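(* Let $\lambda=(\lambda_1,\lambda_2,0)$ with integers $\lambda_1>\lambda_2>0$, and enumerate the basis vectors $v_0,v_1,\dots$ of $V^R_\mu(\lambda)$ on $\mathcal{O}(U_q(3))$ as $v_i=\xi_{O_2^i(\mathbf T_0)}$ (see context). Suppose these basis vectors are of type (b), and that $$v_i=(k^* )^{d_1}(-qh^* )^{d_2}(q^2g^* )^{d_3}b^{c_2}c^{c_3}D_q^{d_1+d_2+d_3},\qquad v_{i+k}=(k^* )^{d_1+k}(-qh^* )^{d_2-k}(q^2g^* )^{d_3}b^{c_2-k}c^{c_3+k}D_q^{d_1+d_2+d_3}$$ with $0\le k\le\min(d_2,c_2)$. (The exponent and index $k$ is an integer; the base $k$ is a generator.) Then $$\langle v_i,v_{i+k}\rangle_L=\mathbf h(v_i^*v_{i+k})=q^{2d_2d_3+2d_1d_2+2d_1d_3+4d_3+4d_1+4d_2+2c_2c_3+4c_2+4c_3+k(d_2+c_2-k)}\,\frac{(1-q^2)^2(1-q^4)(q^2;q^2)_{d_2}(q^2;q^2)_{c_2}}{(q^2;q^2)_{c_2+c_3+1}(q^2;q^2)_{d_1+d_2+d_3+1}}$$ $$\times\sum_{j=0}^{d_1}\frac{(-1)^jq^{j^2-j}\binom{d_1}{j}_{q^2}\binom{c_3}{j}_{q^2}(q^2;q^2)_j}{(q^{2d_3+2c_2+2c_3+2d_1-2j+4};q^2)_{d_2+1}}\sum_{p=0}^{d_2-k}q^{(2c_2+2c_3+2d_1-2j+2)p}(q^2;q^2)_{c_3+d_2+d_1-j-p}(q^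2;q^2)_{d_3+p}\binom{d_2-k}{p}_{q^2}.$$
   Context: Let $q$ be real, $q\notin\{0,1,-1\}$. $\mathcal{O}(Mat_q(3))$ is the unital associative $\mathbb{C}$-algebra generated by $x_{i,j}$, $1\le i,j\le 3$, with relations, for $i<l$ and $j<k$: $x_{i,j}x_{l,j}=q\,x_{l,j}x_{i,j}$, $x_{i,j}x_{i,k}=q\,x_{i,k}x_{i,j}$, $x_{i,k}x_{l,j}=x_{l,j}x_{i,k}$, $x_{i,j}x_{l,k}=x_{l,k}x_{i,j}+(q-q^{-1})x_{i,k}x_{l,j}$, with algebra homomorphisms $\Delta(x_{i,j})=\sum_{p}x_{i,p}\otimes x_{p,j}$, $\varepsilon(x_{i,j})=\delta_{i,j}$. For $I=\{i_1<\dots<i_r\}$, $J=\{j_1<\dots<j_r\}$ put $\xi^I_J=\sum_{\tau\in\mathfrak S_r}(-q)^{\ell(\tau)}x_{i_1,j_{\tau(1)}}\cdots x_{i_r,j_{\tau(r)}}$ ($\ell$ = number of inversions); $D_q=\xi^{\{1,2,3\}}_{\{1,2,3\}}$ is central. Adjoin a central inverse $\mathrm{det}_q^{-1}$ of $D_q$ with $\Delta(\mathrm{det}_q^{-1})=\mathrm{det}_q^{-1}\otimes\mathrm{det}_q^{-1}$ to obtain the Hopf algebra $\mathcal{O}(GL_q(3))$. $\mathcal{O}(U_q(3))$ is this algebra with the conjugate-linear anti-multiplicative involution $x_{i,j}^*=(-q)^{j-i}\xi_{\hat j}^{\hat i}\,\mathrm{det}_q^{-1}$, $D_q^*=\mathrm{det}_q^{-1}$,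 where $\hat p=\{1,2,3\}\setminus\{p\}$. The Haar state $\mathbf h$ is the unique linear functional with $\mathbf h(1)=1$ and $(\mathrm{id}\otimes \mathbf h)\Delta(x)=\mathbf h(x)1=(\mathbf h\otimes\mathrm{id})\Delta(x)$ for all $x$; $\langle\varphi,\psi\rangle_L=\mathbf h(\varphi^*\psi)$. Generators are renamed $\begin{bmatrix} x_{1,1} & x_{1,2} & x_{1,3} \\ x_{2,1} & x_{2,2} & x_{2,3} \\ x_{3,1} & x_{3,2} & x_{3,3} \end{bmatrix}=\begin{bmatrix} a & b & c \\ d & e & f \\ g & h & k \end{bmatrix}$ (the Haar state is boldface to distinguish it from the generator $h$). For $\lambda=(\lambda_1,\lambda_2,0)$ and a semistandard Young tableau $\mathbf T$ of shape $\lambda$ with entries in $\{1,2,3\}$ and column contents $J_1,\dots,J_{\lambda_1}$ (left to right), put $\xi_{\mathbf T}=\xi^{\{1,\dots,|J_1|\}}_{J_1}\cdots\xi^{\{1,\dots,|J_{\lambda_1}|\}}_{J_{\lambda_1}}$. The $\xi_{\mathbf T}$ form a basis of an irreducible right co-module $V^R(\lambda)$, and $V^R_\mu(\lambda)$ is the span of those $\xi_{\mathbf T}$ with $\mathbf T$ of content $\mu$. Columns correspond to $\xi_{\{1,2\}}^{\{1,2\}}=k^*D_q$, $\xi^{\{1,2\}}_{\{1,3\}}=-qh^*D_q$, $\xi^{\{1,2\}}_{\{2,3\}}=q^2g^*D_q$, $\xi^{\{1\}}_{\{1\}}=a$, $\xi^{\{1\}}_{\{2\}}=b$, $\xi^{\{1\}}_{\{3\}}=c$.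 Type (b): $\mathbf T$ has first row $1^{d_1+d_2}2^{d_3+c_2}3^{c_3}$ and second row $2^{d_1}3^{d_2+d_3}$ (so $d_3$ columns have content $\{2,3\}$ and no single-box column has entry $1$), so $\xi_{\mathbf T}=(k^* )^{d_1}(-qh^* )^{d_2}(q^2g^* )^{d_3}b^{c_2}c^{c_3}D_q^{d_1+d_2+d_3}$. The operation $O_2$ switches a box labelled $2$ in the first row with a box labelled $3$ in the second row (reordering to a tableau). $\mathbf T_0$ is the tableau of content $\mu$ with the largest number of boxes labelled $2$ in the first row, and $v_i=\xi_{O_2^i(\mathbf T_0)}$. Notation: $(x;p)_N=\prod_{i=0}^{N-1}(1-xp^i)$, $(x;p)_0=1$; $\binom{N}{j}_{q^2}=\frac{(q^2;q^2)_N}{(q^2;q^2)_j(q^2;q^2)_{N-j}}$ for $0\le j\le N$ and $0$ for other integers $j$. *)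

(* Defs.v *)
From HB Require Import structures.
From mathcomp Require Import all_boot all_order all_fingroup all_algebra.
From mathcomp Require Import finmap generic_quotient.
From mathcomp Require Import boolp reals complex monalg.

Set Implicit Arguments.
Unset Strict Implicit.
Unset Printing Implicit Defensive.

Import GRing.Theory Num.Theory.

Local Open Scope ring_scope.
Local Open Scope quotient_scope.

Section LinearProp.
Variables (K : pzRingType) (U V : lmodType K) (f : U -> V).
Hypothesis f_lin : linear f.

Lemma linear_0 : f 0 = 0.
Proof. by have := f_lin (-1) 0 0; rewrite scaler0 addr0 scaleN1r addNr. Qed.

Lemma linear_D : {morph f : u v / u + v}.
Proof. by move=> u v; have := f_lin 1 u v; rewrite !scale1r. Qed.

End LinearProp.

Lemma scaler_addACA (K : comPzRingType) (V : lmodType K) (c d : K)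
    (x y s t : V) :
  d *: (c *: x + y) + (c *: s + t) = c *: (d *: x + s) + (d *: y + t).
Proof. by rewrite !scalerDr !scalerA [d * c]mulrC addrACA. Qed.

Section Span.
Variables (K : pzRingType) (V : lmodType K).

Inductive lspan (X : V -> Prop) : V -> Prop :=
| lspan0 : lspan X 0
| lspanP a u v : X u -> lspan X v -> lspan X (a *: u + v).

Variable X : V -> Prop.

Lemma lspanD u v : lspan X u -> lspan X v -> lspan X (u + v).
Proof.
move=> Xu Xv; elim: Xu => [|a x y Xx _ IH]; first by rewrite add0r.
by rewrite -addrA; apply: lspanP.
Qed.

Lemma lspanZ a v : lspan X v -> lspan X (a *: v).
Proof.
elim=> [|b x y Xx _ IH]; first by rewrite scaler0; apply: lspan0.
by rewrite scalerDr scalerA; apply: lspanP.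
Qed.

Lemma lspanN v : lspan X v -> lspan X (- v).
Proof. by rewrite -scaleN1r; apply: lspanZ. Qed.

Lemma lspan_gen u : X u -> lspan X u.
Proof.
by move=> Xu; rewrite -[u]addr0 -[u]scale1r; apply: lspanP => //; apply: lspan0.
Qed.

Definition span_equiv : rel V := fun u v => `[< lspan X (u - v) >].

Lemma span_equiv_class : equiv_class_of span_equiv.
Proof.
split=> [u|u v|v u w]; first by apply/asboolP; rewrite subrr; apply: lspan0.
  by apply/asboolP/asboolP => /lspanN; rewrite opprB.
move=> /asboolP uv /asboolP vw; apply/asboolP.
by rewrite -[u](subrK v) -addrA; apply: lspanD.
Qed.

Canonical span_equiv_equiv := EquivRelPack span_equiv_class.
Canonical span_equiv_enc := defaultEncModRel span_equiv.

(* The quotient of V by the submodule spanned by X. *)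
Definition quomod := {eq_quot span_equiv}.

HB.instance Definition _ := Choice.on quomod.

Definition quorepr (x : quomod) : V := repr x.

End Span.

(* The operations on quotients and on tensor products are locked: unfolding
   them during unification is very slow. *)
HB.lock Definition quo (K : pzRingType) (V : lmodType K) (X : V -> Prop)
  (v : V) : quomod X := \pi_(quomod X) v.

HB.lock Definition quoadd (K : pzRingType) (V : lmodType K) (X : V -> Prop)
  (x y : quomod X) : quomod X := quo X (quorepr x + quorepr y).

HB.lock Definition quoopp (K : pzRingType) (V : lmodType K) (X : V -> Prop)
  (x : quomod X) : quomod X := quo X (- quorepr x).

HB.lock Definition quoscale (K : pzRingType) (V : lmodType K) (X : V -> Prop)
  (a : K) (x : quomod X) : quomod X := quo X (a *: quorepr x).

Section QuotientModule.
Variables (K : pzRingType) (V : lmodType K) (X : V -> Prop).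

Local Notation quo := (quo X).

Lemma quoP u v : quo u = quo v <-> lspan X (u - v).
Proof.
rewrite unlock; split=> [/eqmodP/asboolP //|uv].
exact/eqmodP/asboolP.
Qed.

Lemma quo_repr (x : quomod X) : quo (quorepr x) = x.
Proof. by rewrite unlock; apply: reprK. Qed.

Lemma quoaddE u v : quoadd (quo u) (quo v) = quo (u + v).
Proof.
rewrite [quoadd]unlock; apply/quoP; rewrite opprD addrACA.
by apply: lspanD; apply/quoP; rewrite quo_repr.
Qed.

Lemma quooppE u : quoopp (quo u) = quo (- u).
Proof.
rewrite [quoopp]unlock; apply/quoP; rewrite -opprD.
by apply/lspanN/quoP; rewrite quo_repr.
Qed.

Lemma quoscaleE a u : quoscale a (quo u) = quo (a *: u).
Proof.
rewrite [quoscale]unlock; apply/quoP; rewrite -scalerBr.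
by apply/lspanZ/quoP; rewrite quo_repr.
Qed.

Let quoE := (quoaddE, quooppE, quoscaleE).

Lemma quoaddA : associative (@quoadd K V X).
Proof.
move=> x y z; rewrite -[x]quo_repr -[y]quo_repr -[z]quo_repr.
by rewrite !quoE addrA.
Qed.
Lemma quoaddC : commutative (@quoadd K V X).
Proof.
by move=> x y; rewrite -[x]quo_repr -[y]quo_repr !quoE addrC.
Qed.
Lemma quoadd0 : left_id (quo 0) (@quoadd K V X).
Proof. by move=> x; rewrite -[x]quo_repr !quoE add0r. Qed.
Lemma quoaddN : left_inverse (quo 0) (@quoopp K V X) (@quoadd K V X).
Proof. by move=> x; rewrite -[x]quo_repr !quoE addNr. Qed.

HB.instance Definition _ := GRing.isZmodule.Build (quomod X)
  quoaddA quoaddC quoadd0 quoaddN.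

Lemma quoD u v : quo (u + v) = quo u + quo v.
Proof. by rewrite -quoaddE. Qed.

Lemma quoB : zmod_morphism quo.
Proof. by move=> u v; rewrite quoD -quooppE. Qed.

HB.instance Definition _ := GRing.isZmodMorphism.Build V (quomod X) quo quoB.

Lemma quoscaleA a b (x : quomod X) :
  quoscale a (quoscale b x) = quoscale (a * b) x.
Proof. by rewrite -[x]quo_repr !quoE scalerA. Qed.
Lemma quoscale1 : left_id 1 (@quoscale K V X).
Proof. by move=> x; rewrite -[x]quo_repr !quoE scale1r. Qed.
Lemma quoscaleDr : right_distributive (@quoscale K V X) +%R.
Proof.
move=> a x y; rewrite -[x]quo_repr -[y]quo_repr -quoD !quoE.
by rewrite scalerDr quoD.
Qed.
Lemma quoscaleDl (x : quomod X) :
  {morph (@quoscale K V X)^~ x : a b / a + b}.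
Proof. by move=> a b; rewrite -[x]quo_repr !quoE scalerDl quoD. Qed.

HB.instance Definition _ := GRing.Zmodule_isLmodule.Build K (quomod X)
  quoscaleA quoscale1 quoscaleDr quoscaleDl.

Lemma quoZ a v : quo (a *: v) = a *: quo v.
Proof. by rewrite -quoscaleE. Qed.

HB.instance Definition _ := GRing.isScalable.Build K V (quomod X) *:%R quo quoZ.

End QuotientModule.

(* The two-sided ideal generated by X is the span of ideal_gen X. *)
Inductive ideal_gen (K : comNzRingType) (F : algType K) (X : F -> Prop) :
    F -> Prop :=
| IdealGen a r b of X r : ideal_gen X (a * r * b).

Definition quoalg (K : comNzRingType) (F : algType K) (X : F -> Prop) :=
  quomod (ideal_gen X).

HB.lock Definition quomul (K : comNzRingType) (F : algType K) (X : F -> Prop)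
  (x y : quoalg X) : quoalg X :=
  quo (ideal_gen X) (quorepr x * quorepr y).

Section QuotientAlgebra.
Variables (K : comNzRingType) (F : algType K) (X : F -> Prop).

HB.instance Definition _ := GRing.Lmodule.on (quoalg X).

Definition quoa (x : F) : quoalg X := quo (ideal_gen X) x.

Lemma ideal_genMl a x : lspan (ideal_gen X) x -> lspan (ideal_gen X) (a * x).
Proof.
elim=> [|c _ v [b r d Xr] _ IH]; first by rewrite mulr0; apply: lspan0.
by rewrite mulrDr -scalerAr !mulrA; apply: lspanP.
Qed.

Lemma ideal_genMr a x : lspan (ideal_gen X) x -> lspan (ideal_gen X) (x * a).
Proof.
elim=> [|c _ v [b r d Xr] _ IH]; first by rewrite mul0r; apply: lspan0.
by rewrite mulrDl -scalerAl -[b * r * d * a]mulrA; apply: lspanP.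
Qed.

Lemma quoaP x y : quoa x = quoa y <-> lspan (ideal_gen X) (x - y).
Proof. exact: quoP. Qed.

Lemma quoa_repr (x : quoalg X) : quoa (quorepr x) = x.
Proof. exact: quo_repr. Qed.

Lemma quoaD x y : quoa (x + y) = quoa x + quoa y.
Proof. exact: quoD. Qed.

Lemma quoaZ a x : quoa (a *: x) = a *: quoa x.
Proof. exact: quoZ. Qed.

HB.instance Definition _ := GRing.isZmodMorphism.Build F (quoalg X) quoa
  (@quoB _ _ (ideal_gen X)).
HB.instance Definition _ := GRing.isScalable.Build K F (quoalg X) *:%R quoa
  quoaZ.

Lemma quomulE x y : quomul (quoa x) (quoa y) = quoa (x * y).
Proof.
rewrite unlock; apply/quoaP; set x' := quorepr _; set y' := quorepr _.
have -> : x' * y' - x * y = (x' - x) * y' + x * (y' - y).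
  by rewrite mulrBl mulrBr addrA subrK.
by apply: lspanD; [apply: ideal_genMr | apply: ideal_genMl];
  apply/quoaP; rewrite quoa_repr.
Qed.

Lemma quomulA : associative (@quomul K F X).
Proof.
move=> x y z; rewrite -[x]quoa_repr -[y]quoa_repr -[z]quoa_repr.
by rewrite !quomulE mulrA.
Qed.
Lemma quomul1l : left_id (quoa 1) (@quomul K F X).
Proof. by move=> x; rewrite -[x]quoa_repr quomulE mul1r. Qed.
Lemma quomul1r : right_id (quoa 1) (@quomul K F X).
Proof. by move=> x; rewrite -[x]quoa_repr quomulE mulr1. Qed.
Lemma quomulDl : left_distributive (@quomul K F X) +%R.
Proof.
move=> x y z; rewrite -[x]quoa_repr -[y]quoa_repr -[z]quoa_repr.
by rewrite -quoaD !quomulE mulrDl quoaD.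
Qed.
Lemma quomulDr : right_distributive (@quomul K F X) +%R.
Proof.
move=> x y z; rewrite -[x]quoa_repr -[y]quoa_repr -[z]quoa_repr.
by rewrite -quoaD !quomulE mulrDr quoaD.
Qed.

HB.instance Definition _ := GRing.Zmodule_isPzRing.Build (quoalg X)
  quomulA quomul1l quomul1r quomulDl quomulDr.

Lemma quoaM x y : quoa (x * y) = quoa x * quoa y.
Proof. by rewrite -quomulE. Qed.

HB.instance Definition _ := GRing.isMonoidMorphism.Build F (quoalg X) quoa
  (conj (erefl _) quoaM).

Lemma quoa_scaleAl a (x y : quoalg X) : a *: (x * y) = (a *: x) * y.
Proof.
rewrite -[x]quoa_repr -[y]quoa_repr -quoaZ -!quoaM -quoaZ.
by rewrite scalerAl.
Qed.

Lemma quoa_scaleAr a (x y : quoalg X) : a *: (x * y) = x * (a *: y).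
Proof.
rewrite -[x]quoa_repr -[y]quoa_repr -quoaZ -!quoaM -quoaZ.
by rewrite scalerAr.
Qed.

End QuotientAlgebra.

Section FreeAlgebra.
Variables (K : comNzRingType) (G : choiceType).

Definition freealg := {malg K[{fmonom G}]}.

HB.instance Definition _ := GRing.Lalgebra.on freealg.

Lemma freealg_scaleAr a (x y : freealg) : a *: (x * y) = x * (a *: y).
Proof.
have aC (z : freealg) : a%:MP * z = z * a%:MP.
  apply/malgP => k; rewrite mcoeffCM.
  rewrite (mcoeffMrw _ (fsubset_refl _) msuppU_le) big_seq_fset1.
  rewrite mcoeffUU.
  have [kz|kz] := boolP (k \in msupp z).
    rewrite (big_fsetD1 k) //= mulm1 eqxx mulr1n mulrC big1_fset ?addr0 //.
    by move=> i; rewrite in_fsetD1 mulm1 => /andP[/negPf->].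
  rewrite mcoeff_outdom // mulr0 big1_fset // => i iz _.
  by rewrite mulm1; case: eqP kz => [<-|]; rewrite ?iz.
by rewrite -!mul_malgC mulrA aC mulrA.
Qed.

HB.instance Definition _ := GRing.Lalgebra_isAlgebra.Build K freealg
  freealg_scaleAr.

Definition fgen (g : G) : freealg := << fmu g >>.

End FreeAlgebra.

Section TensorDef.
Variables (K : comNzRingType) (U V : lmodType K).

Definition free2 := {malg K[(U * V)%type]}.

HB.instance Definition _ := GRing.Lmodule.on free2.

Definition fpair u v : free2 := << (u, v) >>.

Inductive bilinear_rel : free2 -> Prop :=
| bilinear_l a u u' v : bilinear_rel
    (fpair (a *: u + u') v - (a *: fpair u v + fpair u' v))
| bilinear_r a u v v' : bilinear_rel
    (fpair u (a *: v + v') - (a *: fpair u v + fpair u v')).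

Definition tensor := quomod bilinear_rel.

HB.instance Definition _ := GRing.Lmodule.on tensor.

End TensorDef.

HB.lock Definition tens (K : comNzRingType) (U V : lmodType K) (u : U) (v : V) :
  tensor U V := quo (@bilinear_rel K U V) (fpair u v).

(* The linear map induced by B, meaningful when B is bilinear. *)
HB.lock Definition tens_lift (K : comNzRingType) (U V W : lmodType K)
    (B : U -> V -> W) (t : tensor U V) : W :=
  \sum_(k <- msupp (quorepr t)) (quorepr t)@_k *: B k.1 k.2.

Section Tensor.
Variables (K : comNzRingType) (U V : lmodType K).
Local Notation bilinear_rel := (@bilinear_rel K U V).
Local Notation free2 := (free2 U V).
Local Notation tensor := (tensor U V).
Implicit Types (u : U) (v : V).

Lemma tensE u v : tens u v = quo bilinear_rel (fpair u v).
Proof. by rewrite unlock. Qed.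

Lemma tens_linl v : linear (fun u => tens u v).
Proof.
move=> a u u'; rewrite !tensE -linearZ -raddfD /=.
exact/quoP/lspan_gen/bilinear_l.
Qed.

Lemma tens_linr u : linear (fun v => tens u v).
Proof.
move=> a v v'; rewrite !tensE -linearZ -raddfD /=.
exact/quoP/lspan_gen/bilinear_r.
Qed.

Definition bilin (W : lmodType K) (B : U -> V -> W) :=
  (forall v, linear (B^~ v)) /\ (forall u, linear (B u)).

Lemma free2E (g : free2) :
  g = \sum_(k <- msupp g) g@_k *: fpair k.1 k.2.
Proof.
rewrite [LHS]monalgE; apply: eq_bigr => -[u v] _.
by apply/malgP => k; rewrite mcoeffZ !mcoeffU mulrnAr mulr1.
Qed.

Lemma tensor_ind (P : tensor -> Prop) : P 0 ->
  (forall a u v t, P t -> P (a *: tens u v + t)) -> forall t, P t.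
Proof.
move=> P0 PD t; rewrite -[t]quo_repr [quorepr t]free2E raddf_sum /=.
elim: (enum_fset _) => [|k s IH]; first by rewrite big_nil.
by rewrite big_cons (quoZ bilinear_rel) -tensE; apply: PD.
Qed.

Section Lift.
Variables (W : lmodType K) (B : U -> V -> W).

Definition free2_lift (g : free2) : W :=
  \sum_(k <- msupp g) g@_k *: B k.1 k.2.

Lemma free2_liftw (d : {fset (U * V)%type}) g : (msupp g `<=` d)%fset ->
  free2_lift g = \sum_(k <- d) g@_k *: B k.1 k.2.
Proof.
move=> le; rewrite /free2_lift (big_fset_incl _ le) => //= x xd /mcoeff_outdom.
by move=> ->; rewrite scale0r.
Qed.

Lemma free2_lift_linear : linear free2_lift.
Proof.
move=> a g h; pose d := (msupp g `|` msupp h)%fset.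
rewrite (@free2_liftw d g) ?fsubsetUl // (@free2_liftw d h) ?fsubsetUr //.
rewrite (@free2_liftw d).
  rewrite scaler_sumr -big_split /=; apply: eq_bigr => k _.
  by rewrite mcoeffD mcoeffZ scalerDl scalerA.
apply: (fsubset_trans (msuppD_le _ _)); apply: fsetSU; exact: msuppZ_le.
Qed.

HB.instance Definition _ :=
  GRing.isLinear.Build K free2 W *:%R free2_lift free2_lift_linear.

Lemma free2_lift_pair u v : free2_lift (fpair u v) = B u v.
Proof.
by rewrite (free2_liftw msuppU_le) big_seq_fset1 mcoeffUU scale1r.
Qed.

Hypothesis Bbilin : bilin B.

Lemma free2_lift_ker g : lspan bilinear_rel g -> free2_lift g = 0.
Proof.
case: Bbilin => Bl Br.
have rel0 h : bilinear_rel h -> free2_lift h = 0.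
  by case=> [a u u' v|a u v v']; rewrite raddfB /= free2_lift_linear
    !free2_lift_pair ?(Bl v) ?(Br u) subrr.
elim=> [|a r h /rel0 r0 _ IH]; first exact: raddf0.
by rewrite free2_lift_linear r0 IH scaler0 addr0.
Qed.

Lemma tens_lift_quo g : tens_lift B (quo _ g) = free2_lift g.
Proof.
rewrite [tens_lift]unlock.
apply/eqP; rewrite -subr_eq0 -[X in X - _]/(free2_lift _) -raddfB /=.
by apply/eqP/free2_lift_ker/quoP; rewrite quo_repr.
Qed.

Lemma tens_liftE u v : tens_lift B (tens u v) = B u v.
Proof. by rewrite tensE tens_lift_quo free2_lift_pair. Qed.

Lemma tens_lift_linear : linear (tens_lift B).
Proof.
move=> a s t; rewrite -[s]quo_repr -[t]quo_repr -linearP.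
by rewrite !tens_lift_quo linearP.
Qed.

End Lift.
End Tensor.

(* The product (a # b) t, where # stands for the tensor sign *)
HB.lock Definition tmulr (K : comNzRingType) (A B : algType K) (a : A) (b : B)
  (t : tensor A B) : tensor A B :=
  tens_lift (fun a' b' => tens (a * a') (b * b')) t.

HB.lock Definition tmul (K : comNzRingType) (A B : algType K)
  (s t : tensor A B) : tensor A B :=
  tens_lift (fun a b => tmulr a b t) s.

Section TensorAlgebra.
Variables (K : comNzRingType) (A B : algType K).

Local Notation T := (tensor A B).
Implicit Types (s t : T).

Lemma tmulr_def (a : A) (b : B) t :
  tmulr a b t = tens_lift (fun a' b' => tens (a * a') (b * b')) t.
Proof. by rewrite unlock. Qed.

Lemma tmul_def s t : tmul s t = tens_lift (fun a b => tmulr a b t) s.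
Proof. by rewrite unlock. Qed.

Lemma tmulr_bilin (a : A) (b : B) :
  bilin (fun a' b' => tens (a * a') (b * b') : T).
Proof.
split=> [b'|a'] c x y; rewrite mulrDr -scalerAr;
  [exact: tens_linl | exact: tens_linr].
Qed.

Lemma tmulr_linear (a : A) (b : B) : linear (fun t => tmulr a b t).
Proof.
move=> c s t; rewrite !tmulr_def.
exact: (tens_lift_linear (tmulr_bilin a b)).
Qed.

Lemma tmulrE (a : A) (b : B) (a' : A) (b' : B) : tmulr a b (tens a' b') = tens (a * a') (b * b').
Proof. by rewrite tmulr_def (tens_liftE (tmulr_bilin a b)). Qed.

Lemma tmulr0 (a : A) (b : B) : tmulr a b 0 = 0.
Proof. exact: (linear_0 (tmulr_linear a b)). Qed.

Lemma tmul_bilin t : bilin (fun a b => tmulr a b t).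
Proof.
split=> [b|a] c x y; elim/tensor_ind: t => [|d a' b' t IH].
- by rewrite !tmulr0 scaler0 addr0.
- rewrite !tmulr_linear IH !tmulrE mulrDl -scalerAl.
  by rewrite (tens_linl (b * b')); exact: scaler_addACA.
- by rewrite !tmulr0 scaler0 addr0.
rewrite !tmulr_linear IH !tmulrE mulrDl -scalerAl.
by rewrite (tens_linr (a * a')); exact: scaler_addACA.
Qed.

Lemma tmul_linearl t : linear (fun s => tmul s t).
Proof.
move=> a s s'; rewrite !tmul_def.
exact: (tens_lift_linear (tmul_bilin t)).
Qed.

Lemma tmul_tens (a : A) (b : B) t : tmul (tens a b) t = tmulr a b t.
Proof. by rewrite tmul_def; exact/tens_liftE/tmul_bilin. Qed.

Lemma tmulE (a a' : A) (b b' : B) :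
  tmul (tens a b) (tens a' b') = tens (a * a') (b * b').
Proof. by rewrite tmul_tens tmulrE. Qed.

Lemma tmulDl : left_distributive (@tmul K A B) +%R.
Proof. by move=> s s' t; exact: (linear_D (tmul_linearl t)). Qed.

Lemma tmul0l t : tmul 0 t = 0.
Proof. exact: (linear_0 (tmul_linearl t)). Qed.

Lemma tmul_linearr s : linear (fun t => tmul s t).
Proof.
move=> c t t'; elim/tensor_ind: s => [|d a b s IH].
  by rewrite !tmul0l scaler0 addr0.
rewrite !(tmul_linearl _ d) !tmul_tens IH tmulr_linear.
exact: scaler_addACA.
Qed.

Lemma tmul0r s : tmul s 0 = 0.
Proof. exact: (linear_0 (tmul_linearr s)). Qed.

Lemma tmulDr : right_distributive (@tmul K A B) +%R.
Proof. by move=> s t t'; exact: (linear_D (tmul_linearr s)). Qed.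

Lemma tmulA : associative (@tmul K A B).
Proof.
move=> s t u; elim/tensor_ind: s => [|c a b s IH]; first by rewrite !tmul0l.
rewrite !(tmul_linearl _ c) IH; congr (_ *: _ + _).
elim/tensor_ind: t {IH} => [|d a' b' t IH].
  by rewrite tmul0r !tmul0l tmul0r.
rewrite (tmul_linearl _ d) !(tmul_linearr (tens a b)) (tmul_linearl _ d) IH.
congr (_ *: _ + _).
elim/tensor_ind: u {IH} => [|e x y u IH]; first by rewrite !tmul0r.
by rewrite !(tmul_linearr _ e) IH !tmulE !mulrA.
Qed.

Lemma tmul1l : left_id (tens 1 1) (@tmul K A B).
Proof.
elim/tensor_ind => [|c a b t IH]; first exact: tmul0r.
by rewrite tmul_linearr IH tmulE !mul1r.
Qed.

Lemma tmul1r : right_id (tens 1 1) (@tmul K A B).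
Proof.
elim/tensor_ind => [|c a b t IH]; first exact: tmul0l.
by rewrite tmul_linearl IH tmulE !mulr1.
Qed.

HB.instance Definition _ := GRing.Zmodule_isPzRing.Build T
  tmulA tmul1l tmul1r tmulDl tmulDr.

End TensorAlgebra.

Section QuantumMinor.
Variables (K : pzRingType) (A : lalgType K) (q : K) (x : 'I_3 -> 'I_3 -> A).

Definition inversions n (t : 'S_n) : nat :=
  #|[set p : 'I_n * 'I_n | (p.1 < p.2)%N && (t p.2 < t p.1)%N]|.

(* xi^I_J, used for #|I| = #|J|; enum lists a set of ordinals in increasing
   order. *)
Definition qminor (I J : {set 'I_3}) : A :=
  \sum_(t : 'S_#|I|) (- q) ^+ inversions t *:
    \prod_(m < #|I|) x (nth ord0 (enum I) m) (nth ord0 (enum J) (t m)).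

End QuantumMinor.

Lemma qminor_counit (K : comNzRingType) (A : lalgType K) (q : K)
    (x : 'I_3 -> 'I_3 -> A) (f : {rmorphism A -> K}) (I : {set 'I_3}) :
  (forall a u, f (a *: u) = a * f u) ->
  (forall i j, f (x i j) = (i == j)%:R) ->
  f (qminor q x I I) = 1.
Proof.
move=> fZ fx; rewrite /qminor rmorph_sum (bigD1 1%g) //= fZ rmorph_prod /=.
have -> : inversions (1%g : 'S_#|I|) = 0%N.
  apply/eqP; rewrite cards_eq0; apply/eqP/setP => -[i j].
  by rewrite !inE !perm1 /= ltnNge; case: ltngtP.
rewrite expr0 mul1r !big1 ?addr0 // => [t t1|m _]; last by rewrite fx perm1 eqxx.
rewrite fZ rmorph_prod /=.
have [m mt] : exists m, t m != m.
  apply/existsP; rewrite -negb_forall; apply: contra t1 => /forallP H.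
  by apply/eqP/permP => m; rewrite perm1; apply/eqP.
rewrite (bigD1 m) //= fx nth_uniq ?enum_uniq -?cardE // eq_sym val_eqE.
by rewrite (negPf mt) mul0r mulr0.
Qed.

(* The defining relations, for elements x i j and t of an algebra; t is the
   inverse of the quantum determinant. *)
Inductive GLq_rel (K : fieldType) (A : algType K) (q : K)
    (x : 'I_3 -> 'I_3 -> A) (t : A) : A -> Prop :=
| GLq_col (i l j : 'I_3) of (i < l)%N :
    GLq_rel q x t (x i j * x l j - q *: (x l j * x i j))
| GLq_row (i j k : 'I_3) of (j < k)%N :
    GLq_rel q x t (x i j * x i k - q *: (x i k * x i j))
| GLq_anti (i l j k : 'I_3) of (i < l)%N & (j < k)%N :
    GLq_rel q x t (x i k * x l j - x l j * x i k)
| GLq_diag (i l j k : 'I_3) of (i < l)%N & (j < k)%N :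
    GLq_rel q x t (x i j * x l k
                   - (x l k * x i j + (q - q^-1) *: (x i k * x l j)))
| GLq_detV_central i j : GLq_rel q x t (t * x i j - x i j * t)
| GLq_detV : GLq_rel q x t (t * qminor q x setT setT - 1).

Lemma GLq_rel_counit (K : fieldType) (A : algType K) (q : K)
    (x : 'I_3 -> 'I_3 -> A) (t u : A) (f : {rmorphism A -> K}) :
  (forall a v, f (a *: v) = a * f v) ->
  (forall i j, f (x i j) = (i == j)%:R) -> f t = 1 ->
  GLq_rel q x t u -> f u = 0.
Proof.
move=> fZ fx ft.
have nlt (i j : 'I_3) : (i < j)%N -> (i == j) = false.
  by move=> ij; apply/negbTE; rewrite neq_ltn ij.
case=> [i l j il|i j k jk|i l j k il jk|i l j k il jk|i j|];
  rewrite rmorphB ?rmorphD ?fZ !rmorphM /= ?fx.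
- case: (eqVneq i j) => [<-|_]; last by rewrite !(mul0r, mulr0) subrr.
  by rewrite eq_sym nlt // !(mul0r, mulr0) subrr.
- case: (eqVneq i j) => [->|_]; last by rewrite !(mul0r, mulr0) subrr.
  by rewrite nlt // !(mul0r, mulr0) subrr.
- by rewrite mulrC subrr.
- rewrite [X in _ - (X + _)]mulrC opprD addNKr.
  case: (eqVneq i k) => [ik|_]; last by rewrite mul0r mulr0 oppr0.
  case: (eqVneq l j) => [lj|_]; last by rewrite mulr0 mulr0 oppr0.
  by move: il jk; rewrite ik lj ltnNge => /negP kl /ltnW.
- by rewrite mulrC subrr.
by rewrite ft (qminor_counit _ _ fZ fx) rmorph1 mulr1 subrr.
Qed.

Lemma GLq_ideal_counit (K : fieldType) (A : algType K) (q : K)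
    (x : 'I_3 -> 'I_3 -> A) (t u : A) (f : {rmorphism A -> K}) :
  (forall a v, f (a *: v) = a * f v) ->
  (forall i j, f (x i j) = (i == j)%:R) -> f t = 1 ->
  lspan (ideal_gen (GLq_rel q x t)) u -> f u = 0.
Proof.
move=> fZ fx ft; elim=> [|a _ v [b r c r0] _ IH]; first exact: rmorph0.
rewrite rmorphD fZ !rmorphM /= (GLq_rel_counit fZ fx ft r0) IH.
by rewrite mulr0 mul0r mulr0 addr0.
Qed.

(* Some (i, j) stands for the generator x_(i+1,j+1), None for the inverse of
   the quantum determinant. *)
Definition GLq_gen := option ('I_3 * 'I_3).

HB.instance Definition _ := Choice.on GLq_gen.

Section QuantumGroup.
Variables (K : fieldType) (q : K).

Local Notation F := (freealg K GLq_gen).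

Definition free_x (i j : 'I_3) : F := fgen K (Some (i, j) : GLq_gen).
Definition free_detV : F := fgen K (None : GLq_gen).

Definition GLq_ideal_gens : F -> Prop := GLq_rel q free_x free_detV.

Definition OGLq := quoalg GLq_ideal_gens.

HB.instance Definition _ := GRing.PzRing.on OGLq.
HB.instance Definition _ := GRing.Lmodule.on OGLq.

(* The counit of the free algebra shows that OGLq is not the zero ring. *)
Definition gen_counit (g : GLq_gen) : K :=
  if g is Some (i, j) then (i == j)%:R else 1.

Definition monom_counit (m : {fmonom GLq_gen}) : K :=
  \prod_(g <- m : seq _) gen_counit g.

Lemma monom_counit_morph : mmorphism monom_counit.
Proof.
split; last by rewrite /monom_counit fm1 big_nil.
by move=> m m'; rewrite /monom_counit fmM big_cat.
Qed.

HB.instance Definition _ :=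
  isMultiplicative.Build {fmonom GLq_gen} K monom_counit monom_counit_morph.

Definition free_counit : F -> K := mmap idfun monom_counit.

HB.instance Definition _ := GRing.RMorphism.on free_counit.

Lemma free_counit_fgen g : free_counit (fgen K g) = gen_counit g.
Proof.
by rewrite /free_counit mmapU mul1r /monom_counit fmuE big_seq1.
Qed.

Lemma OGLq_nontrivial : (1 : OGLq) != 0.
Proof.
apply/eqP => /esym E.
have {}E : quoa GLq_ideal_gens 1 = quoa GLq_ideal_gens 0.
  by rewrite (raddf0 (quoa GLq_ideal_gens)) E.
move/quoaP: E; rewrite subr0 => I1.
have /eqP : free_counit 1 = 0.
  apply: GLq_ideal_counit I1 => [a u|i j|]; first exact: mmapZ.
    exact: (free_counit_fgen (Some (i, j))).
  exact: (free_counit_fgen None).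
by rewrite rmorph1 oner_eq0.
Qed.

HB.instance Definition _ :=
  GRing.PzSemiRing_isNonZero.Build OGLq OGLq_nontrivial.
HB.instance Definition _ :=
  GRing.Lmodule_isLalgebra.Build K OGLq (@quoa_scaleAl _ _ GLq_ideal_gens).
HB.instance Definition _ :=
  GRing.Lalgebra_isAlgebra.Build K OGLq (@quoa_scaleAr _ _ GLq_ideal_gens).

End QuantumGroup.

HB.lock Definition gx (K : fieldType) (q : K) (i j : 'I_3) : OGLq q :=
  quoa (GLq_ideal_gens q) (free_x K i j).

HB.lock Definition gdetV (K : fieldType) (q : K) : OGLq q :=
  quoa (GLq_ideal_gens q) (free_detV K).

Lemma qminor_morph (K : fieldType) (A B : algType K) (f : A -> B) (q : K)
    (x : 'I_3 -> 'I_3 -> A) (I J : {set 'I_3}) :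
  linear f -> monoid_morphism f ->
  f (qminor q x I J) = qminor q (fun i j => f (x i j)) I J.
Proof.
move=> fL [f1 fM]; have fZ a u : f (a *: u) = a *: f u.
  by rewrite -[a *: u]addr0 fL (linear_0 fL) addr0.
rewrite /qminor (big_morph f (linear_D fL) (linear_0 fL)).
by apply: eq_bigr => t _; rewrite fZ (big_morph f fM f1).
Qed.

Lemma GLq_rel_morph (K : fieldType) (A B : algType K) (f : A -> B) (q : K)
    (x : 'I_3 -> 'I_3 -> A) (t : A) (u : B) :
  linear f -> monoid_morphism f ->
  GLq_rel q (fun i j => f (x i j)) (f t) u ->
  exists2 v, GLq_rel q x t v & u = f v.
Proof.
move=> fL fM; have [f1 fMM] := fM; have fD := linear_D fL.
have fZ a v : f (a *: v) = a *: f v.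
  by rewrite -[a *: v]addr0 fL (linear_0 fL) addr0.
have fB v w : f (v - w) = f v - f w by rewrite fD -scaleN1r fZ scaleN1r.
case=> [i l j il|i j k jk|i l j k il jk|i l j k il jk|i j|].
- by eexists; [apply: (GLq_col _ _ _ j il) | rewrite fB fZ !fMM].
- by eexists; [apply: (GLq_row _ _ _ i jk) | rewrite fB fZ !fMM].
- by eexists; [apply: (GLq_anti _ _ _ il jk) | rewrite fB !fMM].
- by eexists; [apply: (GLq_diag _ _ _ il jk) | rewrite fB fD fZ !fMM].
- by eexists; [apply: (GLq_detV_central _ _ _ i j) | rewrite fB !fMM].
by eexists; [apply: GLq_detV | rewrite fB fMM f1 (qminor_morph _ _ _ _ fL fM)].
Qed.

Lemma gx_rel (K : fieldType) (q : K) (u : OGLq q) :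
  GLq_rel q (gx q) (gdetV q) u -> u = 0.
Proof.
pose pi (v : freealg K GLq_gen) : OGLq q := quoa (GLq_ideal_gens q) v.
have gxE : gx q = (fun i j => pi (free_x K i j)).
  by apply/funext => i; apply/funext => j; rewrite unlock.
have tE : gdetV q = pi (free_detV K) by rewrite unlock.
have piL : linear pi by move=> a v w; rewrite /pi quoaD quoaZ.
have piM : monoid_morphism pi by split=> // v w; rewrite /pi quoaM.
rewrite gxE tE => /(GLq_rel_morph piL piM)[v Xv ->].
rewrite -(linear_0 piL); apply/quoaP; rewrite subr0; apply: lspan_gen.
by rewrite -[v]mulr1 -[v]mul1r; apply: IdealGen.
Qed.

Definition xi (K : fieldType) (q : K) (I J : {set 'I_3}) : OGLq q :=
  qminor q (gx q) I J.

Definition qdet (K : fieldType) (q : K) : OGLq q := xi q setT setT.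

(* O(U_q(3)), for q in a realType, is O(GL_q(3)) over the complex numbers
   together with the involution described by is_Uq_star. *)
Notation OUq q := (OGLq (real_complex _ q)).

Section HopfStructure.
Variables (R : realType) (q : R).

Local Notation K := R[i].
Local Notation Q := (real_complex R q).
Local Notation A := (OUq q).

Definition is_comult (Delta : A -> tensor A A) : Prop :=
  [/\ linear Delta,
      monoid_morphism Delta,
      forall i j, Delta (gx Q i j) = \sum_(p < 3) tens (gx Q i p) (gx Q p j)
    & Delta (gdetV Q) = tens (gdetV Q) (gdetV Q)].

Definition is_Uq_star (star : A -> A) : Prop :=
  [/\ forall (a : K) (u v : A), star (a *: u + v) = a^* *: star u + star v,
      forall u v, star (u * v) = star v * star u,
      forall u, star (star u) = u,
      forall i j : 'I_3, star (gx Q i j) =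
        (- Q) ^ (j%:Z - i%:Z) *: (xi Q [set~ i] [set~ j] * gdetV Q)
    & star (qdet Q) = gdetV Q].

(* The maps id # h and h # id on A # A, where # stands for the tensor sign and
   A # K is identified with A. *)
Definition id_tens (h : A -> K) : tensor A A -> A :=
  tens_lift (fun a b => h b *: a).
Definition tens_id (h : A -> K) : tensor A A -> A :=
  tens_lift (fun a b => h a *: b).

(* These conditions determine h: two such functionals h and h' agree because
   both h x and h' x are equal to (h # h')(Delta x). *)
Definition is_haar_state (Delta : A -> tensor A A) (h : A -> K) : Prop :=
  [/\ scalar h,
      h 1 = 1,
      forall x, id_tens h (Delta x) = h x *: 1
    & forall x, tens_id h (Delta x) = h x *: 1].

Definition innerL (star : A -> A) (h : A -> K) (u v : A) : K :=
  h (star u * v).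

End HopfStructure.

Section Tableaux.

(* The ordinals of 'I_3 start at 0: o1, o2, o3 are the entries and the indices
   written 1, 2, 3. *)
Definition o1 : 'I_3 := @Ordinal 3 0 isT.
Definition o2 : 'I_3 := @Ordinal 3 1 isT.
Definition o3 : 'I_3 := @Ordinal 3 2 isT.

(* The first and the second row. *)
Definition tableau := (seq 'I_3 * seq 'I_3)%type.

Definition le3 (a b : 'I_3) : bool := (a <= b)%N.

Definition semistandard (l1 l2 : nat) (T : tableau) : bool :=
  [&& size T.1 == l1, size T.2 == l2, sorted le3 T.1, sorted le3 T.2
    & [forall m : 'I_l2, (nth o1 T.1 m < nth o1 T.2 m)%N]].

Definition content (T : tableau) (p : 'I_3) : nat :=
  count_mem p T.1 + count_mem p T.2.

Definition ssyt (l1 l2 : nat) (mu : 'I_3 -> nat) (T : tableau) : bool :=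
  semistandard l1 l2 T && [forall p, content T p == mu p].

Definition column (T : tableau) (m : nat) : {set 'I_3} :=
  [set:: nth o1 T.1 m :: take 1 (drop m T.2)].

Definition xiT (K : fieldType) (q : K) (T : tableau) : OGLq q :=
  \prod_(m < size T.1)
    xi q [set i : 'I_3 | (i < #|column T m|)%N] (column T m).

(* Only meaningful when there is an entry 2 in the first row and an entry 3 in
   the second one; the result may fail to be semistandard. *)
Definition O2 (T : tableau) : tableau :=
  (sort le3 (o3 :: rem o2 T.1), sort le3 (o2 :: rem o3 T.2)).

Definition top_tableau (l1 l2 : nat) (mu : 'I_3 -> nat) (T0 : tableau) : Prop :=
  ssyt l1 l2 mu T0 /\
  forall T, ssyt l1 l2 mu T -> (count_mem o2 T.1 <= count_mem o2 T0.1)%N.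

Definition type_b_tableau (d1 d2 d3 c2 c3 : nat) : tableau :=
  (nseq (d1 + d2) o1 ++ nseq (d3 + c2) o2 ++ nseq c3 o3,
   nseq d1 o2 ++ nseq (d2 + d3) o3).

Definition type_b (T : tableau) : Prop :=
  exists d1 d2 d3 c2 c3 : nat, T = type_b_tableau d1 d2 d3 c2 c3.

End Tableaux.

Definition qpoch (R : fieldType) (x p : R) (N : nat) : R :=
  \prod_(i < N) (1 - x * p ^+ i).

Definition qbinom (R : fieldType) (p : R) (N j : nat) : R :=
  if (j <= N)%N then qpoch p p N / (qpoch p p j * qpoch p p (N - j)) else 0.

(* Main.v *)
(** The Haar state kills the skew derivations of O(U_q(3)) dual to the root
    vectors E_1, E_2 and F_2 of U_q(gl_3). Applied to a product of two words in
    the letters b, c, k^*, h^*, g^* and their adjoints, this yields linear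
    recursions between the pairings of words; E_1 creates a letter a, which the
    q-Pluecker relation turns back into letters b and c. Together with
    g g^* + h h^* + k k^* = 1 and a^* a + q^-2 b^* b + q^-4 c^* c = 1, which
    compare words of different lengths, the recursions determine every pairing.
    For k = d2 the solution is a product, and the double sum of the theorem is
    then a terminating balanced 3phi2, summed by the q-Saalschuetz formula. The
    other values of k follow by induction on d2 and descending induction on k:
    the recursion attached to E_1 holds for each term of the sum over j,
    because the sums over p satisfy a contiguous relation of 2phi1 type. *)

Require Import Defs.
From HB Require Import structures.
From mathcomp Require Import all_boot all_order all_fingroup all_algebra.
From mathcomp Require Import finmap boolp reals complex monalg.
From mathcomp Require Import ring zify.

Set Implicit Arguments.
Unset Strict Implicit.
Unset Printing Implicit Defensive.

Import GRing.Theory Num.Theory.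

Local Open Scope ring_scope.

(** * Representations of the quantum group *)

(** The functionals dual to root vectors are read off from representations of the presented algebra
    by upper triangular 2x2 matrices. Slicing the second tensor factor of the comultiplication with
    such a functional alters only column indices, so a word in letters of fixed rows remains a
    combination of such words. All recursions obtained in this way preserve the two lengths d1 + d2
    + d3 and c2 + c3, hence cannot fix a normalization. The two unitarity relations can: each
    expresses a norm through words one letter longer, and the unknown ratio between norm and closed
    form is thereby forced to be 1, starting from the value 1 at the empty word. Once the relations
    are available, the pairing is treated as an arbitrary function of ten exponents satisfying them,
    and the remaining work takes place in a field. Truncated predecessors such as [f2.-1] are
    harmless throughout: at 0 they come with a coefficient 1 - q^0. *)

Lemma GLq_rel_image (K : fieldType) (A B : algType K) (f : A -> B) (q : K)
    (x : 'I_3 -> 'I_3 -> A) (t v : A) : linear f -> monoid_morphism f ->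
  GLq_rel q x t v -> GLq_rel q (fun i j => f (x i j)) (f t) (f v).
Proof.
move=> fL fM; have [f1 fMM] := fM; have fD := linear_D fL.
have fZ a w : f (a *: w) = a *: f w.
  by rewrite -[a *: w]addr0 fL (linear_0 fL) addr0.
have fB w w' : f (w - w') = f w - f w' by rewrite fD -scaleN1r fZ scaleN1r.
case=> [i l j il|i j k jk|i l j k il jk|i l j k il jk|i j|].
- by rewrite fB fZ !fMM; apply: GLq_col.
- by rewrite fB fZ !fMM; apply: GLq_row.
- by rewrite fB !fMM; apply: GLq_anti.
- by rewrite fB fD fZ !fMM; apply: GLq_diag.
- by rewrite fB !fMM; apply: GLq_detV_central.
by rewrite fB fMM f1 (qminor_morph _ _ _ _ fL fM); apply: GLq_detV.
Qed.

Section UniversalProperty.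
Variables (K : fieldType) (q : K) (B : algType K).
Variables (x : 'I_3 -> 'I_3 -> B) (t : B).

Definition gen_image (g : GLq_gen) : B :=
  if g is Some (i, j) then x i j else t.

Definition monom_image (m : {fmonom GLq_gen}) : B :=
  \prod_(g <- m : seq _) gen_image g.

Lemma monom_image_morph : mmorphism monom_image.
Proof.
split; last by rewrite /monom_image fm1 big_nil.
by move=> m m'; rewrite /monom_image fmM big_cat.
Qed.

HB.instance Definition _ :=
  isMultiplicative.Build {fmonom GLq_gen} B monom_image monom_image_morph.

Definition free_image : freealg K GLq_gen -> B :=
  mmap (in_alg B) monom_image.

Lemma free_image_morph : monoid_morphism free_image.
Proof.
have [|mM m1] := @commr_mmap_is_multiplicative _ _ _ (in_alg B) monom_image.
  by move=> g m m'; rewrite /GRing.comm /= mulr_algl mulr_algr.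
by split.
Qed.

Lemma free_image_linear : linear free_image.
Proof.
by move=> a u v; rewrite /free_image mmapD mmapZ /= mulr_algl.
Qed.

Lemma free_image_fgen g : free_image (fgen K g) = gen_image g.
Proof.
by rewrite /free_image mmapU /= scale1r mul1r /monom_image fmuE big_seq1.
Qed.

Hypothesis x_rel : forall u, GLq_rel q x t u -> u = 0.

Lemma free_image_ideal u :
  lspan (ideal_gen (GLq_ideal_gens q)) u -> free_image u = 0.
Proof.
have [f1 fM] := free_image_morph; have fL := free_image_linear.
have fx : (fun i j => free_image (free_x K i j)) = x.
  by apply/funext => i; apply/funext => j; apply: free_image_fgen.
have ft : free_image (free_detV K) = t by exact: free_image_fgen.
elim=> [|a _ v [b r c r0] _ IH]; first exact: linear_0.
have rel0 : free_image r = 0.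
  by apply: x_rel; rewrite -[X in GLq_rel _ X]fx -ft; apply: GLq_rel_image r0.
by rewrite fL IH (fM (b * r) c) (fM b r) rel0 mulr0 mul0r scaler0 addr0.
Qed.

(** The map evaluates a chosen representative; [free_image_ideal] makes the value independent of the
    choice, which gives linearity and multiplicativity. *)
Lemma OGLq_universal : exists f : OGLq q -> B,
  [/\ linear f, monoid_morphism f, forall i j, f (gx q i j) = x i j
    & f (gdetV q) = t].
Proof.
have [f1 fM] := free_image_morph; have fL := free_image_linear.
pose f (u : OGLq q) := free_image (quorepr u).
have fE v : f (quoa (GLq_ideal_gens q) v) = free_image v.
  apply/eqP; rewrite /f -subr_eq0; apply/eqP.
  rewrite addrC -scaleN1r -fL addrC scaleN1r.
  by apply: free_image_ideal; apply/quoaP; rewrite quoa_repr.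
exists f; split.
- move=> a u v; rewrite -[u]quoa_repr -[v]quoa_repr -quoaZ -quoaD.
  by rewrite !fE fL.
- split; first by rewrite fE f1.
  by move=> u v; rewrite -[u]quoa_repr -[v]quoa_repr -quoaM !fE fM.
- by move=> i j; rewrite unlock fE free_image_fgen.
by rewrite unlock fE free_image_fgen.
Qed.

End UniversalProperty.

(** * Explicit expansion of 2x2 and 3x3 quantum minors *)

Lemma inversionsE n (t : 'S_n) :
  inversions t = (\sum_(i < n) \sum_(j < n) ((i < j) && (t j < t i)))%N.
Proof.
rewrite /inversions -sum1_card pair_bigA /= big_mkcond /=.
by apply: eq_bigr => p _; rewrite inE; case: ifP.
Qed.

(** A list of n! distinct permutations exhausts the symmetric group; this turns the sum defining a
    quantum minor into an explicit polynomial. *)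
Lemma sum_perm_seq (V : nmodType) n (s : seq 'S_n) (F : 'S_n -> V) :
  uniq s -> size s = n`! -> \sum_t F t = \sum_(t <- s) F t.
Proof.
move=> us ss; rewrite (big_uniq _ us) /=; apply: eq_bigl => t; apply/esym.
suff /eqP E : [set t in s] == [set: 'S_n].
  by have := in_setT t; rewrite -E inE.
rewrite eqEcard subsetT /= cardsT card_Sn -ss.
by rewrite cardsE (card_uniqP us).
Qed.

Definition seq_fun n (s : seq 'I_n.+1) (i : 'I_n.+1) : 'I_n.+1 := nth ord0 s i.

Lemma seq_fun_inj n (s : seq 'I_n.+1) :
  uniq s -> size s = n.+1 -> injective (seq_fun s).
Proof.
move=> us ss i j /eqP; rewrite /seq_fun nth_uniq ?ss ?ltn_ord //.
by move/eqP/val_inj.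
Qed.

Section Minors.
Variables (K : pzRingType) (A : lalgType K) (q : K) (x : 'I_3 -> 'I_3 -> A).

Let i0 : 'I_2 := ord0.
Let i1 : 'I_2 := lift ord0 ord0.

Lemma qminor2 (I J : {set 'I_3}) a b c d : enum I = [:: a; b] ->
  enum J = [:: c; d] ->
  qminor q x I J = x a c * x b d - q *: (x a d * x b c).
Proof.
rewrite /qminor => EI EJ; rewrite EJ EI; move: (cardE I); rewrite EI /=.
(* The type ['S_#|I|] depends on the cardinal, so the cardinal is abstracted first and only then
   replaced by 2. *)
move: #|I| => n ->.
have u1 : uniq [:: i0; i1] by [].
have u2 : uniq [:: i1; i0] by [].
pose p1 := perm (seq_fun_inj u1 erefl); pose p2 := perm (seq_fun_inj u2 erefl).
rewrite (@sum_perm_seq _ _ [:: p1; p2]) //; last first.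
  by rewrite /= inE andbT; apply/eqP => /permP/(_ i0); rewrite !permE.
rewrite big_cons big_seq1 !inversionsE !big_ord_recl !big_ord0 !permE /=.
by rewrite !mulr1 expr0 expr1 scale1r scaleNr.
Qed.

Lemma qminor3 (I J : {set 'I_3}) a b c d e f : enum I = [:: a; b; c] ->
  enum J = [:: d; e; f] ->
  qminor q x I J = x a d * x b e * x c f - q *: (x a d * x b f * x c e)
    - q *: (x a e * x b d * x c f) + q ^+ 2 *: (x a e * x b f * x c d)
    + q ^+ 2 *: (x a f * x b d * x c e) - q ^+ 3 *: (x a f * x b e * x c d).
Proof.
rewrite /qminor => EI EJ; rewrite EJ EI; move: (cardE I); rewrite EI /=.
move: #|I| => n ->.
pose p (s : seq 'I_3) us ss := perm (@seq_fun_inj 2 s us ss).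
rewrite (@sum_perm_seq _ _
  [:: p [:: o1; o2; o3] isT erefl; p [:: o1; o3; o2] isT erefl;
      p [:: o2; o1; o3] isT erefl; p [:: o2; o3; o1] isT erefl;
      p [:: o3; o1; o2] isT erefl; p [:: o3; o2; o1] isT erefl]) //; last first.
  apply: (@map_uniq _ _ (fun t : 'S_3 => (t o1, t o2))).
  by rewrite /= !permE.
rewrite !big_cons big_nil !inversionsE !big_ord_recl !big_ord0 !permE /=.
rewrite !mulr1 expr0 expr1 scale1r addr0 !mulrA.
have E3 : (- q) ^+ 3 = - q ^+ 3 by rewrite exprS sqrrN mulNr -exprS.
by rewrite E3 sqrrN !scaleNr !addrA.
Qed.
End Minors.

Lemma enum_I3 : enum 'I_3 = [:: o1; o2; o3].
Proof. by apply: (inj_map val_inj); rewrite val_enum_ord. Qed.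

Lemma enum_setT3 : enum [set: 'I_3] = [:: o1; o2; o3].
Proof. by rewrite -enum_I3 enum_setT enumT. Qed.

Lemma enum_I3_filter (I : {set 'I_3}) :
  enum I = [seq i <- [:: o1; o2; o3] | i \in I].
Proof. by rewrite -enum_I3 enumT. Qed.

Lemma enum_compl1 : enum [set~ o1] = [:: o2; o3].
Proof. by rewrite enum_I3_filter /= !inE. Qed.

Lemma enum_compl2 : enum [set~ o2] = [:: o1; o3].
Proof. by rewrite enum_I3_filter /= !inE. Qed.

Lemma enum_compl3 : enum [set~ o3] = [:: o1; o2].
Proof. by rewrite enum_I3_filter /= !inE. Qed.

(** Words in the generators span the algebra, so a linear property need only survive left
    multiplication by a generator. The counit axiom and the centrality of [gdetV] are checked in
    this way. *)
Lemma OGLq_ind (K : fieldType) (q : K) (P : OGLq q -> Prop) :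
  P 1 -> (forall a u v, P u -> P v -> P (a *: u + v)) ->
  (forall i j u, P u -> P (gx q i j * u)) ->
  (forall u, P u -> P (gdetV q * u)) -> forall u, P u.
Proof.
move=> P1 PL Px Pt u; pose pi := quoa (GLq_ideal_gens q).
have P0 : P 0 by rewrite -(addNr 1) -scaleN1r; apply: PL.
have Pm (s : seq GLq_gen) : P (pi (<< FMonom s >> : freealg K GLq_gen)).
  elim: s => [|g s IH].
    suff -> : (<< FMonom [::] >> : freealg K GLq_gen) = 1 by rewrite /pi
      rmorph1.
    have -> : FMonom [::] = mone :> {fmonom GLq_gen} by apply: val_inj; rewrite
      /= fm1.
    by [].
  have -> : (<< FMonom (g :: s) >> : freealg K GLq_gen) =
      fgen K g * << FMonom s >>.
    rewrite /fgen -[RHS]/(fgmul _ _) fgmulUU mulr1.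
    by congr (<< _ *g _ >>); apply: val_inj; rewrite /= fmM fmuE.
  rewrite /pi quoaM; case: g => [[i j]|].
    by have := Px i j _ IH; rewrite [gx]unlock.
  by have := Pt _ IH; rewrite [gdetV]unlock.
rewrite -[u]quoa_repr [quorepr u]monalgE.
elim: (enum_fset _) => [|[s] r IH]; first by rewrite big_nil raddf0.
rewrite big_cons; suff -> : << (quorepr u)@_(FMonom s) *g FMonom s >> =
    (quorepr u)@_(FMonom s) *: << FMonom s >> :> freealg K GLq_gen.
  by rewrite quoaD quoaZ; apply: PL.
by apply/malgP => m; rewrite mcoeffZ !mcoeffU mulrnAr mulr1.
Qed.

(** * Functionals dual to the root vectors *)

Section SkewFunctional.
Variables (K : fieldType) (q : K).
Hypothesis q0 : q != 0.

(* A representation by upper triangular matrices whose second diagonal entry is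
   the counit: the first diagonal entry is a character, and the entry above the
   diagonal is a skew derivation with respect to both. *)
Definition upper2 (a d b : K) : 'M[K]_2 :=
  \matrix_(i, j) (if i == j then if i == ord0 then a else b
                  else if i == ord0 then d else 0).

Lemma upper2P (A B : 'M[K]_2) : reflect
  [/\ A ord0 ord0 = B ord0 ord0, A ord0 ord_max = B ord0 ord_max,
      A ord_max ord0 = B ord_max ord0 & A ord_max ord_max = B ord_max ord_max]
  (A == B).
Proof.
apply: (iffP eqP) => [->//|[H1 H2 H3 H4]]; apply/matrixP => i j.
have two (k : 'I_2) : k = ord0 \/ k = ord_max.
  by case: k => [[|[|//]]] ?; [left|right]; apply: val_inj.
by case: (two i) => ->; case: (two j) => ->.
Qed.

Lemma upper2D a d b a' d' b' :
  upper2 a d b + upper2 a' d' b' = upper2 (a + a') (d + d') (b + b').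
Proof. by apply/eqP/upper2P; rewrite !mxE /= addr0. Qed.

Lemma upper2Z k a d b : k *: upper2 a d b = upper2 (k * a) (k * d) (k * b).
Proof. by apply/eqP/upper2P; rewrite !mxE /= mulr0. Qed.

Lemma upper2N a d b : - upper2 a d b = upper2 (- a) (- d) (- b).
Proof. by apply/eqP/upper2P; rewrite !mxE /= oppr0. Qed.

Lemma upper2M a d b a' d' b' :
  upper2 a d b * upper2 a' d' b' = upper2 (a * a') (a * d' + d * b') (b * b').
Proof.
by apply/eqP/upper2P; rewrite !mxE !big_ord_recl !big_ord0 !mxE /=
  !(addr0, mulr0, mul0r, add0r).
Qed.

Lemma upper2_1 : 1 = upper2 1 0 1.
Proof. by apply/eqP/upper2P; rewrite !mxE. Qed.

Lemma upper2_0 : 0 = upper2 0 0 0.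
Proof. by apply/eqP/upper2P; rewrite !mxE. Qed.

Definition adjacent_pair (s t : 'I_3) := (t == s.+1 :> nat) || (s == t.+1 :>
  nat).

(** The diagonal of the group-like element attached to the root joining s and t. The smaller index
    carries q whichever of s, t it is, so a raising functional (t < s) and a lowering one (s < t)
    share this element. *)
Definition weight (s t j : 'I_3) : K :=
  if j == (if (s < t)%N then s else t) then q
  else if j == (if (s < t)%N then t else s) then q^-1 else 1.

Definition gx_upper2 (s t i j : 'I_3) : 'M[K]_2 :=
  upper2 (weight s t j * (i == j)%:R) ((i == t) && (j == s))%:R (i == j)%:R.

Lemma ord3P (P : 'I_3 -> Prop) : P o1 -> P o2 -> P o3 -> forall i, P i.
Proof.
move=> P1 P2 P3 [[|[|[|//]]] i3].
- by rewrite (_ : Ordinal i3 = o1) //; apply: val_inj.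
- by rewrite (_ : Ordinal i3 = o2) //; apply: val_inj.
by rewrite (_ : Ordinal i3 = o3) //; apply: val_inj.
Qed.

Lemma gx_upper2_rel s t u : adjacent_pair s t ->
  GLq_rel q (gx_upper2 s t) 1 u -> u = 0.
Proof.
move=> st.
have up0 a d b : a = 0 -> d = 0 -> b = 0 -> upper2 a d b = 0.
  by move=> -> -> ->; rewrite upper2_0.
case=> [i l j|i j k|i l j k|i l j k|i j|];
  rewrite /gx_upper2 ?(qminor3 _ _ enum_setT3 enum_setT3) ?upper2_1;
  rewrite !(upper2M, upper2Z, upper2D, upper2N).
- elim/ord3P: i; elim/ord3P: l => // _; elim/ord3P: j;
  move: st; elim/ord3P: s; elim/ord3P: t => // _;
  by apply: up0; rewrite /weight /=; field.
- elim/ord3P: j; elim/ord3P: k => // _; elim/ord3P: i;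
  move: st; elim/ord3P: s; elim/ord3P: t => // _;
  by apply: up0; rewrite /weight /=; field.
- elim/ord3P: i; elim/ord3P: l => // _; elim/ord3P: j; elim/ord3P: k => // _;
  move: st; elim/ord3P: s; elim/ord3P: t => // _;
  by apply: up0; rewrite /weight /=; field.
- elim/ord3P: i; elim/ord3P: l => // _; elim/ord3P: j; elim/ord3P: k => // _;
  move: st; elim/ord3P: s; elim/ord3P: t => // _;
  by apply: up0; rewrite /weight /=; field.
- elim/ord3P: i; elim/ord3P: j; move: st; elim/ord3P: s; elim/ord3P: t => // _;
  by apply: up0; rewrite /weight /=; field.
move: st; elim/ord3P: s; elim/ord3P: t => // _;
by apply: up0; rewrite /weight /=; field.
Qed.

Lemma skew_functional s t : adjacent_pair s t ->
  exists a d b : OGLq q -> K,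
  [/\ [/\ scalar a, scalar d & scalar b],
      [/\ a 1 = 1, d 1 = 0 & b 1 = 1],
      forall u v, [/\ a (u * v) = a u * a v, d (u * v) = a u * d v + d u * b v
                    & b (u * v) = b u * b v],
      forall i j, [/\ a (gx q i j) = weight s t j * (i == j)%:R,
                      d (gx q i j) = ((i == t) && (j == s))%:R
                    & b (gx q i j) = (i == j)%:R]
    & [/\ a (gdetV q) = 1, d (gdetV q) = 0 & b (gdetV q) = 1]].
Proof.
move=> st; have [f [fL [f1 fM] fx ft]] :=
  OGLq_universal (fun u => @gx_upper2_rel s t u st).
(* The lower left entry vanishes on generators, hence on all words; only then are the diagonal
   entries multiplicative. *)
have f10 u : f u ord_max ord0 = 0.
  elim/OGLq_ind: u => [|k u v Hu Hv|i j u Hu|u Hu].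
  - by rewrite f1 upper2_1 mxE.
  - by rewrite fL !mxE Hu Hv mulr0 addr0.
  - rewrite fM fx /gx_upper2 mxE !big_ord_recl big_ord0 !mxE /= mul0r.
    by rewrite (_ : lift _ _ = ord_max) ?Hu ?mulr0 ?addr0 //; apply: val_inj.
  rewrite fM ft mul1r; exact: Hu.
exists (fun u => f u ord0 ord0), (fun u => f u ord0 ord_max),
  (fun u => f u ord_max ord_max); split.
- by split=> k u v; rewrite fL !mxE.
- by rewrite f1 upper2_1 !mxE.
- move=> u v; rewrite fM !mxE !big_ord_recl !big_ord0.
  have -> : lift ord0 ord0 = ord_max :> 'I_2 by exact: val_inj.
  by rewrite !f10 mulr0 mul0r !addr0 add0r.
- by move=> i j; rewrite fx !mxE.
by rewrite ft upper2_1 !mxE.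
Qed.
End SkewFunctional.

(** * Skew derivations killed by the Haar state *)

Lemma linear_scale (K : pzRingType) (U V : lmodType K) (f : U -> V) k u :
  linear f -> f (k *: u) = k *: f u.
Proof. by move=> fL; rewrite -[k *: u]addr0 fL (linear_0 fL) addr0. Qed.

Section SliceMaps.
Variables (K : fieldType) (A : algType K).

Definition slicer (f : A -> K) : tensor A A -> A :=
  tens_lift (fun a b => f b *: a).
Definition slicel (f : A -> K) : tensor A A -> A :=
  tens_lift (fun a b => f a *: b).

Lemma scalar0 (f : A -> K) : scalar f -> f 0 = 0.
Proof. by move=> fL; have := fL (-1) 0 0; rewrite scaler0 addr0 mulN1r addNr.
  Qed.

Lemma scalarZ (f : A -> K) k u : scalar f -> f (k *: u) = k * f u.
Proof. by move=> fL; rewrite -[k *: u]addr0 fL scalar0 ?addr0. Qed.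

Lemma slicer_bilin (f : A -> K) : scalar f -> bilin (fun a b : A => f b *: a).
Proof.
move=> fL; split=> [v|u] k x y.
  by rewrite scalerDr !scalerA mulrC.
by rewrite fL scalerDl scalerA.
Qed.

Lemma slicel_bilin (f : A -> K) : scalar f -> bilin (fun a b : A => f a *: b).
Proof.
move=> fL; split=> [v|u] k x y.
  by rewrite fL scalerDl scalerA.
by rewrite scalerDr !scalerA mulrC.
Qed.

Lemma slicer_linear f : scalar f -> linear (slicer f).
Proof. by move=> fL; apply: tens_lift_linear; apply: slicer_bilin. Qed.

Lemma slicel_linear f : scalar f -> linear (slicel f).
Proof. by move=> fL; apply: tens_lift_linear; apply: slicel_bilin. Qed.

Lemma slicerE f a b : scalar f -> slicer f (tens a b) = f b *: a.
Proof. by move=> fL; apply: tens_liftE; apply: slicer_bilin. Qed.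

Lemma slicelE f a b : scalar f -> slicel f (tens a b) = f a *: b.
Proof. by move=> fL; apply: tens_liftE; apply: slicel_bilin. Qed.

Lemma slicer0 f : scalar f -> slicer f 0 = 0.
Proof. by move=> fL; exact: (linear_0 (slicer_linear fL)). Qed.

Lemma slicel0 f : scalar f -> slicel f 0 = 0.
Proof. by move=> fL; exact: (linear_0 (slicel_linear fL)). Qed.

Lemma slicer_mul (f g g' f' e : A -> K) (s t : tensor A A) :
  scalar f -> scalar g -> scalar f' -> scalar g' -> scalar e ->
  (forall u v, e (u * v) = f u * g v + f' u * g' v) ->
  slicer e (s * t) = slicer f s * slicer g t + slicer f' s * slicer g' t.
Proof.
move=> fL gL f'L g'L eL eM.
elim/tensor_ind: s => [|k a b s IH].
  by rewrite mul0r !slicer0 // !mul0r addr0.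
have -> : (k *: tens a b + s) * t = k *: (tens a b * t) + s * t.
  exact: (tmul_linearl t).
rewrite !slicer_linear // !mulrDl IH addrACA -!scalerAl -scalerDr.
congr (k *: _ + _); rewrite !slicerE //; clear IH.
elim/tensor_ind: t => [|l a' b' t IH].
  by rewrite mulr0 !slicer0 // !mulr0 addr0.
have -> : tens a b * (l *: tens a' b' + t) =
    l *: (tens a b * tens a' b') + tens a b * t.
  exact: (tmul_linearr (tens a b)).
rewrite !slicer_linear // !mulrDr IH addrACA -!scalerAr -scalerDr.
congr (l *: _ + _); rewrite [tens a b * _]tmulE !slicerE // eM.
by rewrite -!scalerAl -!scalerAr !scalerA scalerDl.
Qed.

Lemma slice_exchange f g t : scalar f -> scalar g ->
  g (slicer f t) = f (slicel g t).
Proof.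
move=> fL gL; elim/tensor_ind: t => [|k u v w IH].
  by rewrite slicer0 // slicel0 // !scalar0.
by rewrite slicer_linear // slicel_linear // fL gL IH slicerE // slicelE //
  !scalarZ // [f v * _]mulrC.
Qed.

Variables (Delta : A -> tensor A A) (haar : A -> K).
Hypotheses (DL : linear Delta) (DM : monoid_morphism Delta).
Hypotheses (hL : scalar haar) (hI : forall u, slicel haar (Delta u) = haar u *:
  1).

Lemma slicer_comult_linear f : scalar f -> linear (fun u => slicer f (Delta u)).
Proof. by move=> fL k u v; rewrite DL slicer_linear. Qed.

Lemma slicer_comult1 f : scalar f -> slicer f (Delta 1) = f 1 *: 1.
Proof. by move=> fL; case: DM => -> _; rewrite -[1]/(tens 1 1) slicerE. Qed.

Lemma slicer_comultM f u v : scalar f ->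
  (forall u v, f (u * v) = f u * f v) ->
  slicer f (Delta (u * v)) = slicer f (Delta u) * slicer f (Delta v).
Proof.
move=> fL fM; case: DM => _ ->.
have zL : scalar (fun _ : A => 0 : K) by move=> k x y /=; rewrite mulr0 addr0.
rewrite (@slicer_mul f f (fun _ => 0) (fun _ => 0)) //; last first.
  by move=> u' v'; rewrite fM mul0r addr0.
suff -> : slicer (fun _ => 0) (Delta u) = 0 by rewrite mul0r addr0.
elim/tensor_ind: (Delta u) => [|k x y w IH]; first exact: slicer0.
by rewrite slicer_linear // IH slicerE // scale0r scaler0 addr0.
Qed.

(** Exchanging the two slices reduces the claim to f applied to h(u) 1. In particular a functional
    with f 1 = 0 yields an operator whose image the Haar state kills. *)
Lemma haar_slicer f u : scalar f -> haar (slicer f (Delta u)) = haar u * f 1.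
Proof. by move=> fL; rewrite slice_exchange // hI scalarZ. Qed.

End SliceMaps.

Section SkewDerivation.
Variables (R : realType) (q : R).

Local Notation K := R[i].
Local Notation Q := (real_complex R q).
Local Notation A := (OUq q).

Variables (Delta : A -> tensor A A) (haar : A -> K).
Hypotheses (Q0 : Q != 0) (Delta_comult : is_comult Delta)
  (haar_Uq : is_haar_state Delta haar).

Lemma slicer_gx (f : A -> K) i j : scalar f ->
  slicer f (Delta (gx Q i j)) = \sum_(p < 3) f (gx Q p j) *: gx Q i p.
Proof.
move=> fL; case: Delta_comult => _ _ -> _.
rewrite (big_morph _ (linear_D (slicer_linear fL)) (slicer0 fL)).
by apply: eq_bigr => p _; rewrite slicerE.
Qed.

(** [Kop] and [E] are the slices of the comultiplication by the character a and the skew functional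
    d. The slice by b is the identity, since b is the counit; this is why v itself appears in the
    last term of the Leibniz rule. *)
Lemma skew_derivation s t : adjacent_pair s t -> exists Kop E : A -> A,
  [/\ [/\ linear Kop, linear E & forall u, haar (E u) = 0],
      [/\ Kop 1 = 1, forall u v, Kop (u * v) = Kop u * Kop v
        & forall u v, E (u * v) = Kop u * E v + E u * v],
      forall i j, Kop (gx Q i j) = weight Q s t j *: gx Q i j,
      forall i j, E (gx Q i j) = (j == s)%:R *: gx Q i t
    & Kop (gdetV Q) = gdetV Q /\ E (gdetV Q) = 0].
Proof.
move=> st; have [DL DM Dx Dt] := Delta_comult.
have [hL _ _ hI] := haar_Uq.
have [a [d [b [[aL dL bL] [a1 d1 b1] M x t1]]]] := skew_functional Q0 st.
have odV f : scalar f -> slicer f (Delta (gdetV Q)) = f (gdetV Q) *: gdetV Q.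
  by move=> fL; rewrite Dt slicerE.
have aM u' v' : a (u' * v') = a u' * a v' by case: (M u' v').
have bM u' v' : b (u' * v') = b u' * b v' by case: (M u' v').
have ob u : slicer b (Delta u) = u.
  elim/OGLq_ind: u => [|k u v Hu Hv|i j u Hu|u Hu].
  - by rewrite (slicer_comult1 DM) // b1 scale1r.
  - by rewrite (slicer_comult_linear DL bL k u v) Hu Hv.
  - rewrite (slicer_comultM DM) // Hu; congr (_ * _); rewrite slicer_gx //.
    rewrite (bigD1 j) //= big1 => [|p pj].
      by case: (x j j) => _ _ ->; rewrite eqxx scale1r addr0.
    by case: (x p j) => _ _ ->; rewrite (negPf pj) scale0r.
  rewrite (slicer_comultM DM) // Hu odV //; case: t1 => _ _ ->.
  by rewrite scale1r.
exists (fun u => slicer a (Delta u)), (fun u => slicer d (Delta u)); split.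
- split; [exact: slicer_comult_linear|exact: slicer_comult_linear|move=> u].
  by rewrite (haar_slicer hL hI) // d1 mulr0.
- split; first by rewrite (slicer_comult1 DM) // a1 scale1r.
    by move=> u v; rewrite (slicer_comultM DM).
  case: DM => _ DM' u v; rewrite DM' (@slicer_mul _ _ a d b d) ?ob //.
  by move=> u' v'; case: (M u' v').
- move=> i j; rewrite slicer_gx // (bigD1 j) //= big1 => [|p pj].
    by case: (x j j) => -> _ _; rewrite eqxx mulr1 addr0.
  by case: (x p j) => -> _ _; rewrite (negPf pj) mulr0 scale0r.
- move=> i j; rewrite slicer_gx // (bigD1 t) //= big1 => [|p pt].
    by case: (x t j) => _ -> _; rewrite eqxx addr0.
  by case: (x p j) => _ -> _; rewrite (negPf pt) scale0r.
by rewrite !odV //; case: t1 => -> -> _; rewrite scale1r scale0r.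
Qed.
End SkewDerivation.

Section SkewPowers.
Variables (K : fieldType) (A : algType K) (Kop E : A -> A).
Hypotheses (KL : linear Kop) (EL : linear E) (K1 : Kop 1 = 1)
  (KM : forall u v, Kop (u * v) = Kop u * Kop v)
  (EM : forall u v, E (u * v) = Kop u * E v + E u * v).

Lemma skew1 : E 1 = 0.
Proof.
by have /esym/eqP := EM 1 1; rewrite K1 !mul1r mulr1 -subr_eq0 addrK => /eqP.
Qed.

Lemma Kop_exp (x : A) s n : Kop x = s *: x -> Kop (x ^+ n) = s ^+ n *: x ^+ n.
Proof.
move=> Kx; elim: n => [|n IH]; first by rewrite !expr0 K1 scale1r.
by rewrite exprS KM IH Kx -scalerAl -scalerAr scalerA -!exprS.
Qed.

Lemma skew_exp0 (x : A) n : E x = 0 -> E (x ^+ n) = 0.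
Proof.
move=> Ex; elim: n => [|n IH]; first by rewrite expr0 skew1.
by rewrite exprS EM IH Ex mulr0 mul0r addr0.
Qed.

(** The image letter y is collected on the left. Passing i letters x costs s^i from [Kop] and r^i
    from the exchange, whence a geometric sum. This form serves the raising derivations, whose image
    letter precedes x in the words. *)
Lemma skew_expl (x y : A) s m r n : Kop x = s *: x -> E x = m *: y ->
  x * y = r *: (y * x) ->
  E (x ^+ n) = (m * \sum_(i < n) (s * r) ^+ i) *: (y * x ^+ n.-1).
Proof.
move=> Kx Ex xy; elim: n => [|n IH].
  by rewrite expr0 skew1 big_ord0 mulr0 scale0r.
rewrite exprS EM IH Kx Ex big_ord_recl expr0 mulrDr mulr1 scalerDl addrC /=.
congr (_ + _); first by rewrite -scalerAl.
rewrite -scalerAl -scalerAr mulrA xy -!scalerAl !scalerA -mulrA.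
case: n {IH} => [|n]; first by rewrite !big_ord0 !(mulr0, mul0r) !scale0r.
rewrite -[y * x * _]mulrA -exprS /=; congr (_ *: _).
rewrite mulrCA -mulrA; congr (_ * _); rewrite mulrC mulr_sumr.
by apply: eq_bigr => i _; rewrite -exprS.
Qed.

(** Here y is collected on the right: s counts the letters before it, r those it still has to pass.
    This form serves the lowering derivation, whose image letter follows x in the words. *)
Lemma skew_expr (x y : A) s m r n : Kop x = s *: x -> E x = m *: y ->
  y * x = r *: (x * y) ->
  E (x ^+ n) = (m * \sum_(i < n) s ^+ (n.-1 - i) * r ^+ i) *: (x ^+ n.-1 * y).
Proof.
move=> Kx Ex yx; elim: n => [|n IH].
  by rewrite expr0 skew1 big_ord0 mulr0 scale0r.
have yxn : y * x ^+ n = r ^+ n *: (x ^+ n * y).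
  elim: n {IH} => [|n IHn]; first by rewrite !expr0 mulr1 mul1r scale1r.
  rewrite !exprS mulrA yx -scalerAl -[x * y * _]mulrA IHn -scalerAr scalerA.
  by rewrite mulrA.
rewrite exprS EM IH Kx Ex -!scalerAl yxn -!scalerAr !scalerA mulrA.
rewrite big_ord_recr /= subnn expr0 mul1r [m * (_ + _)]mulrDr scalerDl.
congr (_ + _); case: n {IH yxn} => [|n].
  by rewrite !big_ord0 !mulr0 !scale0r.
rewrite [x * (_ * _)]mulrA -exprS /=; congr (_ *: _).
rewrite mulrAC mulrC; congr (_ * _); rewrite mulr_sumr.
apply: eq_bigr => i _; rewrite mulrA -exprS subSn //.
by rewrite -ltnS.
Qed.
End SkewPowers.

(** * Pairings of words *)

Definition skew_der (K : fieldType) (A : algType K) (haar : A -> K)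
    (Kop E : A -> A) : Prop :=
  [/\ [/\ linear Kop, linear E & forall u, haar (E u) = 0], Kop 1 = 1,
      forall u v, Kop (u * v) = Kop u * Kop v
    & forall u v, E (u * v) = Kop u * E v + E u * v].

Definition qsum (K : fieldType) (q : K) n : K :=
  \sum_(i < n) (q^-1 * q^-1) ^+ i.

Definition qsum_sym (K : fieldType) (q : K) n : K :=
  \sum_(i < n) q ^+ (n.-1 - i) * q^-1 ^+ i.

Lemma gatherl (K : fieldType) (A : algType K) k (x y : A) :
  k *: x * y = k *: (x * y).
Proof. by rewrite scalerAl. Qed.

Lemma gatherr (K : fieldType) (A : algType K) k (x y : A) :
  x * (k *: y) = k *: (x * y).
Proof. by rewrite scalerAr. Qed.

Definition gatherE := (gatherl, gatherr, scalerA).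

Lemma scalarD (K : fieldType) (A : algType K) (f : A -> K) u v :
  scalar f -> f (u + v) = f u + f v.
Proof. by move=> fL; have := fL 1 u v; rewrite scale1r mul1r. Qed.

Lemma scalarN (K : fieldType) (A : algType K) (f : A -> K) u :
  scalar f -> f (- u) = - f u.
Proof. by move=> fL; rewrite -scaleN1r scalarZ // mulN1r. Qed.

Section Words.
Variables (K : fieldType) (A : algType K) (q : K) (haar : A -> K).
(* In the application p1, p2, p3 are q^2 g^*, -q h^*, k^*, that is, the 2x2
   minors of the first two rows divided by the determinant; r1, r2, r3 are their
   adjoints q^2 g, -q h, k, and sa, sb, sc are a^*, b^*, c^*. *)
Variables (p1 p2 p3 a b c r1 r2 r3 sa sb sc : A).
Hypotheses (q0 : q != 0) (q21 : 1 - q ^+ 2 != 0).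
Hypothesis haarL : scalar haar.
Hypotheses (p32 : p3 * p2 = q *: (p2 * p3)) (p21 : p2 * p1 = q *: (p1 * p2))
  (p31 : p3 * p1 = q *: (p1 * p3)) (ab : a * b = q *: (b * a))
  (bc : b * c = q *: (c * b)) (r12 : r1 * r2 = q *: (r2 * r1))
  (r23 : r2 * r3 = q *: (r3 * r2)) (scb : sc * sb = q *: (sb * sc))
  (p1a : p1 * a = q^-1 *: (p2 * b) - (q^-1 * q^-1) *: (p3 * c)).

(** In the application this is the adjoint of [rword] with the same exponents, hence the reversed
    order of the letters. *)
Definition lword (d1 d2 d3 c2 c3 : nat) : A :=
  sc ^+ c3 * sb ^+ c2 * r1 ^+ d3 * r2 ^+ d2 * r3 ^+ d1.

Definition rword (d1 d2 d3 c2 c3 : nat) : A :=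
  p3 ^+ d1 * p2 ^+ d2 * p1 ^+ d3 * b ^+ c2 * c ^+ c3.

Definition pairing d1 d2 d3 c2 c3 e1 e2 e3 f2 f3 : K :=
  haar (lword d1 d2 d3 c2 c3 * rword e1 e2 e3 f2 f3).

Local Notation qs := (qsum q).
Local Notation qt := (qsum_sym q).

Lemma qsE n : qs n = q ^+ 2 * (1 - q ^+ n ^+ 2) / (q ^+ n ^+ 2 * (1 - q ^+ 2)).
Proof.
elim: n => [|n IH]; first by rewrite /qsum big_ord0 !expr0 expr1n subrr mulr0
  mul0r.
rewrite /qsum big_ord_recr /= -/(qsum q n) IH.
have -> : (q^-1 * q^-1) ^+ n = (q ^+ n ^+ 2)^-1.
  by rewrite -invfM exprVn -expr2 -!exprM mulnC.
rewrite [q ^+ n.+1]exprS; by have := expf_neq0 n q0 => qn0; field; rewrite qn0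
  q0 q21.
Qed.

Lemma qtE n : qt n = q * (1 - q ^+ n ^+ 2) / (q ^+ n * (1 - q ^+ 2)).
Proof.
have -> : qt n = q ^+ n / q * qs n.
  rewrite /qsum_sym /qsum mulr_sumr; apply: eq_bigr => i _.
  case: n i => [[]//|n] i /=; have lin : (i <= n)%N by rewrite -ltnS.
  rewrite expfB_cond; last by rewrite (negPf q0).
  have qi0 := expf_neq0 i q0; rewrite [q ^+ n.+1]exprS exprMn !exprVn; field.
  by rewrite q0 qi0.
by rewrite qsE; have qn0 := expf_neq0 n q0; field; rewrite qn0 q0 q21.
Qed.

Lemma swap_pow (x y : A) r n : x * y = r *: (y * x) ->
  x ^+ n * y = r ^+ n *: (y * x ^+ n).
Proof.
move=> xy; elim: n => [|n IH]; first by rewrite !expr0 mulr1 mul1r scale1r.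
rewrite [x ^+ n.+1]exprSr -mulrA xy -scalerAr [x ^+ n * (y * x)]mulrA IH
  -scalerAl.
by rewrite scalerA -exprS -mulrA.
Qed.

Lemma swap_powl (x y : A) r n : x * y = r *: (y * x) ->
  x * y ^+ n = r ^+ n *: (y ^+ n * x).
Proof.
move=> xy; elim: n => [|n IH]; first by rewrite !expr0 mulr1 mul1r scale1r.
rewrite [y ^+ n.+1]exprS mulrA xy -scalerAl -[y * x * _]mulrA IH -scalerAr.
by rewrite scalerA -exprS mulrA.
Qed.

Lemma swap_inv (x y : A) : x * y = q *: (y * x) -> y * x = q^-1 *: (x * y).
Proof. by move=> ->; rewrite scalerA mulVf // scale1r. Qed.

Section FirstRoot.
Variables (Kop E : A -> A).
Hypothesis skewE : skew_der haar Kop E.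
Hypotheses (Ksc : Kop sc = 1 *: sc) (Ksb : Kop sb = q *: sb)
  (Ksa : Kop sa = q^-1 *: sa)
  (Kr1 : Kop r1 = q *: r1) (Kr2 : Kop r2 = q^-1 *: r2) (Kr3 : Kop r3 = 1 *: r3)
  (Kp3 : Kop p3 = 1 *: p3) (Kp2 : Kop p2 = q *: p2) (Kp1 : Kop p1 = q^-1 *: p1)
  (Kb : Kop b = q^-1 *: b).
Hypotheses (Esc : E sc = 0) (Esb : E sb = 0) (Er1 : E r1 = 0)
  (Er2 : E r2 = - q^-1 *: r1) (Er3 : E r3 = 0) (Ep3 : E p3 = 0) (Ep2 : E p2 = 0)
  (Ep1 : E p1 = 1 *: p2) (Eb : E b = 1 *: a) (Ec : E c = 0)
  (Esa : E sa = - q^-1 *: sb).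

Lemma root1_lword d1 d2 d3 c2 c3 :
  E (lword d1 d2 d3 c2 c3) =
  (- q ^+ c2 * q ^+ d3 * q^-1 * qs d2) *: lword d1 d2.-1 d3.+1 c2 c3.
Proof.
case: skewE => [[KL EL hE] K1 KM EM].
have Kx := Kop_exp K1 KM; have E0 := skew_exp0 K1 EM.
rewrite /lword !EM !(E0 _ _ Esc, E0 _ _ Esb, E0 _ _ Er1, E0 _ _ Er3) !KM (Kx _
  _ _ Ksc) (Kx _ _ _ Ksb) (Kx _ _ _ Kr1).
rewrite (skew_expl K1 EM _ Kr2 Er2 (swap_inv r12)) -/(qsum q d2).
rewrite !(mulr0, mul0r, addr0, add0r) expr1n scale1r.
rewrite !gatherE.
rewrite exprSr !mulrA; congr (_ *: _); ring.
Qed.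

Lemma root1_Klword d1 d2 d3 c2 c3 :
  Kop (lword d1 d2 d3 c2 c3) =
  (q ^+ c2 * q ^+ d3 * q^-1 ^+ d2) *: lword d1 d2 d3 c2 c3.
Proof.
case: skewE => [[KL EL hE] K1 KM EM]; have Kx := Kop_exp K1 KM.
rewrite /lword !KM (Kx _ _ _ Ksc) (Kx _ _ _ Ksb) (Kx _ _ _ Kr1).
rewrite (Kx _ _ _ Kr2) (Kx _ _ _ Kr3) !expr1n !scale1r.
rewrite !gatherE.
by congr (_ *: _); ring.
Qed.

(* The q-Pluecker relation [p1a] removes the letter a. *)
Lemma p1_pow_a n : p1 ^+ n.+1 * a =
  (q^-1 * q^-1 ^+ n) *: (p2 * (p1 ^+ n * b))
  - (q^-1 * q^-1 * q^-1 ^+ n) *: (p3 * (p1 ^+ n * c)).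
Proof.
rewrite exprSr -mulrA p1a mulrBr !gatherr !mulrA.
rewrite (swap_pow n (swap_inv p21)) (swap_pow n (swap_inv p31)).
by rewrite !gatherE -!mulrA.
Qed.

(** The letter a produced from b is collected to the left of the other letters b, where it meets a
    p1. The exponent of p1 is taken positive so that the Pluecker relation applies there. *)
Lemma root1_rword e1 e2 e3 f2 f3 :
  E (rword e1 e2 e3.+1 f2 f3) =
  (q ^+ e2 * qs e3.+1 + q ^+ e2 * q^-1 ^+ e3.+1 * qs f2 * q^-1 * q^-1 ^+ e3)
     *: rword e1 e2.+1 e3 f2 f3
  - (q ^+ e2 * q^-1 ^+ e2 * q^-1 ^+ e3.+1 * qs f2 * q^-1 ^+ 2 * q^-1 ^+ e3
      * q^-1 ^+ f2.-1) *: rword e1.+1 e2 e3 f2.-1 f3.+1.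
Proof.
case: skewE => [[KL EL hE] K1 KM EM].
have Kx := Kop_exp K1 KM; have E0 := skew_exp0 K1 EM.
rewrite /rword !EM !(E0 _ _ Ep3, E0 _ _ Ep2, E0 _ _ Ec) !KM.
rewrite (Kx _ _ _ Kp3) (Kx _ _ _ Kp2) (Kx _ _ _ Kp1).
rewrite (skew_expl K1 EM _ Kp1 Ep1 (swap_inv p21)) -/(qsum q e3.+1).
rewrite (skew_expl K1 EM _ Kb Eb (swap_inv ab)) -/(qsum q f2).
rewrite !(mulr0, mul0r, addr0, add0r) expr1n scale1r /=.
rewrite scalerDl -addrA [X in _ = X]addrC mulrDl; congr (_ + _); last first.
  rewrite !gatherE exprSr !mulrA; congr (_ *: _); ring.
case: f2 => [|f2] /=.
  by rewrite /qsum !big_ord0 !(mulr0, mul0r, scale0r) subrr.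
rewrite !gatherE -[_ * p1 ^+ _ * _]mulrA [p1 ^+ _ * _]mulrA p1_pow_a.
rewrite mulrBl mulrBr !mulrBl scalerBr !gatherE; congr (_ - _).
  rewrite [p2 ^+ e2.+1]exprSr [b ^+ f2.+1]exprS !mulrA; congr (_ *: _); ring.
rewrite -!mulrA [c * _]mulrA (swap_powl _ (swap_inv bc)) !mulrA.
rewrite -[p3 ^+ e1 * _ * p3]mulrA (swap_pow _ (swap_inv p32)) !gatherE.
rewrite [p3 ^+ e1.+1]exprSr [c ^+ f3.+1]exprS !mulrA; congr (_ *: _); ring.
Qed.

Lemma pairing_root1 d1 d2 d3 c2 c3 e1 e2 e3 f2 f3 :
  q ^+ e3 ^+ 2 * q ^+ 2 * q ^+ f2 ^+ 3 * (1 - q ^+ d2 ^+ 2)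
    * pairing d1 d2.-1 d3.+1 c2 c3 e1 e2 e3.+1 f2 f3 =
  q ^+ d2 * q *
  (q ^+ e2 * q ^+ f2 * (1 - q ^+ 2 * q ^+ e3 ^+ 2 * q ^+ f2 ^+ 2)
     * pairing d1 d2 d3 c2 c3 e1 e2.+1 e3 f2 f3
   - (1 - q ^+ f2 ^+ 2) * pairing d1 d2 d3 c2 c3 e1.+1 e2 e3 f2.-1 f3.+1).
Proof.
have [[KL EL hE] K1 KM EM] := skewE.
have := hE (lword d1 d2 d3 c2 c3 * rword e1 e2 e3.+1 f2 f3).
rewrite EM root1_Klword root1_lword root1_rword mulrBr !gatherE.
rewrite !(scalarD, scalarN, scalarZ) //.
rewrite -!/(pairing _ _ _ _ _ _ _ _ _ _) !qsE !exprVn ![q ^+ e3.+1]exprS.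
have qn0 n : q ^+ n != 0 by exact: expf_neq0.
set X := pairing _ _ _ _ _ _ _ _ _ _; set Y := pairing _ _ _ _ _ _ _ _ _ _.
set Z := pairing _ _ _ _ _ _ _ _ _ _ => rel.
apply/eqP; rewrite -subr_eq0; apply/eqP.
(* Up to this constant, [rel] is the claim with all terms on one side. *)
rewrite -[RHS](mulr0 (- q ^+ e3 ^+ 2 * q * q ^+ f2 ^+ 3 * q ^+ d2 ^+ 2
  * (1 - q ^+ 2) / (q ^+ c2 * q ^+ d3))) -rel.
case: f2 @X @Y @Z {rel} => [|f2] X Y Z /=; last rewrite ![q ^+ f2.+1]exprS.
  by rewrite !expr0; field; rewrite ?(q0, q21, qn0, oner_eq0).
by field; rewrite q0 q21 !qn0.
Qed.

(** The derivation is applied to sb^M sa b^(M+1), where only sa and the letters b contribute. The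
    result eliminates the letters a and a^* that the first-row unitarity relation brings in. *)
Lemma root1_norm M :
  qs M.+1 * haar (sb ^+ M * sa * (a * b ^+ M)) = haar (sb ^+ M.+1 * b ^+ M.+1).
Proof.
have [[KL EL hE] K1 KM EM] := skewE.
have Kx := Kop_exp K1 KM; have E0 := skew_exp0 K1 EM.
have := hE (sb ^+ M * sa * b ^+ M.+1).
rewrite !EM (E0 _ _ Esb) !KM (Kx _ _ _ Ksb) Ksa Esa.
rewrite (skew_expl K1 EM _ Kb Eb (swap_inv ab)) -/(qsum q M.+1) mul1r mul0r
  addr0.
rewrite !gatherE -exprSr !(scalarD, scalarN, scalarZ) //=.
have qn0 n : q ^+ n != 0 by exact: expf_neq0.
move=> rel; apply/eqP; rewrite -subr_eq0; apply/eqP.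
by rewrite -[RHS](mulr0 (q / q ^+ M)) -rel; field; rewrite q0 qn0.
Qed.

End FirstRoot.

Section SecondRoot.
Variables (Kop E : A -> A).
Hypothesis skewE : skew_der haar Kop E.
Hypotheses (Ksc : Kop sc = q *: sc) (Ksb : Kop sb = q^-1 *: sb)
  (Kr1 : Kop r1 = 1 *: r1) (Kr2 : Kop r2 = q *: r2) (Kr3 : Kop r3 = q^-1 *: r3)
  (Kp3 : Kop p3 = q *: p3) (Kp2 : Kop p2 = q^-1 *: p2) (Kp1 : Kop p1 = 1 *: p1)
  (Kb : Kop b = q *: b) (Kc : Kop c = q^-1 *: c).

Lemma root2_Klword d1 d2 d3 c2 c3 :
  Kop (lword d1 d2 d3 c2 c3) =
  (q ^+ c3 * q^-1 ^+ c2 * q ^+ d2 * q^-1 ^+ d1) *: lword d1 d2 d3 c2 c3.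
Proof.
case: skewE => [[KL EL hE] K1 KM EM]; have Kx := Kop_exp K1 KM.
rewrite /lword !KM (Kx _ _ _ Ksc) (Kx _ _ _ Ksb) (Kx _ _ _ Kr1).
rewrite (Kx _ _ _ Kr2) (Kx _ _ _ Kr3) !expr1n !scale1r !gatherE.
by congr (_ *: _); ring.
Qed.

Section Raising.
Hypotheses (Esc : E sc = 0) (Esb : E sb = - q^-1 *: sc) (Er1 : E r1 = 0)
  (Er2 : E r2 = 0) (Er3 : E r3 = - q^-1 *: r2) (Ep3 : E p3 = 0)
  (Ep2 : E p2 = 1 *: p3) (Ep1 : E p1 = 0) (Eb : E b = 0) (Ec : E c = 1 *: b).

Lemma root2_lword d1 d2 d3 c2 c3 :
  E (lword d1 d2 d3 c2 c3) =
  (- q^-1 * q ^+ c3 * q^-1 ^+ c2 * q ^+ d2 * qs d1)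
     *: lword d1.-1 d2.+1 d3 c2 c3
  + (- q^-1 * q ^+ c3 * qs c2) *: lword d1 d2 d3 c2.-1 c3.+1.
Proof.
case: skewE => [[KL EL hE] K1 KM EM].
have Kx := Kop_exp K1 KM; have E0 := skew_exp0 K1 EM.
rewrite /lword !EM !(E0 _ _ Esc, E0 _ _ Er1, E0 _ _ Er2) !KM.
rewrite (Kx _ _ _ Ksc) (Kx _ _ _ Ksb) (Kx _ _ _ Kr1) (Kx _ _ _ Kr2).
rewrite (skew_expl K1 EM _ Ksb Esb (swap_inv scb)) -/(qsum q c2).
rewrite (skew_expl K1 EM _ Kr3 Er3 (swap_inv r23)) -/(qsum q d1).
rewrite !(mulr0, mul0r, addr0, add0r) expr1n scale1r !gatherE.
congr (_ + _).
  by rewrite [r2 ^+ d2.+1]exprSr !mulrA; congr (_ *: _); ring.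
by rewrite [sc ^+ c3.+1]exprSr !mulrA; congr (_ *: _); ring.
Qed.

Lemma root2_rword e1 e2 e3 f2 f3 :
  E (rword e1 e2 e3 f2 f3) =
  (q ^+ e1 * q^-1 ^+ e2 * q ^+ f2 * qs f3) *: rword e1 e2 e3 f2.+1 f3.-1
  + (q ^+ e1 * qs e2) *: rword e1.+1 e2.-1 e3 f2 f3.
Proof.
case: skewE => [[KL EL hE] K1 KM EM].
have Kx := Kop_exp K1 KM; have E0 := skew_exp0 K1 EM.
rewrite /rword !EM !(E0 _ _ Ep3, E0 _ _ Ep1, E0 _ _ Eb) !KM.
rewrite (Kx _ _ _ Kp3) (Kx _ _ _ Kp2) (Kx _ _ _ Kp1) (Kx _ _ _ Kb).
rewrite (skew_expl K1 EM _ Kp2 Ep2 (swap_inv p32)) -/(qsum q e2).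
rewrite (skew_expl K1 EM _ Kc Ec (swap_inv bc)) -/(qsum q f3).
rewrite !(mulr0, mul0r, addr0, add0r) expr1n scale1r !gatherE.
congr (_ + _).
  by rewrite [b ^+ f2.+1]exprSr !mulrA; congr (_ *: _); ring.
by rewrite [p3 ^+ e1.+1]exprSr !mulrA; congr (_ *: _); ring.
Qed.

Lemma pairing_root2 d1 d2 d3 c2 c3 e1 e2 e3 f2 f3 :
  q ^+ e2 ^+ 2 * q ^+ f3 ^+ 2 *
  (q ^+ d1 ^+ 2 * (1 - q ^+ c2 ^+ 2)
     * pairing d1 d2 d3 c2.-1 c3.+1 e1 e2 e3 f2 f3
   + q ^+ d2 * q ^+ c2 * (1 - q ^+ d1 ^+ 2)
     * pairing d1.-1 d2.+1 d3 c2 c3 e1 e2 e3 f2 f3) =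
  q * q ^+ d2 * q ^+ c2 * q ^+ d1 * q ^+ e1 *
  (q ^+ f3 ^+ 2 * (1 - q ^+ e2 ^+ 2)
     * pairing d1 d2 d3 c2 c3 e1.+1 e2.-1 e3 f2 f3
   + q ^+ e2 * q ^+ f2 * (1 - q ^+ f3 ^+ 2)
     * pairing d1 d2 d3 c2 c3 e1 e2 e3 f2.+1 f3.-1).
Proof.
have [[KL EL hE] K1 KM EM] := skewE.
have := hE (lword d1 d2 d3 c2 c3 * rword e1 e2 e3 f2 f3).
rewrite EM root2_Klword root2_lword root2_rword mulrDr mulrDl !gatherE.
rewrite !(scalarD, scalarN, scalarZ) //.
rewrite -!/(pairing _ _ _ _ _ _ _ _ _ _) !qsE !exprVn.
have qn0 n : q ^+ n != 0 by exact: expf_neq0.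
move=> rel; apply/eqP; rewrite -subr_eq0; apply/eqP.
rewrite -[RHS](mulr0 (- q ^+ e2 ^+ 2 * q ^+ f3 ^+ 2 * q ^+ d1 ^+ 2
  * q ^+ c2 ^+ 2 * (1 - q ^+ 2) / (q ^+ c3 * q))) -rel.
by field; rewrite q0 q21 !qn0.
Qed.
End Raising.

Section Lowering.
Hypotheses (Esc : E sc = - q *: sb) (Esb : E sb = 0) (Er1 : E r1 = 0)
  (Er2 : E r2 = - q *: r3) (Er3 : E r3 = 0) (Ep3 : E p3 = 1 *: p2)
  (Ep2 : E p2 = 0) (Ep1 : E p1 = 0) (Eb : E b = 1 *: c) (Ec : E c = 0).

Lemma lower2_lword d1 d2 d3 c2 c3 :
  E (lword d1 d2 d3 c2 c3) =
  (- q * q ^+ c3 * q^-1 ^+ c2 * qt d2) *: lword d1.+1 d2.-1 d3 c2 c3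
  + (- q * qt c3) *: lword d1 d2 d3 c2.+1 c3.-1.
Proof.
case: skewE => [[KL EL hE] K1 KM EM].
have Kx := Kop_exp K1 KM; have E0 := skew_exp0 K1 EM.
rewrite /lword !EM !(E0 _ _ Esb, E0 _ _ Er1, E0 _ _ Er3) !KM.
rewrite (Kx _ _ _ Ksc) (Kx _ _ _ Ksb) (Kx _ _ _ Kr1).
rewrite (skew_expr K1 EM _ Ksc Esc (swap_inv scb)) -/(qsum_sym q c3).
rewrite (skew_expr K1 EM _ Kr2 Er2 (swap_inv r23)) -/(qsum_sym q d2).
rewrite !(mulr0, mul0r, addr0, add0r) expr1n scale1r mulrDl !gatherE.
congr (_ + _).
  by rewrite [r3 ^+ d1.+1]exprS !mulrA; congr (_ *: _); ring.
by rewrite [sb ^+ c2.+1]exprS !mulrA; congr (_ *: _); ring.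
Qed.

Lemma lower2_rword e1 e2 e3 f2 f3 :
  E (rword e1 e2 e3 f2 f3) =
  (q ^+ e1 * q^-1 ^+ e2 * qt f2) *: rword e1 e2 e3 f2.-1 f3.+1
  + qt e1 *: rword e1.-1 e2.+1 e3 f2 f3.
Proof.
case: skewE => [[KL EL hE] K1 KM EM].
have Kx := Kop_exp K1 KM; have E0 := skew_exp0 K1 EM.
rewrite /rword !EM !(E0 _ _ Ep2, E0 _ _ Ep1, E0 _ _ Ec) !KM.
rewrite (Kx _ _ _ Kp3) (Kx _ _ _ Kp2) (Kx _ _ _ Kp1).
rewrite (skew_expr K1 EM _ Kp3 Ep3 (swap_inv p32)) -/(qsum_sym q e1).
rewrite (skew_expr K1 EM _ Kb Eb (swap_inv bc)) -/(qsum_sym q f2).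
rewrite !(mulr0, mul0r, addr0, add0r) expr1n scale1r mulrDl !gatherE.
congr (_ + _).
  by rewrite [c ^+ f3.+1]exprS !mulrA; congr (_ *: _); ring.
by rewrite [p2 ^+ e2.+1]exprS !mulrA; congr (_ *: _); ring.
Qed.

Lemma pairing_lower2 d1 d2 d3 c2 c3 e1 e2 e3 f2 f3 :
  q * q ^+ e1 * q ^+ e2 * q ^+ f2 *
  (q ^+ c2 * q ^+ d1 * q ^+ d2 * (1 - q ^+ c3 ^+ 2)
     * pairing d1 d2 d3 c2.+1 c3.-1 e1 e2 e3 f2 f3
   + q ^+ c3 ^+ 2 * q ^+ d1 * (1 - q ^+ d2 ^+ 2)
     * pairing d1.+1 d2.-1 d3 c2 c3 e1 e2 e3 f2 f3) =
  q ^+ c3 ^+ 2 * q ^+ d2 ^+ 2 *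
  (q ^+ e2 * q ^+ f2 * (1 - q ^+ e1 ^+ 2)
     * pairing d1 d2 d3 c2 c3 e1.-1 e2.+1 e3 f2 f3
   + q ^+ e1 ^+ 2 * (1 - q ^+ f2 ^+ 2)
     * pairing d1 d2 d3 c2 c3 e1 e2 e3 f2.-1 f3.+1).
Proof.
have [[KL EL hE] K1 KM EM] := skewE.
have := hE (lword d1 d2 d3 c2 c3 * rword e1 e2 e3 f2 f3).
rewrite EM root2_Klword lower2_lword lower2_rword mulrDr mulrDl !gatherE.
rewrite !(scalarD, scalarN, scalarZ) //.
rewrite -!/(pairing _ _ _ _ _ _ _ _ _ _) !qtE !exprVn.
have qn0 n : q ^+ n != 0 by exact: expf_neq0.
move=> rel; apply/eqP; rewrite -subr_eq0; apply/eqP.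
rewrite -[RHS](mulr0 (- q ^+ e1 * q ^+ e2 * q ^+ f2 * q ^+ c2 * q ^+ d1
  * q ^+ d2 * q ^+ c3 * (1 - q ^+ 2) / q)) -rel.
by field; rewrite q0 q21 !qn0.
Qed.
End Lowering.
End SecondRoot.

Section Unitarity.
Hypotheses (row3 : 1 = q^-1 ^+ 4 *: (r1 * p1) + q^-1 ^+ 2 *: (r2 * p2) + r3 *
  p3)
  (row1 : 1 = sa * a + q^-1 ^+ 2 *: (sb * b) + q^-1 ^+ 4 *: (sc * c)).

(** The relation is inserted between the two words. As d1 = d2 = 0, each new letter already stands
    where the normal form wants it. *)
Lemma pairing_row3 D c2 c3 :
  pairing 0 0 D c2 c3 0 0 D c2 c3 =
  q^-1 ^+ 4 * pairing 0 0 D.+1 c2 c3 0 0 D.+1 c2 c3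
  + q^-1 ^+ 2 * pairing 0 1 D c2 c3 0 1 D c2 c3
  + pairing 1 0 D c2 c3 1 0 D c2 c3.
Proof.
rewrite {1}/pairing -[lword _ _ _ _ _]mulr1 row3 !mulrDr !mulrDl.
rewrite !gatherE !(scalarD, scalarZ) //; congr (_ * haar _ + _ * haar _ + haar
  _);
  rewrite /lword /rword !expr0 !mulr1 !mul1r ?expr1 ?[r1 ^+ _.+1]exprSr
  ?[p1 ^+ _.+1]exprS !mulrA //.
Qed.

Lemma pairing_row1 M :
  pairing 0 0 0 M 0 0 0 0 M 0 =
  haar (sb ^+ M * sa * (a * b ^+ M))
  + q^-1 ^+ 2 * pairing 0 0 0 M.+1 0 0 0 0 M.+1 0
  + q^-1 ^+ 4 * q^-1 ^+ M ^+ 2 * pairing 0 0 0 M 1 0 0 0 M 1.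
Proof.
rewrite /pairing /lword /rword !expr0 !mulr1 !mul1r !expr1.
rewrite -{1}[sb ^+ M]mulr1 row1 !mulrDr !mulrDl !gatherE !(scalarD, scalarZ) //.
congr (_ + _ * _ + _); first by rewrite !mulrA.
  by rewrite exprSr exprS !mulrA.
(* Both sc and c have to pass M letters, each at the cost of q^-M. *)
rewrite mulrA (swap_pow _ (swap_inv scb)) -[_ * c * _]mulrA.
rewrite (swap_powl _ (swap_inv bc)) !gatherE scalarZ // expr2 !mulrA.
by [].
Qed.
End Unitarity.
End Words.

(** * Laplace expansions and the q-Pluecker relation *)

Section LinearCombinations.
Variables (K : pzRingType) (V : lmodType K).

(** Coordinates with respect to six monomials: an identity between combinations of noncommuting
    monomials becomes six scalar identities for [field]. *)
Definition lin6 (m1 m2 m3 m4 m5 m6 : V) (k1 k2 k3 k4 k5 k6 : K) : V :=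
  k1 *: m1 + k2 *: m2 + k3 *: m3 + k4 *: m4 + k5 *: m5 + k6 *: m6.

Variables m1 m2 m3 m4 m5 m6 : V.
Local Notation lin := (lin6 m1 m2 m3 m4 m5 m6).

Lemma lin6D k1 k2 k3 k4 k5 k6 l1 l2 l3 l4 l5 l6 :
  lin k1 k2 k3 k4 k5 k6 + lin l1 l2 l3 l4 l5 l6 =
  lin (k1 + l1) (k2 + l2) (k3 + l3) (k4 + l4) (k5 + l5) (k6 + l6).
Proof.
rewrite /lin6 !scalerDl.
by do 5!(rewrite addrACA; congr (_ + _)).
Qed.

Lemma lin6Z k k1 k2 k3 k4 k5 k6 : k *: lin k1 k2 k3 k4 k5 k6 =
  lin (k * k1) (k * k2) (k * k3) (k * k4) (k * k5) (k * k6).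
Proof. by rewrite /lin6 !scalerDr !scalerA. Qed.

Lemma lin6N k1 k2 k3 k4 k5 k6 : - lin k1 k2 k3 k4 k5 k6 =
  lin (- k1) (- k2) (- k3) (- k4) (- k5) (- k6).
Proof. by rewrite /lin6 !opprD !scaleNr. Qed.

Lemma lin6_gens :
  (m1 = lin 1 0 0 0 0 0) * (m2 = lin 0 1 0 0 0 0) * (m3 = lin 0 0 1 0 0 0) *
  (m4 = lin 0 0 0 1 0 0) * (m5 = lin 0 0 0 0 1 0) * (m6 = lin 0 0 0 0 0 1).
Proof. by rewrite /lin6 !scale0r !scale1r !(addr0, add0r). Qed.
End LinearCombinations.

Section NormalOrder.
Variables (K : fieldType) (A : algType K) (q : K).
Variables (x : 'I_3 -> 'I_3 -> A) (t : A).
Hypotheses (q0 : q != 0) (x_rel : forall u, GLq_rel q x t u -> u = 0).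

Lemma swap_col (i l j : 'I_3) : (i < l)%N ->
  x l j * x i j = q^-1 *: (x i j * x l j).
Proof.
move=> il; rewrite (subr0_eq (x_rel (GLq_col _ _ _ j il))).
by rewrite scalerA mulVf // scale1r.
Qed.

Lemma swap_row (i j k : 'I_3) : (j < k)%N ->
  x i k * x i j = q^-1 *: (x i j * x i k).
Proof.
move=> jk; rewrite (subr0_eq (x_rel (GLq_row _ _ _ i jk))).
by rewrite scalerA mulVf // scale1r.
Qed.

Lemma swap_anti (i l j k : 'I_3) : (i < l)%N -> (j < k)%N ->
  x l j * x i k = x i k * x l j.
Proof. by move=> il jk; rewrite (subr0_eq (x_rel (GLq_anti _ _ _ il jk))). Qed.

Lemma swap_diag (i l j k : 'I_3) : (i < l)%N -> (j < k)%N ->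
  x l k * x i j = x i j * x l k - (q - q^-1) *: (x i k * x l j).
Proof.
move=> il jk; rewrite (subr0_eq (x_rel (GLq_diag _ _ _ il jk))).
by rewrite addrK.
Qed.

Lemma swap_antiA (i l j k : 'I_3) : (i < l)%N -> (j < k)%N ->
  forall u, u * x l j * x i k = u * x i k * x l j.
Proof. by move=> il jk u; rewrite -mulrA swap_anti // mulrA. Qed.

Lemma swap_diagA (i l j k : 'I_3) : (i < l)%N -> (j < k)%N ->
  forall u, u * x l k * x i j = u * x i j * x l k
    - (q - q^-1) *: (u * x i k * x l j).
Proof.
by move=> il jk u; rewrite -mulrA swap_diag // mulrBr gatherr !mulrA.
Qed.

Let d123 := x o1 o1 * x o2 o2 * x o3 o3.
Let d132 := x o1 o1 * x o2 o3 * x o3 o2.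
Let d213 := x o1 o2 * x o2 o1 * x o3 o3.
Let d231 := x o1 o2 * x o2 o3 * x o3 o1.
Let d312 := x o1 o3 * x o2 o1 * x o3 o2.
Let d321 := x o1 o3 * x o2 o2 * x o3 o1.
(** Oriented rules that sort a product by rows. Each minor omits the column of the letter multiplied
    with it, so two letters of the same column never have to be exchanged. *)
Let order_row3 := ((@swap_anti o1 o3 o1 o2 isT isT), (@swap_anti o1 o3 o1 o3
  isT isT),
(@swap_antiA o2 o3 o1 o2 isT isT), (@swap_antiA o2 o3 o1 o3 isT isT),
(@swap_diag o1 o3 o1 o2 isT isT), (@swap_anti o1 o3 o2 o3 isT isT),
(@swap_diagA o2 o3 o1 o2 isT isT), (@swap_antiA o2 o3 o2 o3 isT isT),
(@swap_diag o1 o3 o1 o3 isT isT), (@swap_diag o1 o3 o2 o3 isT isT),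
(@swap_diagA o2 o3 o1 o3 isT isT), (@swap_diagA o2 o3 o2 o3 isT isT)).

Let order_row1 := ((@swap_anti o1 o2 o1 o2 isT isT), (@swap_anti o1 o2 o1 o3
  isT isT),
(@swap_diag o1 o2 o1 o2 isT isT), (@swap_anti o1 o2 o2 o3 isT isT),
(@swap_diag o1 o2 o1 o3 isT isT), (@swap_diag o1 o2 o2 o3 isT isT),
(@swap_antiA o1 o3 o1 o2 isT isT), (@swap_antiA o1 o3 o1 o3 isT isT),
(@swap_diagA o1 o3 o1 o2 isT isT), (@swap_antiA o1 o3 o2 o3 isT isT),
(@swap_diagA o1 o3 o1 o3 isT isT), (@swap_diagA o1 o3 o2 o3 isT isT)).

Lemma det_row3 : qminor q x setT setT =
  q^-1 ^+ 2 *: (x o3 o1 * qminor q x [set~ o3] [set~ o1])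
  - q^-1 *: (x o3 o2 * qminor q x [set~ o3] [set~ o2])
  + x o3 o3 * qminor q x [set~ o3] [set~ o3].
Proof.
rewrite (qminor3 _ _ enum_setT3 enum_setT3).
rewrite (qminor2 _ _ enum_compl3 enum_compl1) (qminor2 _ _ enum_compl3
  enum_compl2).
rewrite (qminor2 _ _ enum_compl3 enum_compl3) !mulrBr !gatherr !mulrA.
rewrite !(order_row3, mulrBl, gatherl).
rewrite -/d123 -/d132 -/d213 -/d231 -/d312 -/d321.
have ms := lin6_gens d123 d132 d213 d231 d312 d321.
have := (@lin6Z _ _ d123 d132 d213 d231 d312 d321,
  @lin6N _ _ d123 d132 d213 d231 d312 d321,
  @lin6D _ _ d123 d132 d213 d231 d312 d321).
(* Abstracting [lin6] together with its monomials removes these from the right-hand sides of [ms],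
   so that rewriting with [ms] terminates. *)
move: (lin6 _ _ _ _ _ _) ms => L ms LE.
rewrite !ms !LE; congr L; field; exact: q0.
Qed.

Lemma det_row1 : qminor q x setT setT =
  qminor q x [set~ o1] [set~ o1] * x o1 o1
  - q^-1 *: (qminor q x [set~ o1] [set~ o2] * x o1 o2)
  + q^-1 ^+ 2 *: (qminor q x [set~ o1] [set~ o3] * x o1 o3).
Proof.
rewrite (qminor3 _ _ enum_setT3 enum_setT3).
rewrite (qminor2 _ _ enum_compl1 enum_compl1) (qminor2 _ _ enum_compl1
  enum_compl2).
rewrite (qminor2 _ _ enum_compl1 enum_compl3) !mulrBl !gatherl.
rewrite !(order_row1, mulrBl, gatherl).
rewrite -/d123 -/d132 -/d213 -/d231 -/d312 -/d321.
have ms := lin6_gens d123 d132 d213 d231 d312 d321.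
have := (@lin6Z _ _ d123 d132 d213 d231 d312 d321,
  @lin6N _ _ d123 d132 d213 d231 d312 d321,
  @lin6D _ _ d123 d132 d213 d231 d312 d321).
move: (lin6 _ _ _ _ _ _) ms => L ms LE.
rewrite !ms !LE; congr L; field; exact: q0.
Qed.

Let order_plucker := ((@swap_row o1 o1 o2 isT), (@swap_row o1 o1 o3 isT),
  (@swap_row o1 o2 o3 isT),
(@swap_antiA o1 o2 o1 o2 isT isT), (@swap_antiA o1 o2 o1 o3 isT isT),
(@swap_diagA o1 o2 o1 o2 isT isT), (@swap_antiA o1 o2 o2 o3 isT isT),
(@swap_diagA o1 o2 o1 o3 isT isT), (@swap_diagA o1 o2 o2 o3 isT isT)).

(** This is the expansion [det_row1] with the minors of rows 2, 3 replaced by those of rows 1, 2: a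
    determinant with repeated first row, hence zero. *)
Lemma plucker : qminor q x [set~ o3] [set~ o1] * x o1 o1 =
  q^-1 *: (qminor q x [set~ o3] [set~ o2] * x o1 o2)
  - (q^-1 * q^-1) *: (qminor q x [set~ o3] [set~ o3] * x o1 o3).
Proof.
rewrite (qminor2 _ _ enum_compl3 enum_compl1) (qminor2 _ _ enum_compl3
  enum_compl2).
rewrite (qminor2 _ _ enum_compl3 enum_compl3) !mulrBl !gatherl.
rewrite !(order_plucker, mulrBl, gatherl).
set n1 := x o1 o1 * x o1 o2 * x o2 o3; set n2 := x o1 o1 * x o1 o3 * x o2 o2.
set n3 := x o1 o2 * x o1 o3 * x o2 o1.
have ms := lin6_gens n1 n2 n3 0 0 0.
have := (@lin6Z _ _ n1 n2 n3 0 0 0, @lin6N _ _ n1 n2 n3 0 0 0,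
  @lin6D _ _ n1 n2 n3 0 0 0).
move: (lin6 _ _ _ _ _ _) ms => L ms LE.
rewrite !ms !LE; congr L; field; exact: q0.
Qed.
End NormalOrder.

(** * Cofactors under the skew derivations *)

Section Minors.
Variables (K : fieldType) (q : K).
Hypothesis q0 : q != 0.
Local Notation A := (OGLq q).
Local Notation x := (gx q).
Local Notation T := (gdetV q).

Definition cominor (i j : 'I_3) : A := xi q [set~ i] [set~ j].

Lemma gdetV_central i j : T * x i j = x i j * T.
Proof. by apply/subr0_eq/gx_rel/GLq_detV_central. Qed.

Lemma gdetV_qdet : T * qdet q = 1.
Proof. by apply/subr0_eq/gx_rel/GLq_detV. Qed.

Lemma gdetV_comm u : T * u = u * T.
Proof.
elim/OGLq_ind: u => [|k u v Hu Hv|i j u Hu|u Hu].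
- by rewrite mulr1 mul1r.
- by rewrite mulrDr mulrDl gatherr gatherl Hu Hv.
- by rewrite mulrA gdetV_central -mulrA Hu mulrA.
by rewrite -[RHS]mulrA -Hu.
Qed.

Lemma qdet_gdetV : qdet q * T = 1.
Proof. by rewrite -gdetV_comm gdetV_qdet. Qed.

Lemma row_pair (i : 'I_3) : exists r r', enum [set~ i] = [:: r; r'].
Proof.
by elim/ord3P: i; [exists o2, o3 | exists o1, o3 | exists o1, o2];
  rewrite ?enum_compl1 ?enum_compl2 ?enum_compl3.
Qed.

Section SkewMinors.
Variables (Kop E : A -> A) (s t : 'I_3).
Hypotheses (KL : linear Kop) (EL : linear E)
  (KM : forall u v, Kop (u * v) = Kop u * Kop v)
  (EM : forall u v, E (u * v) = Kop u * E v + E u * v)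
  (Kx : forall i j, Kop (x i j) = weight q s t j *: x i j)
  (Ex : forall i j, E (x i j) = (j == s)%:R *: x i t).

Let mapB (f : A -> A) u v : linear f -> f (u - v) = f u - f v.
Proof. by move=> fL; rewrite addrC -scaleN1r fL scaleN1r addrC. Qed.

Let mapZ (f : A -> A) k u : linear f -> f (k *: u) = k *: f u.
Proof. by move=> fL; rewrite -[k *: u]addr0 fL (linear_0 fL) addr0. Qed.

(** The weights of the three columns multiply to 1. *)
Lemma Kop_cominor i j : adjacent_pair s t ->
  Kop (cominor i j) = (weight q s t j)^-1 *: cominor i j.
Proof.
move=> st; have [r [r' Er]] := row_pair i; have [c [d Ec]] := row_pair j.
rewrite /cominor /xi (qminor2 _ _ Er Ec) (mapB _ _ KL) (mapZ _ _ KL) !KM !Kx.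
rewrite !gatherE scalerBr scalerA.
suff -> : (weight q s t j)^-1 = weight q s t c * weight q s t d.
  by congr (_ *: _ - _ *: _); ring.
move: st Ec; elim/ord3P: s; elim/ord3P: t => // _; elim/ord3P: j;
  rewrite ?enum_compl1 ?enum_compl2 ?enum_compl3 => -[<- <-];
  by rewrite /weight /=; field; rewrite ?q0 ?oner_eq0.
Qed.

(** The derivation replaces column s by column t. In the minor omitting t this gives the minor
    omitting s, without sign because s and t are adjacent; the minor omitting s has no column to
    replace; in the third minor a column gets repeated, and the result vanishes. *)
Lemma skew_cominor i j : adjacent_pair s t ->
  E (cominor i j) = (j == t)%:R *: cominor i s.
Proof.
move=> st; have [r [r' Er]] := row_pair i; have [c [d Ec]] := row_pair j.
have [c' [d' Ec']] := row_pair s.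
rewrite /cominor /xi (qminor2 _ _ Er Ec) (qminor2 _ _ Er Ec').
rewrite (mapB _ _ EL) (mapZ _ _ EL) !EM !Kx !Ex !gatherE.
move: st Ec Ec'; elim/ord3P: s; elim/ord3P: t => // _; elim/ord3P: j;
  rewrite ?enum_compl1 ?enum_compl2 ?enum_compl3 => -[<- <-] -[<- <-];
  rewrite /weight /= ?(mulr0, mulr1, scale0r, scale1r, scaler0, addr0, add0r,
    subr0, oppr0) ?scalerA ?divff // ?scale1r ?subrr //.
Qed.
End SkewMinors.
End Minors.

Section Instance.
Variables (R : realType) (q : R).
Local Notation K := R[i].
Local Notation Q := (real_complex R q).
Local Notation A := (OUq q).
Local Notation x := (gx Q).
Local Notation T := (gdetV Q).
Variables (Delta : A -> tensor A A) (haar : A -> K).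
Hypotheses (Q0 : Q != 0) (Delta_comult : is_comult Delta)
  (haar_Uq : is_haar_state Delta haar).

Lemma root_derivation s t : adjacent_pair s t -> exists Kop E,
  [/\ skew_der haar Kop E,
      forall i j, Kop (x i j) = weight Q s t j *: x i j,
      forall i j, E (x i j) = (j == s)%:R *: x i t,
      forall i j, Kop (cominor Q i j * T) =
        (weight Q s t j)^-1 *: (cominor Q i j * T)
    & forall i j, E (cominor Q i j * T) = (j == t)%:R *: (cominor Q i s * T)].
Proof.
move=> st; have [Kop [E [[KL EL hE] [K1 KM EM] Kx Ex [KT ET]]]] :=
  skew_derivation Q0 Delta_comult haar_Uq st.
exists Kop, E; split=> // i j.
  by rewrite KM KT (Kop_cominor Q0 KL KM Kx) // gatherl.
by rewrite EM ET mulr0 add0r (skew_cominor Q0 EL EM Kx Ex) // gatherl.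
Qed.
End Instance.

(** * The pairing of words in O(U_q(3)) *)

Section UqPairing.
Variables (R : realType) (q : R).
Local Notation K := R[i].
Local Notation Q := (real_complex R q).
Local Notation A := (OUq q).
Local Notation x := (gx Q).
Local Notation T := (gdetV Q).
Local Notation m := (fun i j => cominor Q i j * T).
Variables (Delta : A -> tensor A A) (star : A -> A) (haar : A -> K).
Hypotheses (Q0 : Q != 0) (Q21 : 1 - Q ^+ 2 != 0)
  (Delta_comult : is_comult Delta) (star_Uq : is_Uq_star star)
  (haar_Uq : is_haar_state Delta haar).

Definition Uq_pairing := pairing haar (m o3 o1) (m o3 o2) (m o3 o3) (x o1 o2)
  (x o1 o3) (Q ^+ 2 *: x o3 o1) (- Q *: x o3 o2) (x o3 o3) (- Q *: m o1 o2)
  (Q ^+ 2 *: m o1 o3).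

Lemma starZ k u : star (k *: u) = k^* *: star u.
Proof.
case: star_Uq => sL _ _ _ _.
have s0 : star 0 = 0.
  have := sL 1 0 0; rewrite scale1r addr0 conjC1 scale1r => E.
  by apply: (addrI (star 0)); rewrite -E addr0.
by rewrite -[k *: u]addr0 sL s0 addr0.
Qed.

Lemma starM u v : star (u * v) = star v * star u.
Proof. by case: star_Uq. Qed.

Lemma conjQ : Q^* = Q.
Proof. exact: conjc_real. Qed.

Lemma star_gx i j : star (x i j) = (- Q) ^ (j%:Z - i%:Z) *: m i j.
Proof. by case: star_Uq. Qed.

Lemma star_gx1 j : star (x o1 j) = (- Q) ^+ j *: m o1 j.
Proof. by rewrite star_gx subr0. Qed.

Lemma star_gx3 j : star (x o3 j) = (- Q) ^- (2 - j) *: m o3 j.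
Proof.
rewrite star_gx; congr (_ *: _); elim/ord3P: j => //=.
by rewrite subrr expr0z expr0 invr1.
Qed.

Lemma gx_row (i j k : 'I_3) : (j < k)%N -> x i j * x i k = Q *: (x i k * x i j).
Proof. by move=> jk; apply/subr0_eq/gx_rel/GLq_row. Qed.

(** The adjoint of the q-commutation in the third row of generators: [star] sends x_3j to a multiple
    of the cofactor and reverses products. *)
Lemma m_row3 (j k : 'I_3) : (j < k)%N -> m o3 k * m o3 j = Q *: (m o3 j * m o3
  k).
Proof.
move=> jk; have := congr1 star (gx_row o3 jk).
rewrite starZ conjQ !starM !star_gx3 !gatherE.
have N0 n : (- Q) ^- n != 0 by rewrite invr_eq0 expf_neq0 // oppr_eq0.
move: (N0 (2 - j)%N) (N0 (2 - k)%N); move: (_ ^- _) (_ ^- _) => al be al0 be0 E.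
have ab0 : al * be != 0 by rewrite mulf_neq0.
rewrite -[LHS]scale1r -(mulVf ab0) -scalerA E scalerA; congr (_ *: _).
by field; rewrite al0 be0.
Qed.

Lemma star_row1 (j k : 'I_3) : (j < k)%N ->
  star (x o1 k) * star (x o1 j) = Q *: (star (x o1 j) * star (x o1 k)).
Proof.
by move=> jk; rewrite -!starM gx_row // starZ conjQ starM.
Qed.

Lemma m_gx_plucker : m o3 o1 * x o1 o1 =
  Q^-1 *: (m o3 o2 * x o1 o2) - (Q^-1 * Q^-1) *: (m o3 o3 * x o1 o3).
Proof.
rewrite -!mulrA !gdetV_central !mulrA /cominor /xi (plucker Q0 (@gx_rel _ Q)).
by rewrite mulrBl !gatherl.
Qed.

Lemma m_gx_row3 :
  1 = Q^-1 ^+ 4 *: (Q ^+ 2 *: x o3 o1 * m o3 o1)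
      + Q^-1 ^+ 2 *: (- Q *: x o3 o2 * m o3 o2) + x o3 o3 * m o3 o3.
Proof.
rewrite -(qdet_gdetV Q) /qdet /xi (det_row3 Q0 (@gx_rel _ Q)).
rewrite !mulrDl mulNr !gatherE -!mulrA; congr (_ *: _ + _ + _).
  by rewrite ?exprVn; field.
by rewrite -scaleNr; congr (_ *: _); rewrite ?exprVn; field.
Qed.

Lemma m_gx_row1 :
  1 = m o1 o1 * x o1 o1 + Q^-1 ^+ 2 *: (- Q *: m o1 o2 * x o1 o2)
      + Q^-1 ^+ 4 *: (Q ^+ 2 *: m o1 o3 * x o1 o3).
Proof.
rewrite -(qdet_gdetV Q) /qdet /xi (det_row1 Q0 (@gx_rel _ Q)).
have mT u v : u * T * v = u * v * T by rewrite -mulrA gdetV_comm mulrA.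
rewrite !mulrDl mulNr !gatherE !mT; congr (_ + _ + _ *: _).
  by rewrite -scaleNr; congr (_ *: _); rewrite ?exprVn; field.
by rewrite ?exprVn; field.
Qed.

Lemma m_row1 : (Q ^+ 2 *: m o1 o3) * (- Q *: m o1 o2) =
  Q *: ((- Q *: m o1 o2) * (Q ^+ 2 *: m o1 o3)).
Proof.
have := star_row1 (isT : (o2 < o3)%N).
by rewrite !star_gx1 expr1 sqrrN.
Qed.

Lemma gx_row3 (j k : 'I_3) s t : (j < k)%N ->
  (s *: x o3 j) * (t *: x o3 k) = Q *: ((t *: x o3 k) * (s *: x o3 j)).
Proof.
by move=> jk; rewrite !gatherE gx_row // !gatherE; congr (_ *: _); ring.
Qed.

Let haarL : scalar haar. Proof. by case: haar_Uq. Qed.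

Let r12 : (Q ^+ 2 *: x o3 o1) * (- Q *: x o3 o2) =
  Q *: ((- Q *: x o3 o2) * (Q ^+ 2 *: x o3 o1)).
Proof. exact: gx_row3. Qed.

Let r23 : (- Q *: x o3 o2) * x o3 o3 = Q *: (x o3 o3 * (- Q *: x o3 o2)).
Proof. by have := @gx_row3 o2 o3 (- Q) 1 isT; rewrite !scale1r. Qed.

Lemma Uq_pairing_root1 d1 d2 d3 c2 c3 e1 e2 e3 f2 f3 :
  Q ^+ e3 ^+ 2 * Q ^+ 2 * Q ^+ f2 ^+ 3 * (1 - Q ^+ d2 ^+ 2)
    * Uq_pairing d1 d2.-1 d3.+1 c2 c3 e1 e2 e3.+1 f2 f3 =
  Q ^+ d2 * Q *
  (Q ^+ e2 * Q ^+ f2 * (1 - Q ^+ 2 * Q ^+ e3 ^+ 2 * Q ^+ f2 ^+ 2)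
     * Uq_pairing d1 d2 d3 c2 c3 e1 e2.+1 e3 f2 f3
   - (1 - Q ^+ f2 ^+ 2) * Uq_pairing d1 d2 d3 c2 c3 e1.+1 e2 e3 f2.-1 f3.+1).
Proof.
have [Kop [E [skE Kx Ex Km Em]]] :=
  @root_derivation R q Delta haar Q0 Delta_comult haar_Uq o2 o1 isT.
have [[KL EL _] _ _ _] := skE.
have KZ k u : Kop (k *: u) = k *: Kop u by exact: linear_scale.
have EZ k u : E (k *: u) = k *: E u by exact: linear_scale.
apply: (pairing_root1 Q0 Q21 haarL _ _ _ _ _ r12 m_gx_plucker skE);
  rewrite ?KZ ?EZ ?Kx ?Km ?Ex ?Em ?scalerA /weight /=;
  rewrite ?(mulr0, mulr1, mul1r, scale0r, scaler0, invr1, invrK) //;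
  by [exact: m_row3 | exact: gx_row | exact: m_row1 | (congr (_ *: _); field)].
Qed.

Lemma Uq_pairing_root2 d1 d2 d3 c2 c3 e1 e2 e3 f2 f3 :
  Q ^+ e2 ^+ 2 * Q ^+ f3 ^+ 2 *
  (Q ^+ d1 ^+ 2 * (1 - Q ^+ c2 ^+ 2)
     * Uq_pairing d1 d2 d3 c2.-1 c3.+1 e1 e2 e3 f2 f3
   + Q ^+ d2 * Q ^+ c2 * (1 - Q ^+ d1 ^+ 2)
     * Uq_pairing d1.-1 d2.+1 d3 c2 c3 e1 e2 e3 f2 f3) =
  Q * Q ^+ d2 * Q ^+ c2 * Q ^+ d1 * Q ^+ e1 *
  (Q ^+ f3 ^+ 2 * (1 - Q ^+ e2 ^+ 2)
     * Uq_pairing d1 d2 d3 c2 c3 e1.+1 e2.-1 e3 f2 f3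
   + Q ^+ e2 * Q ^+ f2 * (1 - Q ^+ f3 ^+ 2)
     * Uq_pairing d1 d2 d3 c2 c3 e1 e2 e3 f2.+1 f3.-1).
Proof.
have [Kop [E [skE Kx Ex Km Em]]] :=
  @root_derivation R q Delta haar Q0 Delta_comult haar_Uq o3 o2 isT.
have [[KL EL _] _ _ _] := skE.
have KZ k u : Kop (k *: u) = k *: Kop u by exact: linear_scale.
have EZ k u : E (k *: u) = k *: E u by exact: linear_scale.
apply: (pairing_root2 Q0 Q21 haarL _ _ r23 _ skE);
  rewrite ?KZ ?EZ ?Kx ?Km ?Ex ?Em ?scalerA /weight /=;
  rewrite ?(mulr0, mulr1, mul1r, scale0r, scaler0, invr1, invrK) //;
  by [exact: m_row3 | exact: gx_row | exact: m_row1 | (congr (_ *: _); field)].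
Qed.

Lemma Uq_pairing_lower2 d1 d2 d3 c2 c3 e1 e2 e3 f2 f3 :
  Q * Q ^+ e1 * Q ^+ e2 * Q ^+ f2 *
  (Q ^+ c2 * Q ^+ d1 * Q ^+ d2 * (1 - Q ^+ c3 ^+ 2)
     * Uq_pairing d1 d2 d3 c2.+1 c3.-1 e1 e2 e3 f2 f3
   + Q ^+ c3 ^+ 2 * Q ^+ d1 * (1 - Q ^+ d2 ^+ 2)
     * Uq_pairing d1.+1 d2.-1 d3 c2 c3 e1 e2 e3 f2 f3) =
  Q ^+ c3 ^+ 2 * Q ^+ d2 ^+ 2 *
  (Q ^+ e2 * Q ^+ f2 * (1 - Q ^+ e1 ^+ 2)
     * Uq_pairing d1 d2 d3 c2 c3 e1.-1 e2.+1 e3 f2 f3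
   + Q ^+ e1 ^+ 2 * (1 - Q ^+ f2 ^+ 2)
     * Uq_pairing d1 d2 d3 c2 c3 e1 e2 e3 f2.-1 f3.+1).
Proof.
have [Kop [E [skE Kx Ex Km Em]]] :=
  @root_derivation R q Delta haar Q0 Delta_comult haar_Uq o2 o3 isT.
have [[KL EL _] _ _ _] := skE.
have KZ k u : Kop (k *: u) = k *: Kop u by exact: linear_scale.
have EZ k u : E (k *: u) = k *: E u by exact: linear_scale.
apply: (pairing_lower2 Q0 Q21 haarL _ _ r23 _ skE);
  rewrite ?KZ ?EZ ?Kx ?Km ?Ex ?Em ?scalerA /weight /=;
  rewrite ?(mulr0, mulr1, mul1r, scale0r, scaler0, invr1, invrK) //;
  by [exact: m_row3 | exact: gx_row | exact: m_row1 | (congr (_ *: _); field)].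
Qed.

Lemma Uq_pairing_row3 D c2 c3 :
  Uq_pairing 0 0 D c2 c3 0 0 D c2 c3 =
  Q^-1 ^+ 4 * Uq_pairing 0 0 D.+1 c2 c3 0 0 D.+1 c2 c3
  + Q^-1 ^+ 2 * Uq_pairing 0 1 D c2 c3 0 1 D c2 c3
  + Uq_pairing 1 0 D c2 c3 1 0 D c2 c3.
Proof. exact: (pairing_row3 _ _ _ _ haarL m_gx_row3). Qed.

Hypothesis Q2n : forall n, 1 - Q ^+ n.+1 ^+ 2 != 0.

Lemma Uq_pairing_row1 M :
  Uq_pairing 0 0 0 M 0 0 0 0 M 0 =
  (Q ^+ M ^+ 2 * (1 - Q ^+ 2) / (1 - Q ^+ M.+1 ^+ 2) + Q^-1 ^+ 2)
     * Uq_pairing 0 0 0 M.+1 0 0 0 0 M.+1 0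
  + Q^-1 ^+ 4 * Q^-1 ^+ M ^+ 2 * Uq_pairing 0 0 0 M 1 0 0 0 M 1.
Proof.
have [Kop [E [skE Kx Ex Km Em]]] :=
  @root_derivation R q Delta haar Q0 Delta_comult haar_Uq o2 o1 isT.
have [[KL EL _] _ _ _] := skE.
have KZ k u : Kop (k *: u) = k *: Kop u by exact: linear_scale.
have EZ k u : E (k *: u) = k *: E u by exact: linear_scale.
have bc : x o1 o2 * x o1 o3 = Q *: (x o1 o3 * x o1 o2) by exact: gx_row.
rewrite /Uq_pairing (pairing_row1 _ _ _ _ _ _ Q0 haarL bc m_row1 m_gx_row1).
(* The term with a^* a is traded for a pairing of length M + 1; the fraction in the statement is the
   inverse of [qsum Q M.+1]. *)
have norm : qsum Q M.+1 * haar ((- Q *: m o1 o2) ^+ M * m o1 o1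
    * (x o1 o1 * x o1 o2 ^+ M)) =
    haar ((- Q *: m o1 o2) ^+ M.+1 * x o1 o2 ^+ M.+1).
  apply: (root1_norm Q0 haarL _ skE);
  rewrite ?KZ ?EZ ?Kx ?Km ?Ex ?Em ?scalerA /weight /=;
  rewrite ?(mulr0, mulr1, mul1r, scale0r, scaler0, invr1, invrK) //;
  by [exact: m_row3 | exact: gx_row | exact: m_row1 | (congr (_ *: _); field)].
congr (_ + _); rewrite mulrDl; congr (_ + _).
have -> : pairing haar (m o3 o1) (m o3 o2) (m o3 o3) (x o1 o2) (x o1 o3)
    (Q ^+ 2 *: x o3 o1) (- Q *: x o3 o2) (x o3 o3) (- Q *: m o1 o2)
    (Q ^+ 2 *: m o1 o3) 0 0 0 M.+1 0 0 0 0 M.+1 0 =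
    haar ((- Q *: m o1 o2) ^+ M.+1 * x o1 o2 ^+ M.+1).
  by rewrite /pairing /lword /rword !expr0 !mulr1 !mul1r.
rewrite -norm qsE // [Q ^+ M.+1]exprS; have := Q2n M; rewrite [Q ^+ M.+1]exprS
  => Q2M.
by field; rewrite Q0 Q21 Q2M expf_neq0.
Qed.

Lemma Uq_pairing0 : Uq_pairing 0 0 0 0 0 0 0 0 0 0 = 1.
Proof.
rewrite /Uq_pairing /pairing /lword /rword !expr0 !mulr1.
by case: haar_Uq.
Qed.
End UqPairing.

(** * Closed forms *)

(** Proof by certificate: the difference of the two sides of the goal is a given combination of the
    differences in the hypotheses, an identity left to [ring] or [field]. *)
Lemma eq_lin1 (K : pzRingType) (k a b x y : K) :
  a = b -> x - y = k * (a - b) -> x = y.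
Proof. by move=> ->; rewrite subrr mulr0 => /subr0_eq. Qed.

Lemma eq_lin2 (K : pzRingType) (k a b k' a' b' x y : K) :
  a = b -> a' = b' -> x - y = k * (a - b) + k' * (a' - b') -> x = y.
Proof. by move=> -> ->; rewrite !subrr !mulr0 addr0 => /subr0_eq. Qed.

Lemma eq_lin4 (K : pzRingType) (k1 a1 b1 k2 a2 b2 k3 a3 b3 k4 a4 b4 x y : K) :
  a1 = b1 -> a2 = b2 -> a3 = b3 -> a4 = b4 ->
  x - y = k1 * (a1 - b1) + k2 * (a2 - b2) + k3 * (a3 - b3) + k4 * (a4 - b4) ->
  x = y.
Proof. by move=> -> -> -> ->; rewrite !subrr !mulr0 !addr0 => /subr0_eq. Qed.

Section ClosedForm.
Variables (K : fieldType) (q : K).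
Hypotheses (q0 : q != 0) (q2n : forall n, 1 - q ^+ n.+1 ^+ 2 != 0).

Local Notation F n := (qpoch (q ^+ 2) (q ^+ 2) n).

Lemma qn_neq0 n : q ^+ n != 0. Proof. exact: expf_neq0. Qed.

Lemma qfactS n : F n.+1 = F n * (1 - q ^+ n.+1 ^+ 2).
Proof.
rewrite /qpoch big_ord_recr /=; congr (_ * (1 - _)).
by rewrite -exprS -!exprM mulnC.
Qed.

Lemma qfact0 : F 0 = 1. Proof. by rewrite /qpoch big_ord0. Qed.

Lemma qfact_neq0 n : F n != 0.
Proof.
elim: n => [|n IH]; first by rewrite qfact0 oner_eq0.
by rewrite qfactS mulf_neq0.
Qed.

(* The value of the pairing when k = d2. *)
Definition extremal_form (d1 d2 D c2 c3 : nat) : K :=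
  q ^+ (2 * d2 * D + 2 * d1 * d2 + 2 * d1 * D + 4 * D + 4 * d1 + 4 * d2
        + 2 * c2 * c3 + 4 * c2 + 4 * c3 + d2 * c2 + 2 * c3 * d1)
  * ((1 - q ^+ 2) ^+ 2 * (1 - q ^+ 4) * F c2 * F D * F (c3 + d2) * F (d1 + d2)
     * F (D + c2 + c3).+1 * F (D + c2 + d1).+1
     / (F (c2 + c3).+1 * F (d1 + d2 + D).+1 * F (d1 + d2 + D + c2 + c3).+2
        * F (D + c2).+1)).

(** The closed form satisfies the relation that [norm_c] proves for the norms. The lemmas below are
    likewise the counterparts of [norm_N], of the first-row unitarity relation and of
    [norm_row3]. *)
Lemma extremal_form_c N D c2 c3 :
  q ^+ c3.+1 ^+ 2 * (1 - q ^+ c2.+1 ^+ 2) * (1 - q ^+ (D + c2 + N).+2 ^+ 2)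
    * extremal_form N 0 D c2 c3.+1 =
  q ^+ (c2 + N).+1 ^+ 2 * (1 - q ^+ c3.+1 ^+ 2) * (1 - q ^+ (D + c2).+2 ^+ 2)
    * extremal_form N 0 D c2.+1 c3.
Proof.
rewrite /extremal_form; set E1 := (X in q ^+ X * _); set E2 := (X in _ = _ * (q
  ^+ X * _)).
(* The leading powers of q are compared through their exponents by [lia]; what remains is an
   identity between q-factorials. *)
have EE : q ^+ E1 = q ^+ E2 * q ^+ (c2 + N).+1 ^+ 2 / q ^+ c3.+1 ^+ 2.
  apply: (mulIf (expf_neq0 2 (qn_neq0 c3.+1))); rewrite divfK ?expf_neq0 //.
  by rewrite -!exprM -!exprD /E1 /E2; congr (_ ^+ _); lia.
rewrite EE !addn0 !addnS !addSn ?addn0.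
rewrite ![F _.+2]qfactS ![F _.+1]qfactS.
by field; rewrite ?(qfact_neq0, q2n, qn_neq0).
Qed.
Lemma extremal_form_neq0 d1 d2 D c2 c3 : 1 - q ^+ 4 != 0 ->
  extremal_form d1 d2 D c2 c3 != 0.
Proof.
move=> q4; rewrite /extremal_form.
do ![exact: q4 | exact: qn_neq0 | exact: qfact_neq0 | exact: (expf_neq0 _ (q2n
  0))
  | apply: mulf_neq0 | apply: invr_neq0].
Qed.

Lemma extremal_form_N N D c :
  q ^+ N.+1 ^+ 2 * (1 - q ^+ D.+1 ^+ 2) * extremal_form N.+1 0 D c 0 =
  q ^+ D.+1 ^+ 2 * (1 - q ^+ N.+1 ^+ 2) * extremal_form N 0 D.+1 c 0.
Proof.
rewrite /extremal_form; set E1 := (X in q ^+ X * _); set E2 := (X in _ = _ * (q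
  ^+ X * _)).
have EE : q ^+ E1 = q ^+ E2 * q ^+ D.+1 ^+ 2 / q ^+ N.+1 ^+ 2.
  apply: (mulIf (expf_neq0 2 (qn_neq0 N.+1))); rewrite divfK ?expf_neq0
    ?qn_neq0 //.
  by rewrite -!exprM -!exprD /E1 /E2; congr (_ ^+ _); lia.
rewrite EE !addn0 !addnS !addSn ?addn0.
rewrite (_ : D + c + N = N + D + c)%N; last by lia.
rewrite ![F _.+2]qfactS ![F _.+1]qfactS.
by field; rewrite ?(qfact_neq0, q2n, qn_neq0).
Qed.

Lemma extremal_form_row1 M :
  extremal_form 0 0 0 M 0 =
  (q ^+ M ^+ 2 * (1 - q ^+ 2) / (1 - q ^+ M.+1 ^+ 2) + q^-1 ^+ 2)
     * extremal_form 0 0 0 M.+1 0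
  + q^-1 ^+ 4 * q^-1 ^+ M ^+ 2 * extremal_form 0 0 0 M 1.
Proof.
rewrite /extremal_form; set E1 := (X in q ^+ X * _).
set E2 := (X in _ = _ * (q ^+ X * _) + _); set E3 := (X in _ = _ + _ * (q ^+ X
  * _)).
have EE2 : q ^+ E2 = q ^+ E1 * q ^+ 4.
  by rewrite -exprD /E1 /E2; congr (_ ^+ _); lia.
have EE3 : q ^+ E3 = q ^+ E1 * q ^+ 4 * q ^+ M ^+ 2.
  by rewrite -exprM -!exprD /E1 /E3; congr (_ ^+ _); lia.
rewrite EE2 EE3 !(addn0, add0n, addnS, addSn).
rewrite ![F _.+2]qfactS ![F _.+1]qfactS qfact0.
have := (q2n M.+2, q2n M.+1, q2n M, q2n 0, q2n 1); rewrite ![q ^+ M.+3]exprSr.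
rewrite ![q ^+ M.+2]exprSr ![q ^+ M.+1]exprSr => -[[[[h2 h1] h0] h] h'].
rewrite !exprVn; field; rewrite ?(qfact_neq0, q2n, qn_neq0) ?h2 ?h1 ?h0 ?q0.
by rewrite (q2n 0 : 1 - q ^+ 2 != 0).
Qed.
Lemma extremal_form_row3 D c :
  extremal_form 0 0 D c 0 =
  q^-1 ^+ 4 * extremal_form 0 0 D.+1 c 0
  + q^-1 ^+ 2 * (extremal_form 1 0 D c 0
      - q ^+ 2 / q ^+ c ^+ 2 * (1 - q ^+ c ^+ 2) ^+ 2
        / ((1 - q ^+ 2) * (1 - q ^+ (D + c).+1 ^+ 2))
        * extremal_form 1 0 D c.-1 1)
  + extremal_form 1 0 D c 0.
Proof.
have h0 : 1 - q ^+ 2 != 0 := q2n 0.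
rewrite /extremal_form; set E1 := (X in q ^+ X * _).
set E2 := (X in _ = _ * (q ^+ X * _) + _ + _).
set E3 := (X in _ = _ + _ * (q ^+ X * _ - _) + _).
set E4 := (X in _ = _ + _ * (_ - _ * (q ^+ X * _)) + _).
have EE2 : q ^+ E2 = q ^+ E1 * q ^+ 4.
  by rewrite -exprD /E1 /E2; congr (_ ^+ _); lia.
have EE3 : q ^+ E3 = q ^+ E1 * q ^+ 4 * q ^+ D ^+ 2.
  by rewrite -exprM -!exprD /E1 /E3; congr (_ ^+ _); lia.
case: c @E1 @E2 @E3 @E4 EE2 EE3 => [|c] E1 E2 E3 E4 EE2 EE3.
  rewrite EE2 EE3 expr0 expr1n subrr expr0n mulr0 mul0r mul0r subr0.
  rewrite !(addn0, add0n, addnS, addSn).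
  rewrite ![F _.+2]qfactS ![F _.+1]qfactS qfact0.
  have hD := (q2n D.+2, q2n D.+1, q2n D, h0).
  rewrite ![q ^+ D.+3]exprSr ![q ^+ D.+2]exprSr ![q ^+ D.+1]exprSr in hD *.
  by field; rewrite ?(qfact_neq0, qn_neq0, hD, q0).
have EE4 : q ^+ E4 = q ^+ E1 * q ^+ 4 * q ^+ D ^+ 2 * q ^+ c.+1 ^+ 2.
  by rewrite -!exprM -!exprD /E1 /E4; congr (_ ^+ _); lia.
rewrite EE2 EE3 EE4; move: E1 {E2 E3 E4 EE2 EE3 EE4} => E1.
rewrite !(addn0, add0n, addnS, addSn) /=.
rewrite ![F _.+2]qfactS ![F _.+1]qfactS qfact0.
have hD := (q2n (D + c).+3, q2n (D + c).+2, q2n (D + c).+1, q2n (D + c),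
  q2n D.+1, q2n D, q2n c.+1, q2n c, h0).
rewrite ![q ^+ _.+4]exprSr ![q ^+ _.+3]exprSr ![q ^+ _.+2]exprSr
  ![q ^+ (_ + _).+1]exprSr ![q ^+ D.+1]exprSr ![q ^+ c.+1]exprSr (exprD q D c)
    in hD *.
by field; rewrite ?(qfact_neq0, qn_neq0, hD, q0).
Qed.

(** The counterpart, for the closed form, of the second raising relation with e2 = 0, as used in
    [boundary_form]. *)
Lemma extremal_form_boundary d1 d2 D c2 c3 :
  q ^+ (c3 + d2).+1 ^+ 2 *
  (q ^+ d1.+1 ^+ 2 * (1 - q ^+ c2.+1 ^+ 2) * extremal_form d1.+1 d2 D c2 c3.+1
   + q ^+ d2 * q ^+ c2.+1 * (1 - q ^+ d1.+1 ^+ 2)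
     * extremal_form d1 d2.+1 D c2.+1 c3) =
  q * q ^+ c2 * q ^+ c2.+1 * q ^+ d1.+1 * q ^+ (d1 + d2).+1 *
  ((1 - q ^+ (c3 + d2).+1 ^+ 2) * extremal_form d1.+1 d2 D c2.+1 c3).
Proof.
rewrite /extremal_form; set E1 := (X in _ * (q ^+ X * _) + _).
set E2 := (X in _ + _ * (q ^+ X * _)); set E3 := (X in _ = _ * (_ * (q ^+ X *
  _))).
have EE1 : q ^+ E1 = q ^+ E3 * q ^+ c2 ^+ 2 * q ^+ d1.+1 ^+ 2 / (q ^+ c3 ^+ 2 *
  q ^+ d2).
  apply: (mulIf (mulf_neq0 (expf_neq0 2 (qn_neq0 c3)) (qn_neq0 d2))).
  rewrite divfK ?mulf_neq0 ?expf_neq0 ?qn_neq0 //.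
  by rewrite -!exprM -!exprD /E1 /E3; congr (_ ^+ _); lia.
have EE2 : q ^+ E2 = q ^+ E3 * q ^+ d1 ^+ 2 * q ^+ c2.+1 / (q ^+ c3 ^+ 2 * q ^+
  d2 ^+ 2).
  apply: (mulIf (mulf_neq0 (expf_neq0 2 (qn_neq0 c3)) (expf_neq0 2 (qn_neq0
    d2)))).
  rewrite divfK ?mulf_neq0 ?expf_neq0 ?qn_neq0 //.
  by rewrite -!exprM -!exprD /E2 /E3; congr (_ ^+ _); lia.
rewrite EE1 EE2 !(addn0, add0n, addnS, addSn) /=.
rewrite ![F _.+2]qfactS ![F _.+1]qfactS.
(* These factors occur alike in all three forms, so they are abstracted and cancel without being
   expanded. *)
have X1 := q2n (d1 + d2 + D + c2 + c3).+3; have X2 := q2n (d1 + d2 + D + c2 +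
  c3).+2.
have X3 := q2n (d1 + d2 + D + c2 + c3).+1; have X4 := q2n (d1 + d2 + D + c2 +
  c3).
have Y1 := q2n (d1 + d2 + D).+1; have Y2 := q2n (d1 + d2 + D).
have Z1 := q2n (c2 + c3).+1; have Z2 := q2n (c2 + c3).
move: (1 - q ^+ (d1 + d2 + D + c2 + c3).+4 ^+ 2) X1 => x1 X1.
move: (1 - q ^+ (d1 + d2 + D + c2 + c3).+3 ^+ 2) X2 => x2 X2.
move: (1 - q ^+ (d1 + d2 + D + c2 + c3).+2 ^+ 2) X3 => x3 X3.
move: (1 - q ^+ (d1 + d2 + D + c2 + c3).+1 ^+ 2) X4 => x4 X4.
move: (1 - q ^+ (d1 + d2 + D).+2 ^+ 2) Y1 => y1 Y1.
move: (1 - q ^+ (d1 + d2 + D).+1 ^+ 2) Y2 => y2 Y2.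
move: (1 - q ^+ (c2 + c3).+2 ^+ 2) Z1 => z1 Z1.
move: (1 - q ^+ (c2 + c3).+1 ^+ 2) Z2 => z2 Z2.
have hD := (q2n (D + c2).+1, q2n (D + c2)).
have e1 : q ^+ (D + c2).+2 = q ^+ D * q ^+ c2 * q * q by rewrite !exprSr exprD.
have e2 : q ^+ (D + c2).+1 = q ^+ D * q ^+ c2 * q by rewrite !exprSr exprD.
have e3 : q ^+ (D + c2 + d1).+3 = q ^+ D * q ^+ c2 * q ^+ d1 * q * q * q.
  by rewrite !exprSr !exprD.
have e4 : q ^+ (c3 + d2).+1 = q ^+ c3 * q ^+ d2 * q by rewrite !exprSr exprD.
have e5 : q ^+ (d1 + d2).+1 = q ^+ d1 * q ^+ d2 * q by rewrite !exprSr exprD.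
have e6 : q ^+ d1.+1 = q ^+ d1 * q by rewrite !exprSr.
have e7 : q ^+ c2.+1 = q ^+ c2 * q by rewrite !exprSr.
rewrite e1 e2 in hD; rewrite e1 e2 e3 e4 e5 e6 e7.
by field; rewrite ?(qfact_neq0, qn_neq0, hD, q0, X1, X2, X3, X4, Y1, Y2, Z1,
  Z2).
Qed.
End ClosedForm.

(** * q-binomials and the contiguous relation for the sums over p *)

Section QBinomial.
Variables (K : fieldType) (q : K).
Hypotheses (q0 : q != 0) (q2n : forall n, 1 - q ^+ n.+1 ^+ 2 != 0).

Local Notation F n := (qpoch (q ^+ 2) (q ^+ 2) n).
Local Notation qb n j := (qbinom (q ^+ 2) n j).

Let F0 n : F n != 0. Proof. exact: qfact_neq0. Qed.
Let qn0 n : q ^+ n != 0. Proof. exact: expf_neq0. Qed.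

Lemma qbinom0 n : qb n 0 = 1.
Proof. by rewrite /qbinom /= subn0 qfact0 mul1r divff. Qed.

Lemma qbinom_small n j : (n < j)%N -> qb n j = 0.
Proof. by rewrite /qbinom ltnNge => /negPf ->. Qed.

Lemma qbinom_add m j : qb (j + m) j = F (j + m) / (F j * F m).
Proof. by rewrite /qbinom leq_addr addKn. Qed.

Lemma qbinom_pascall n p : (p <= n)%N ->
  qb n.+1 p.+1 = qb n p.+1 + q ^+ (n - p) ^+ 2 * qb n p.
Proof.
move=> pn; have [m ->] : exists m, n = (p + m)%N by exists (n - p)%N; lia.
rewrite -addSn addKn !qbinom_add; case: m => [|m].
  rewrite !addn0 qbinom_small // expr0 expr1n mul1r add0r.
  by rewrite qfact0 !mulr1 !divff.
rewrite -(addSnnS p m) !qbinom_add addnS !qfactS.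
have -> : q ^+ (p.+1 + m).+1 = q ^+ p.+1 * q ^+ m.+1 by rewrite -exprD addnS.
by field; rewrite ?(F0, q2n).
Qed.

Lemma qbinom_pascalr n p : (p <= n)%N ->
  qb n.+1 p.+1 = q ^+ p.+1 ^+ 2 * qb n p.+1 + qb n p.
Proof.
move=> pn; have [m ->] : exists m, n = (p + m)%N by exists (n - p)%N; lia.
rewrite -addSn !qbinom_add; case: m => [|m].
  rewrite !addn0 qbinom_small // mulr0 add0r.
  by rewrite qfact0 !mulr1 !divff.
rewrite -(addSnnS p m) !qbinom_add addnS !qfactS.
have -> : q ^+ (p.+1 + m).+1 = q ^+ p.+1 * q ^+ m.+1 by rewrite -exprD addnS.
by field; rewrite ?(F0, q2n).
Qed.

(** No bound on j is needed: for j > m both q-binomials vanish, and for j = m the left one and the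
    last factor do. *)
Lemma qbinomS_fact m j : qb m j.+1 * F j.+1 = qb m j * F j * (1 - q ^+ (m - j)
  ^+ 2).
Proof.
case: (ltngtP m j) => [mj|jm|->].
- by rewrite !qbinom_small ?ltnS ?(ltnW mj) // !mul0r.
- have [i ->] : exists i, m = (j + i.+1)%N by exists (m - j).-1; lia.
  rewrite addKn -addSnnS !qbinom_add addSnnS qbinom_add !qfactS.
  by field; rewrite ?(F0, q2n).
by rewrite qbinom_small // subnn expr0 expr1n subrr mul0r mulr0.
Qed.

(** A Pascal rule splits the q-binomial, and shifting the half v by one brings both halves to the
    same range; the values at 0 and n + 1 discard the boundary terms. *)
Lemma sum_pascal (V : nat -> K) n (u v : nat -> K) :
  u 0%N = 1 -> v 0%N = 0 -> u n.+1 = 0 ->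
  (forall p, (p <= n.+1)%N -> qb n.+1 p = u p + v p) ->
  \sum_(p < n.+2) V p * qb n.+1 p =
  \sum_(p < n.+1) (V p * u p + V p.+1 * v p.+1).
Proof.
move=> u0 v0 un E; rewrite (eq_bigr (fun p : 'I_n.+2 => V p * u p + V p * v p)).
  rewrite big_split /= big_ord_recr /= un mulr0 addr0.
  by rewrite [X in _ + X]big_ord_recl /= v0 mulr0 add0r -big_split.
by move=> p _; rewrite E ?mulrDr // -ltnS.
Qed.

(** The sum over p of the theorem with its parameters freed: up to a factor, a terminating 2phi1 in
    base q^2 with parameters q^(-2n), q^(2D+2) over q^(-2s). *)
Definition inner_sum n s D (z : K) :=
  \sum_(p < n.+1) z ^+ p * F (s - p) * F (D + p) * qb n p.

Lemma inner_sum_pascall n s D z : (n < s)%N -> inner_sum n.+1 s D z =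
  \sum_(p < n.+1) z ^+ p * F (s.-1 - p) * F (D + p) * qb n p
    * (1 - q ^+ (s - p) ^+ 2
       + z * q ^+ (n - p) ^+ 2 * (1 - q ^+ (D + p).+1 ^+ 2)).
Proof.
move=> ns; rewrite /inner_sum (@sum_pascal (fun p => z ^+ p * F (s - p) * F (D
  + p)) n
  (fun p => qb n p) (fun p => if p is p'.+1 then q ^+ (n - p') ^+ 2 * qb n p'
    else 0));
  rewrite ?qbinom0 ?qbinom_small //; last first.
  by case=> [_|p pn]; rewrite ?qbinom0 ?addr0 // qbinom_pascall.
apply: eq_bigr => p _; have pn : (p <= n)%N by rewrite -ltnS.
have -> : (s - p = (s.-1 - p).+1)%N by lia.
have -> : (s - p.+1 = s.-1 - p)%N by lia.
by rewrite /= addnS !qfactS [z ^+ p.+1]exprS; ring.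
Qed.

Lemma inner_sum_pascalr n s D z : (n < s)%N -> inner_sum n.+1 s D z =
  \sum_(p < n.+1) z ^+ p * F (s.-1 - p) * F (D + p) * qb n p
    * (q ^+ p ^+ 2 * (1 - q ^+ (s - p) ^+ 2)
       + z * (1 - q ^+ (D + p).+1 ^+ 2)).
Proof.
move=> ns; rewrite /inner_sum (@sum_pascal (fun p => z ^+ p * F (s - p) * F (D
  + p)) n
  (fun p => q ^+ p ^+ 2 * qb n p) (fun p => if p is p'.+1 then qb n p' else 0));
  rewrite ?qbinom0 ?qbinom_small ?expr0 ?expr1n ?mulr0 ?mulr1 //; last first.
  case=> [_|p pn]; first by rewrite !qbinom0 expr0 expr1n mulr1 addr0.
  by rewrite qbinom_pascalr.
apply: eq_bigr => p _; have pn : (p <= n)%N by rewrite -ltnS.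
have -> : (s - p = (s.-1 - p).+1)%N by lia.
have -> : (s - p.+1 = s.-1 - p)%N by lia.
by rewrite /= addnS !qfactS [z ^+ p.+1]exprS; ring.
Qed.

(* The two expansions of [inner_sum n.+1 s D z] given by the two Pascal rules
   are both needed: with them the relation holds term by term. *)
Lemma inner_sum_contiguous n s D z w : (n < s)%N ->
  w * q ^+ s ^+ 2 = z * q ^+ n ^+ 2 ->
  (1 - w * q ^+ D.+1 ^+ 2) * inner_sum n.+1 s D z - (1 - w) * inner_sum n s D z
    =
  w * (1 - z * q ^+ D.+1 ^+ 2) * inner_sum n s.-1 D.+1 z.
Proof.
move=> ns wz; rewrite mulrBl mul1r {1}inner_sum_pascall // inner_sum_pascalr //.
rewrite /inner_sum !mulr_sumr -!sumrB; apply: eq_bigr => p _.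
have pn : (p <= n)%N by rewrite -ltnS.
have wzp : w * q ^+ (s - p) ^+ 2 = z * q ^+ (n - p) ^+ 2.
  apply: (mulIf (expf_neq0 2 (qn0 p))).
  have ps : (p <= s)%N by apply: leq_trans pn (ltnW ns).
  have e1 : q ^+ s = q ^+ (s - p) * q ^+ p by rewrite -exprD subnK.
  have e2 : q ^+ n = q ^+ (n - p) * q ^+ p by rewrite -exprD subnK.
  by rewrite e1 e2 in wz; apply: (eq_lin1 (k := 1) wz); ring.
have -> : (s - p = (s.-1 - p).+1)%N by lia.
rewrite addSn !qfactS -wzp (_ : (s.-1 - p).+1 = s - p)%N; last by lia.
have -> : q ^+ (D + p).+1 = q ^+ D.+1 * q ^+ p by rewrite -exprD.
by ring.
Qed.
End QBinomial.

(** * The q-Saalschuetz sum *)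

Section Saalschutz.
Variables (K : fieldType) (q : K).
Hypotheses (q0 : q != 0) (q2n : forall n, 1 - q ^+ n.+1 ^+ 2 != 0).

Local Notation F n := (qpoch (q ^+ 2) (q ^+ 2) n).
Local Notation qb n j := (qbinom (q ^+ 2) n j).

Let F0 n : F n != 0. Proof. exact: qfact_neq0. Qed.
Let qn0 n : q ^+ n != 0. Proof. exact: expf_neq0. Qed.

(* A terminating balanced 3phi2 in base q^2, up to a factor. *)
Definition balanced_sum n m r Y : K :=
  \sum_(j < n.+1) (-1) ^+ j * q ^+ (j ^ 2 - j) * qb m j * F j
    * F (n + m + r - j) * F (Y + m + n - j) / F ((Y + m + n + r).+1 - j) * qb n
      j.

(** Pascal's rule in n, matched term by term. As m and Y stay fixed, the summation formula follows
    by induction on n with r arbitrary. *)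
Lemma balanced_sum_rec n m r Y :
  q ^+ r.+1 ^+ 2 * balanced_sum n.+1 m r Y =
  (1 - q ^+ (n + r).+1 ^+ 2) * balanced_sum n m r Y
  - (1 - q ^+ r.+1 ^+ 2) * balanced_sum n m r.+1 Y.
Proof.
rewrite /balanced_sum (@sum_pascal _ _ (fun j => (-1) ^+ j * q ^+ (j ^ 2 - j) *
  qb m j * F j
    * F (n.+1 + m + r - j) * F (Y + m + n.+1 - j) / F ((Y + m + n.+1 + r).+1 -
      j)) n
  (fun j => qb n j) (fun j => if j is j'.+1 then q ^+ (n - j') ^+ 2 * qb n j'
    else 0));
  rewrite ?qbinom0 ?qbinom_small //; last first.
  by case=> [_|j jn]; rewrite ?qbinom0 ?addr0 // qbinom_pascall.
rewrite !mulr_sumr -sumrB; apply: eq_bigr => j _ /=.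
have jn : (j <= n)%N by rewrite -ltnS.
(* Beyond m every term vanishes; afterwards m - j is a true difference. *)
case: (leqP j m) => [jm|mj]; last first.
  by rewrite !(@qbinom_small _ _ m) ?ltnS ?(ltnW mj) // !(mulr0, mul0r, addr0)
    subrr.
have pow : q ^+ (j.+1 ^ 2 - j.+1) = q ^+ (j ^ 2 - j) * q ^+ j ^+ 2.
  rewrite -exprM -exprD; congr (_ ^+ _); case: (nat_of_ord j) => [//|i].
  have := leq_pexp2l (ltn0Sn i) (isT : (1 <= 2)%N); lia.
rewrite pow [(-1) ^+ j.+1]exprS.
have := qbinomS_fact q0 q2n m j; move: (qb m j.+1) (F j.+1) => qbS FS qbFS.
(* With n - j and m - j named, the exponents below can all be written as sums. *)
have [al En] : exists al, n = (al + j)%N by exists (n - j)%N; lia.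
have [be Em] : exists be, m = (be + j)%N by exists (m - j)%N; lia.
have -> : (n.+1 + m + r - j = (n + m + r - j).+1)%N by lia.
have -> : (n.+1 + m + r - j.+1 = n + m + r - j)%N by lia.
have -> : (Y + m + n.+1 - j = (Y + m + n - j).+1)%N by lia.
have -> : (Y + m + n.+1 - j.+1 = Y + m + n - j)%N by lia.
have -> : ((Y + m + n.+1 + r).+1 - j = ((Y + m + n + r).+1 - j).+1)%N by lia.
have -> : ((Y + m + n.+1 + r).+1 - j.+1 = (Y + m + n + r).+1 - j)%N by lia.
have -> : (n + m + r.+1 - j = (n + m + r - j).+1)%N by lia.
have -> : ((Y + m + n + r.+1).+1 - j = ((Y + m + n + r).+1 - j).+1)%N by lia.
rewrite !qfactS.
have -> : (q ^+ (n + m + r - j).+1 = q ^+ r * q ^+ al * q ^+ be * q ^+ j * q).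
  by rewrite -!exprD -exprSr; congr (_ ^+ _); lia.
have -> : (q ^+ (Y + m + n - j).+1 = q ^+ Y * q ^+ al * q ^+ be * q ^+ j * q).
  by rewrite -!exprD -exprSr; congr (_ ^+ _); lia.
have E3 : q ^+ ((Y + m + n + r).+1 - j).+1 =
    q ^+ Y * q ^+ r * q ^+ al * q ^+ be * q ^+ j * q * q.
  by rewrite -!exprD -!exprSr; congr (_ ^+ _); lia.
have nz := q2n ((Y + m + n + r).+1 - j); rewrite E3 in nz *.
have -> : q ^+ (n - j) = q ^+ al by congr (_ ^+ _); lia.
have -> : q ^+ (n + r).+1 = q ^+ al * q ^+ j * q ^+ r * q.
  by rewrite -!exprD -exprSr; congr (_ ^+ _); lia.
have Eb : q ^+ (m - j) = q ^+ be by congr (_ ^+ _); lia.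
rewrite Eb in qbFS; rewrite [q ^+ r.+1]exprSr.
have -> : -1 * (-1) ^+ j * (q ^+ (j ^ 2 - j) * q ^+ j ^+ 2) * qbS * FS =
  - ((-1) ^+ j * q ^+ (j ^ 2 - j) * q ^+ j ^+ 2 * (qbS * FS)) by ring.
by rewrite qbFS; field; rewrite nz F0.
Qed.

Lemma balanced_sumE n m r Y :
  balanced_sum n m r Y = q ^+ (2 * m * n) * F (m + r) * F (n + r) * F (Y + m)
    * F (Y + n) / (F r * F (Y + m + n + r).+1 * F Y).
Proof.
elim: n r => [|n IH] r.
  rewrite /balanced_sum big_ord_recl big_ord0 /= !qbinom0 // addr0 muln0 !expr0.
  by rewrite !add0n !addn0 !subn0 qfact0; field; rewrite ?F0.
apply: (mulfI (expf_neq0 2 (qn0 r.+1))); rewrite balanced_sum_rec !IH.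
rewrite ?addnS ?addSn !qfactS.
have -> : q ^+ (2 * m * n.+1) = q ^+ (2 * m * n) * q ^+ m ^+ 2.
  by rewrite -exprM -exprD; congr (_ ^+ _); lia.
have nz1 := q2n (Y + m + n + r); have nz2 := q2n (Y + m + n + r).+1.
have e2 : q ^+ (Y + m + n + r).+2 = q ^+ Y * q ^+ m * q ^+ n * q ^+ r * q * q.
  by rewrite !exprSr !exprD.
have e3 : q ^+ (m + r).+1 = q ^+ m * q ^+ r * q by rewrite exprSr exprD.
have e4 : q ^+ (Y + n).+1 = q ^+ Y * q ^+ n * q by rewrite exprSr exprD.
have nz3 := q2n r; rewrite [q ^+ r.+1]exprSr in nz3 *.
rewrite e2 in nz2 *; rewrite e3 e4.
by field; rewrite ?(F0, nz1, nz2, nz3).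
Qed.
End Saalschutz.

(** * The double sum *)

Section PairingForm.
Variables (K : fieldType) (q : K).
Hypotheses (q0 : q != 0) (q2n : forall n, 1 - q ^+ n.+1 ^+ 2 != 0).

Local Notation F n := (qpoch (q ^+ 2) (q ^+ 2) n).
Local Notation qb n j := (qbinom (q ^+ 2) n j).

Let F0 n : F n != 0. Proof. exact: qfact_neq0. Qed.
Let qn0 n : q ^+ n != 0. Proof. exact: expf_neq0. Qed.

(** The right-hand side of the theorem over an arbitrary field, so that it can be studied at the
    complex image of q. *)
Definition pairing_form (d1 d2 d3 c2 c3 k : nat) : K :=
  q ^+ (2 * d2 * d3 + 2 * d1 * d2 + 2 * d1 * d3 + 4 * d3 + 4 * d1 + 4 * d2
        + 2 * c2 * c3 + 4 * c2 + 4 * c3 + k * (d2 + c2 - k))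
  * ((1 - q ^+ 2) ^+ 2 * (1 - q ^+ 4) * F d2 * F c2
     / (F (c2 + c3 + 1) * F (d1 + d2 + d3 + 1)))
  * \sum_(j < d1.+1)
      ((-1) ^+ j * q ^+ (j ^ 2 - j) * qb d1 j * qb c3 j * F j
       / qpoch (q ^+ (2 * d3 + 2 * c2 + 2 * c3 + 2 * d1 - 2 * j + 4)) (q ^+ 2)
           (d2 + 1)
       * \sum_(p < (d2 - k).+1)
           (q ^+ ((2 * c2 + 2 * c3 + 2 * d1 - 2 * j + 2) * p)
            * F (c3 + d2 + d1 - j - p) * F (d3 + p) * qb (d2 - k) p)).

Lemma qpoch_shift a n : qpoch (q ^+ 2 ^+ a.+1) (q ^+ 2) n = F (a + n) / F a.
Proof.
apply: (mulIf (F0 a)); rewrite divfK // /qpoch big_split_ord /= mulrC.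
congr (_ * _); apply: eq_bigr => i _.
by rewrite -exprS -exprD.
Qed.

Lemma pairing_form_boundary d1 d2 d3 c2 c3 :
  pairing_form d1 d2 d3 c2 c3 d2 = extremal_form q d1 d2 d3 c2 c3.
Proof.
rewrite /pairing_form /extremal_form subnn.
(* For k = d2 only p = 0 is left in the inner sum, and the outer one is the balanced sum with n =
   d1, m = c3, r = d2, Y = d3 + c2 + 1. *)
have -> : \sum_(j < d1.+1)
      ((-1) ^+ j * q ^+ (j ^ 2 - j) * qb d1 j * qb c3 j * F j
       / qpoch (q ^+ (2 * d3 + 2 * c2 + 2 * c3 + 2 * d1 - 2 * j + 4)) (q ^+ 2)
           (d2 + 1)
       * \sum_(p < 1)
           (q ^+ ((2 * c2 + 2 * c3 + 2 * d1 - 2 * j + 2) * p)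
            * F (c3 + d2 + d1 - j - p) * F (d3 + p) * qb 0 p)) =
    F d3 * balanced_sum q d1 c3 d2 (d3 + c2).+1.
  rewrite /balanced_sum mulr_sumr; apply: eq_bigr => j _.
  have jd : (j <= d1)%N by rewrite -ltnS.
  rewrite big_ord_recl big_ord0 addr0 /= muln0 expr0 qbinom0 // addn0 subn0.
  have -> : (2 * d3 + 2 * c2 + 2 * c3 + 2 * d1 - 2 * j + 4 =
     2 * ((d3 + c2).+1 + c3 + d1 - j).+1)%N by lia.
  rewrite exprM qpoch_shift.
  have -> : ((d3 + c2).+1 + c3 + d1 - j + (d2 + 1) =
     ((d3 + c2).+1 + c3 + d1 + d2).+1 - j)%N by lia.
  have -> : (c3 + d2 + d1 - j = d1 + c3 + d2 - j)%N by lia.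
  by field; rewrite !F0.
rewrite balanced_sumE //; set E1 := (X in q ^+ X * _ * _).
set E2 := (X in _ = q ^+ X * _).
(* The exponent 2 c3 d1 of [extremal_form] comes from [balanced_sumE], and d2 c2 is k (d2 + c2 - k)
   at k = d2. *)
have EE : q ^+ E2 = q ^+ E1 * q ^+ (2 * c3 * d1).
  rewrite -exprD /E1 /E2; congr (_ ^+ _); rewrite addKn; lia.
rewrite EE !addn1.
have -> : ((d3 + c2).+1 + c3 = (d3 + c2 + c3).+1)%N by lia.
have -> : ((d3 + c2 + c3).+1 + d1 + d2 = (d1 + d2 + d3 + c2 + c3).+1)%N by lia.
have -> : ((d3 + c2).+1 + d1 = (d3 + c2 + d1).+1)%N by lia.
by field; rewrite !F0.
Qed.

Lemma pairing_form_root1 d1 d2 d3 c2 c3 k : (k <= d2)%N -> (k <= c2)%N ->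
  q ^+ d3 ^+ 2 * q ^+ 2 * q ^+ (c2 - k) ^+ 3 * (1 - q ^+ d2.+1 ^+ 2)
    * pairing_form d1 d2 d3.+1 c2 c3 k =
  q ^+ d2.+1 * q *
  (q ^+ (d2 - k) * q ^+ (c2 - k) * (1 - q ^+ (d3 + (c2 - k)).+1 ^+ 2)
     * pairing_form d1 d2.+1 d3 c2 c3 k
   - (1 - q ^+ (c2 - k) ^+ 2) * pairing_form d1 d2.+1 d3 c2 c3 k.+1).
Proof.
move=> kd kc; rewrite /pairing_form subSn // subSS.
have [a Ed] : exists a, d2 = (k + a)%N by exists (d2 - k)%N; lia.
have [b Ec] : exists b, c2 = (k + b)%N by exists (c2 - k)%N; lia.
have -> : (d2 - k = a)%N by lia.
have -> : (c2 - k = b)%N by lia.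
have -> : (d2 + c2 - k = k + a + b)%N by lia.
have -> : (d2.+1 + c2 - k = (k + a + b).+1)%N by lia.
have -> : (d2.+1 + c2 - k.+1 = k + a + b)%N by lia.
set E1 := (X in _ * (q ^+ X * _ * _) = _).
set E2 := (X in _ = _ * (_ * (q ^+ X * _ * _) - _)).
set E3 := (X in _ = _ * (_ - _ * (q ^+ X * _ * _))).
set S1 := (X in _ * (_ * X) = _); set S2 := (X in _ = _ * (_ * (_ * X) - _)).
set S3 := (X in _ = _ * (_ - _ * (_ * X))).
have EE1 : q ^+ E1 = q ^+ E2 * q ^+ d2 ^+ 2 / (q ^+ d3 ^+ 2 * q ^+ k).
  apply: (mulIf (mulf_neq0 (expf_neq0 2 (qn0 d3)) (qn0 k))).
  rewrite divfK ?mulf_neq0 ?expf_neq0 ?qn0 // -!exprM -!exprD /E1 /E2.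
  by congr (_ ^+ _); nia.
have EE3 : q ^+ E3 = q ^+ E2 * q ^+ a * q ^+ b.
  by rewrite -!exprD /E3 /E2; congr (_ ^+ _); nia.
have SS : q ^+ b ^+ 2 * S1 = (1 - q ^+ (d3 + b).+1 ^+ 2) * S2 - (1 - q ^+ b ^+
  2) * S3.
  rewrite /S1 /S2 /S3 !mulr_sumr -sumrB; apply: eq_bigr => j _.
  have jd : (j <= d1)%N by rewrite -ltnS.
  set z := (2 * c2 + 2 * c3 + 2 * d1 - 2 * j + 2)%N.
  have innerE n s D : \sum_(p < n.+1) q ^+ (z * p) * F (s - p) * F (D + p) * qb
    n p =
      inner_sum q n s D (q ^+ z).
    by apply: eq_bigr => p _; rewrite exprM.
  rewrite !innerE.
  (* The choice w = q^(2 (c2 - k)) satisfies the required w q^(2s) = z q^(2n). *)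
  have := @inner_sum_contiguous _ q q0 q2n a (c3 + d2.+1 + d1 - j) d3 (q ^+ z)
    (q ^+ b ^+ 2).
  have -> : ((c3 + d2.+1 + d1 - j).-1 = c3 + d2 + d1 - j)%N by lia.
  have -> : q ^+ b ^+ 2 * q ^+ d3.+1 ^+ 2 = q ^+ (d3 + b).+1 ^+ 2.
    by rewrite -!exprM -!exprD; congr (_ ^+ _); lia.
  move=> contig.
  set a' := ((d3 + c2).+1 + c3 + d1 - j)%N.
  (* Thus 1 - z q^(2 (d3 + 1)) is the first factor of the denominator belonging to d3; cancelling it
     leaves the denominator belonging to d3 + 1. *)
  have Ez : q ^+ z * q ^+ d3.+1 ^+ 2 = q ^+ a'.+1 ^+ 2.
    by rewrite -!exprM -!exprD /z /a'; congr (_ ^+ _); lia.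
  have -> : (2 * d3.+1 + 2 * c2 + 2 * c3 + 2 * d1 - 2 * j + 4 = 2 * a'.+2)%N.
    by rewrite /a'; lia.
  have -> : (2 * d3 + 2 * c2 + 2 * c3 + 2 * d1 - 2 * j + 4 = 2 * a'.+1)%N.
    by rewrite /a'; lia.
  rewrite !exprM !qpoch_shift !addn1 !addnS addSn !qfactS.
  have nz1 := q2n (a' + d2)%N; have nz2 := q2n (a' + d2).+1; have nz3 := q2n a'.
  rewrite Ez [(c3 + d2.+1)%N]addnS in contig.
  apply: (eq_lin1 (k := - ((-1) ^+ j * q ^+ (j ^ 2 - j) * qb d1 j * qb c3 j * F
    j
    * F a' / (F (a' + d2) * (1 - q ^+ (a' + d2).+1 ^+ 2)
    * (1 - q ^+ (a' + d2).+2 ^+ 2)))) (contig _ _)).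
  - by lia.
  - by rewrite -!exprM -!exprD /z; congr (_ ^+ _); lia.
  by field; rewrite ?(F0, nz1, nz2, nz3).
have Eq2 : q ^+ d2 = q ^+ k * q ^+ a by rewrite -exprD Ed.
apply: (eq_lin1 (k := q ^+ 2 * q ^+ d2 ^+ 2 / q ^+ k * q ^+ b * (1 - q ^+ d2.+1
  ^+ 2)
  * q ^+ E2 * ((1 - q ^+ 2) ^+ 2 * (1 - q ^+ 4) * F d2 * F c2
    / (F (c2 + c3).+1 * F (d1 + d2 + d3).+2))) SS).
move: S1 S2 S3 {SS} => s1 s2 s3; rewrite EE1 EE3 !addn1 !addnS !addSn !qfactS.
rewrite [q ^+ d2.+1]exprSr Eq2.
have nz1 := q2n (c2 + c3); have nz2 := q2n (d1 + d2 + d3); have nz3 := q2n (d1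
  + d2 + d3).+1.
by field; rewrite ?(F0, qn0, nz1, nz2, nz3).
Qed.
End PairingForm.

(** * Solving the recursions *)

Section Recursion.
Variables (K : fieldType) (q : K).
Hypotheses (q0 : q != 0) (q2n : forall n, 1 - q ^+ n.+1 ^+ 2 != 0).
Variable phi : nat -> nat -> nat -> nat -> nat ->
  nat -> nat -> nat -> nat -> nat -> K.
Hypothesis root1 : forall d1 d2 d3 c2 c3 e1 e2 e3 f2 f3,
  q ^+ e3 ^+ 2 * q ^+ 2 * q ^+ f2 ^+ 3 * (1 - q ^+ d2 ^+ 2)
    * phi d1 d2.-1 d3.+1 c2 c3 e1 e2 e3.+1 f2 f3 =
  q ^+ d2 * q *
  (q ^+ e2 * q ^+ f2 * (1 - q ^+ 2 * q ^+ e3 ^+ 2 * q ^+ f2 ^+ 2)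
     * phi d1 d2 d3 c2 c3 e1 e2.+1 e3 f2 f3
   - (1 - q ^+ f2 ^+ 2) * phi d1 d2 d3 c2 c3 e1.+1 e2 e3 f2.-1 f3.+1).
Hypothesis root2 : forall d1 d2 d3 c2 c3 e1 e2 e3 f2 f3,
  q ^+ e2 ^+ 2 * q ^+ f3 ^+ 2 *
  (q ^+ d1 ^+ 2 * (1 - q ^+ c2 ^+ 2)
     * phi d1 d2 d3 c2.-1 c3.+1 e1 e2 e3 f2 f3
   + q ^+ d2 * q ^+ c2 * (1 - q ^+ d1 ^+ 2)
     * phi d1.-1 d2.+1 d3 c2 c3 e1 e2 e3 f2 f3) =
  q * q ^+ d2 * q ^+ c2 * q ^+ d1 * q ^+ e1 *
  (q ^+ f3 ^+ 2 * (1 - q ^+ e2 ^+ 2)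
     * phi d1 d2 d3 c2 c3 e1.+1 e2.-1 e3 f2 f3
   + q ^+ e2 * q ^+ f2 * (1 - q ^+ f3 ^+ 2)
     * phi d1 d2 d3 c2 c3 e1 e2 e3 f2.+1 f3.-1).
Hypothesis lower2 : forall d1 d2 d3 c2 c3 e1 e2 e3 f2 f3,
  q * q ^+ e1 * q ^+ e2 * q ^+ f2 *
  (q ^+ c2 * q ^+ d1 * q ^+ d2 * (1 - q ^+ c3 ^+ 2)
     * phi d1 d2 d3 c2.+1 c3.-1 e1 e2 e3 f2 f3
   + q ^+ c3 ^+ 2 * q ^+ d1 * (1 - q ^+ d2 ^+ 2)
     * phi d1.+1 d2.-1 d3 c2 c3 e1 e2 e3 f2 f3) =
  q ^+ c3 ^+ 2 * q ^+ d2 ^+ 2 *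
  (q ^+ e2 * q ^+ f2 * (1 - q ^+ e1 ^+ 2)
     * phi d1 d2 d3 c2 c3 e1.-1 e2.+1 e3 f2 f3
   + q ^+ e1 ^+ 2 * (1 - q ^+ f2 ^+ 2)
     * phi d1 d2 d3 c2 c3 e1 e2 e3 f2.-1 f3.+1).
Hypothesis row3 : forall D c2 c3, phi 0 0 D c2 c3 0 0 D c2 c3 =
  q^-1 ^+ 4 * phi 0 0 D.+1 c2 c3 0 0 D.+1 c2 c3
  + q^-1 ^+ 2 * phi 0 1 D c2 c3 0 1 D c2 c3 + phi 1 0 D c2 c3 1 0 D c2 c3.
Hypothesis row1 : forall M, phi 0 0 0 M 0 0 0 0 M 0 =
  (q ^+ M ^+ 2 * (1 - q ^+ 2) / (1 - q ^+ M.+1 ^+ 2) + q^-1 ^+ 2)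
     * phi 0 0 0 M.+1 0 0 0 0 M.+1 0
  + q^-1 ^+ 4 * q^-1 ^+ M ^+ 2 * phi 0 0 0 M 1 0 0 0 M 1.
Hypothesis phi1 : phi 0 0 0 0 0 0 0 0 0 0 = 1.

Let qn0 n : q ^+ n != 0. Proof. exact: expf_neq0. Qed.

Local Notation norm N D c2 c3 := (phi N 0 D c2 c3 N 0 D c2 c3).
Local Notation form := (extremal_form q).

Let form0 d1 d2 D c2 c3 : form d1 d2 D c2 c3 != 0.
Proof.
apply: extremal_form_neq0 => //.
by have := q2n 1; rewrite -exprM.
Qed.

(* For d2 = 0 the derivation E_1 kills the left word, so that only the two
   terms coming from the right word remain. *)
Lemma root1_d2_0 N D c2 c3 f3 :
  q ^+ c2 * (1 - q ^+ (D + c2).+1 ^+ 2)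
    * phi N.+1 0 D c2.-1 c3 N 1 D c2 f3 =
  (1 - q ^+ c2 ^+ 2) * phi N.+1 0 D c2.-1 c3 N.+1 0 D c2.-1 f3.+1.
Proof.
have := root1 N.+1 0 D c2.-1 c3 N 0 D c2 f3.
rewrite expr0 expr1n subrr mulr0 mul0r mul1r mul1r => /esym/eqP.
rewrite mulf_eq0 (negPf q0) /= subr_eq0 => /eqP <-.
by congr (_ * (1 - _) * _); rewrite [q ^+ (D + c2).+1]exprS exprD !exprMn mulrA.
Qed.

(** [lower2] links the two norms to one off-diagonal pairing, which [root1_d2_0] turns back into a
    norm; for N = 0 that pairing has coefficient zero. *)
Lemma norm_c N D c2 c3 :
  q ^+ c3.+1 ^+ 2 * (1 - q ^+ c2.+1 ^+ 2) * (1 - q ^+ (D + c2 + N).+2 ^+ 2)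
    * norm N D c2 c3.+1 =
  q ^+ (c2 + N).+1 ^+ 2 * (1 - q ^+ c3.+1 ^+ 2) * (1 - q ^+ (D + c2).+2 ^+ 2)
    * norm N D c2.+1 c3.
Proof.
have := lower2 N 0 D c2 c3.+1 N 0 D c2.+1 c3.
case: N => [|N] /= E.
  apply: (eq_lin1 (k := - (1 - q ^+ (D + c2).+2 ^+ 2)) E).
  by rewrite !addn0 ![q ^+ c2.+1]exprS; ring.
have E' := root1_d2_0 N D c2.+1 c3.+1 c3; rewrite addnS /= in E'.
apply: (eq_lin2 (k := - (1 - q ^+ (D + c2).+2 ^+ 2))
  (k' := - q ^+ c3.+1 ^+ 2 * (1 - q ^+ N.+1 ^+ 2)) E E').
have -> : q ^+ (D + c2 + N.+1).+2 = q ^+ (D + c2).+2 * q ^+ N.+1.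
  by rewrite -exprD; congr (_ ^+ _); lia.
have -> : q ^+ (c2 + N.+1).+1 = q ^+ c2.+1 * q ^+ N.+1.
  by rewrite -exprD; congr (_ ^+ _); lia.
by rewrite ![q ^+ c2.+1]exprS; ring.
Qed.

(** Besides the two norms, the four relations [A1], [A2], [B1], [B2] involve four other pairings;
    the combination below eliminates them. *)
Lemma norm_N N D c :
  q ^+ N.+1 ^+ 2 * (1 - q ^+ D.+1 ^+ 2) * norm N.+1 D c 0 =
  q ^+ D.+1 ^+ 2 * (1 - q ^+ N.+1 ^+ 2) * norm N D.+1 c 0.
Proof.
have A1 := root1 N 1 D c 0 N 0 D c 0.
have A2 := root1_d2_0 N D c 1 0.
have B1 := root2 N.+1 0 D c 0 N 1 D c 0.
have B2 := root2 N.+1 0 D c 0 N.+1 0 D c.-1 1.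
have qc := qn0 c; have h0 : 1 - q ^+ 2 != 0 := q2n 0.
apply: (eq_lin4 (k1 := - (1 - q ^+ N.+1 ^+ 2) / (q ^+ c ^+ 3 * (1 - q ^+ 2)))
  (k2 := - (1 - q ^+ (D + c).+1 ^+ 2) / (q ^+ c ^+ 3 * (1 - q ^+ 2)))
  (k3 := (1 - q ^+ c ^+ 2) / (q ^+ c ^+ 4 * (1 - q ^+ 2)))
  (k4 := q ^+ 2 * q ^+ N.+1 ^+ 2 * (1 - q ^+ c ^+ 2)
     / (q ^+ c ^+ 4 * (1 - q ^+ 2))) A1 B1 B2 A2).
rewrite [q ^+ (D + c).+1]exprS exprD ![q ^+ N.+1]exprS ![q ^+ D.+1]exprS /=.
(* [c.-1] is a true predecessor only for c > 0; for c = 0 every term containing it has coefficient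
   zero. *)
case: c {A1 A2 B1 B2} qc => [|c] qc; last rewrite ![q ^+ c.+1]exprS /= in qc *.
  by rewrite !expr0; field; rewrite h0 ?oner_eq0.
by field; rewrite h0 qn0 q0.
Qed.

(** [root2] and [root1_d2_0] remove from [row3] the pairing with d2 = 1, leaving norms only. *)
Lemma norm_row3 D c :
  norm 0 D c 0 =
  q^-1 ^+ 4 * norm 0 D.+1 c 0
  + q^-1 ^+ 2 * (norm 1 D c 0
      - q ^+ 2 / q ^+ c ^+ 2 * (1 - q ^+ c ^+ 2) ^+ 2
        / ((1 - q ^+ 2) * (1 - q ^+ (D + c).+1 ^+ 2)) * norm 1 D c.-1 1)
  + norm 1 D c 0.
Proof.
rewrite row3; congr (_ + _ * _ + _).
have A2 := root1_d2_0 0 D c 1 0.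
have B1 := root2 1 0 D c 0 0 1 D c 0.
have qc := qn0 c; have h0 : 1 - q ^+ 2 != 0 := q2n 0.
have w0 := q2n (D + c).
apply: (eq_lin2 (k := (q ^+ 2 * q ^+ c * (1 - q ^+ 2))^-1)
  (k' := - q ^+ 2 * (1 - q ^+ c ^+ 2)
    / (q ^+ c ^+ 2 * (1 - q ^+ 2) * (1 - q ^+ (D + c).+1 ^+ 2))) B1 A2).
by rewrite !expr0 !expr1 /=; field; rewrite ?h0 ?qc ?q0 ?w0.
Qed.

(* [norm] and [form] satisfy the same homogeneous relations; [good] records
   their ratio, which is propagated from the empty word. *)
Lemma norm_form N D c2 c3 : norm N D c2 c3 = form N 0 D c2 c3.
Proof.
pose good N D c2 c3 r := norm N D c2 c3 = r * form N 0 D c2 c3.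
have stepc N' D' c2' c3' r : good N' D' c2'.+1 c3' r -> good N' D' c2' c3'.+1 r.
  move=> H; apply: (mulfI (mulf_neq0 (mulf_neq0 (expf_neq0 2 (qn0 c3'.+1)) (q2n
    c2'))
     (q2n (D' + c2' + N').+1))).
  by rewrite norm_c H mulrCA -extremal_form_c // [RHS]mulrCA.
have stepN N' D' c r : good N' D'.+1 c 0%N r -> good N'.+1 D' c 0%N r.
  move=> H; apply: (mulfI (mulf_neq0 (expf_neq0 2 (qn0 N'.+1)) (q2n D'))).
  by rewrite norm_N H mulrCA -extremal_form_N // [RHS]mulrCA.
have goodc N' D' M r : good N' D' M 0%N r -> forall c2' c3', (c2' + c3' = M)%N
  ->
    good N' D' c2' c3' r.
  move=> H c2' c3'; elim: c3' c2' => [|c3' IH] c2'; first by rewrite addn0 =>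
    ->.
  by rewrite addnS -addSn => /IH /stepc.
have goodN M r : forall N' D', good 0%N (N' + D')%N M 0%N r -> good N' D' M 0%N
  r.
  by elim=> [//|N' IH] D'; rewrite addSnnS => /IH /stepN.
(* [row1] expresses the norm of length M through norms of length M + 1. The latter are r times the
   closed form, so [extremal_form_row1] and the ratio 1 at length M give r = 1. *)
have start M : good 0%N 0%N M 0%N 1.
  elim: M => [|M IH].
    rewrite /good phi1 mul1r /extremal_form /= !(muln0, addn0) expr0 mul1r.
    rewrite !qfactS qfact0; have h0 := q2n 0; have h1 := q2n 1.
    by rewrite expr1 in h0 *; field; rewrite ?h0 ?h1 ?oner_eq0.
  pose r := norm 0 0 M.+1 0 / form 0 0 0 M.+1 0.
  have H : good 0%N 0%N M.+1 0%N r by rewrite /good /r divfK.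
  suff -> : 1 = r by [].
  apply: (mulIf (form0 0 0 0 M 0)); rewrite -IH row1.
  rewrite H (goodc _ _ _ _ H M 1%N) ?addn1 // (extremal_form_row1 q0 q2n M).
  by move: (r) (_ / _ + _) (_ * _ ^+ 2) => r' u v; ring.
(* The factor makes the statement true for M = 0 as well; the term of [norm_row3] to be rewritten
   carries the same factor. *)
have pred1 D' M r : good 1%N D' M 0%N r -> (1 - q ^+ M ^+ 2) ^+ 2 * norm 1 D'
  M.-1 1 =
    (1 - q ^+ M ^+ 2) ^+ 2 * (r * form 1 0 D' M.-1 1).
  case: M => [|M] H; first by rewrite expr0 expr1n subrr expr0n !mul0r.
  by rewrite (goodc _ _ _ _ H M 1%N) ?addn1.
(* The same comparison along D, with [norm_row3] in place of [row1]. *)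
have all D' M : good 0%N D' M 0%N 1.
  elim: D' M => [//|D' IH] M.
  pose r := norm 0 D'.+1 M 0 / form 0 0 D'.+1 M 0.
  have H : good 0%N D'.+1 M 0%N r by rewrite /good /r divfK.
  suff -> : 1 = r by [].
  apply: (mulIf (form0 0 0 D' M 0)); rewrite -IH norm_row3.
  have H1 := goodN _ _ 1%N D' H.
  rewrite H H1 (extremal_form_row3 q0 q2n D' M).
  have H2 := pred1 _ _ _ H1; have w0 := q2n (D' + M)%N; have h0 := q2n 0.
  rewrite expr1 in h0; have qM := qn0 M.
  apply: (eq_lin1 (k := - (q ^+ M ^+ 2 * (1 - q ^+ 2)
    * (1 - q ^+ (D' + M).+1 ^+ 2))^-1) H2).
  by move: (r) => r'; field; rewrite ?h0 ?w0 ?qM ?q0.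
by rewrite (goodc _ _ _ _ (goodN _ _ _ _ (all _ _)) c2 c3 erefl) mul1r.
Qed.
(** For k = d2 the right word contains no p2, so the term of [root2] lowering e2 drops out and the
    others express the case d2 + 1 through d2. *)
Lemma boundary_form d1 d2 D c2 c3 : (d2 <= c2)%N ->
  phi d1 d2 D c2 c3 (d1 + d2) 0 D (c2 - d2) (c3 + d2) = form d1 d2 D c2 c3.
Proof.
elim: d2 d1 c2 c3 => [|d2 IH] d1 c2 c3.
  by rewrite !addn0 subn0 norm_form.
case: c2 => [//|c2]; rewrite ltnS => d2c2.
have := root2 d1.+1 d2 D c2.+1 c3 (d1 + d2).+1 0 D (c2 - d2) (c3 + d2).+1 => /=.
rewrite -!addSn (IH d1.+1 c2 c3.+1) // -subSn // (IH d1.+1 c2.+1 c3) ?leqW //.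
have := extremal_form_boundary q0 q2n d1 d2 D c2 c3.
have qc : q ^+ d2 * q ^+ (c2 - d2) = q ^+ c2 by rewrite -exprD subnKC.
rewrite subSS addSnnS addSn -qc expr0 expr1n subrr => E1 E2.
apply: (mulfI (mulf_neq0 (expf_neq0 2 (qn0 (c3 + d2).+1))
  (mulf_neq0 (mulf_neq0 (qn0 d2) (qn0 c2.+1)) (q2n d1)))).
by apply: (eq_lin2 (k := 1) (k' := -1) E2 E1); rewrite !addnS; ring.
Qed.
Lemma pairing_formE d1 d2 D c2 c3 k : (k <= d2)%N -> (k <= c2)%N ->
  phi d1 d2 D c2 c3 (d1 + k) (d2 - k) D (c2 - k) (c3 + k) =
  pairing_form q d1 d2 D c2 c3 k.
Proof.
elim: d2 d1 D c2 c3 k => [|d2 IH] d1 D c2 c3 k kd kc.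
  have -> : k = 0%N by lia.
  by rewrite pairing_form_boundary // -boundary_form // !addn0 !subn0.
have [n] := ubnP (d2.+1 - k)%N; elim: n k kd kc => [//|n IHn] k kd kc kn.
case: (eqVneq k d2.+1) => [Ek|kd'].
  by rewrite {1 2}Ek subnn Ek pairing_form_boundary // -boundary_form // -Ek.
have {kd kd'}kd : (k <= d2)%N by lia.
have := root1 d1 d2.+1 D c2 c3 (d1 + k) (d2 - k) D (c2 - k) (c3 + k).
(* On the left d2 is smaller by one and D larger by one, so that pairing is known; what remains ties
   k to k + 1. *)
rewrite /= IH // pairing_form_root1 // -subSn //.
have -> : q ^+ 2 * q ^+ D ^+ 2 * q ^+ (c2 - k) ^+ 2 = q ^+ (D + (c2 - k)).+1 ^+
  2.
  by rewrite -!exprM -!exprD; congr (_ ^+ _); lia.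
move/(mulfI (mulf_neq0 (qn0 d2.+1) q0)).
have -> : (1 - q ^+ (c2 - k) ^+ 2) * phi d1 d2.+1 D c2 c3 (d1 + k).+1 (d2 - k) D
    (c2 - k).-1 (c3 + k).+1 =
    (1 - q ^+ (c2 - k) ^+ 2) * pairing_form q d1 d2.+1 D c2 c3 k.+1.
  (* At k = c2 the value k + 1 is out of range, but its coefficient is zero. *)
  case: (eqVneq k c2) => [->|kc']; first by rewrite subnn expr0 expr1n subrr
    !mul0r.
  rewrite -IHn; [|lia|lia|lia]; rewrite !addnS subSS.
  by have -> : ((c2 - k).-1 = c2 - k.+1)%N by lia.
move/addIr/(mulfI (mulf_neq0 (mulf_neq0 (qn0 _) (qn0 _)) (q2n _))) => <-.
by [].
Qed.
End Recursion.

(** * From the inner product to the pairing of words *)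

Section Bridge.
Variables (R : realType) (q : R).
Local Notation K := R[i].
Local Notation Q := (real_complex R q).
Local Notation A := (OUq q).
Local Notation x := (gx Q).
Local Notation T := (gdetV Q).
Local Notation m := (fun i j => cominor Q i j * T).
Variables (star : A -> A) (haar : A -> K).
Hypotheses (Q0 : Q != 0) (star_Uq : is_Uq_star star).

Lemma starK u : star (star u) = u.
Proof. by case: star_Uq. Qed.

Lemma star1 : star 1 = 1.
Proof.
have := starM star_Uq (star 1) 1; by rewrite mulr1 !starK mulr1 => <-.
Qed.

Lemma starX u n : star (u ^+ n) = star u ^+ n.
Proof.
elim: n => [|n IH]; first by rewrite !expr0 star1.
by rewrite exprS starM // IH exprSr.
Qed.

(** The coefficients q^2, -q, 1 of the basis vectors cancel the factor (-q)^(j-3), with j counted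
    from 1, in the adjoint of x_3j, leaving the bare cofactor. *)
Lemma scaled_star3 (j : 'I_3) (k : K) : k = (- Q) ^+ (2 - j) -> k *: star (x o3
  j) = m o3 j.
Proof.
move=> ->; rewrite star_gx3 // scalerA divff ?scale1r //.
by rewrite expf_neq0 // oppr_eq0.
Qed.

Lemma innerL_pairing d1 d2 d3 c2 c3 n e1 e2 e3 f2 f3 :
  innerL star haar
    (star (x o3 o3) ^+ d1 * (- Q *: star (x o3 o2)) ^+ d2
      * (Q ^+ 2 *: star (x o3 o1)) ^+ d3 * x o1 o2 ^+ c2 * x o1 o3 ^+ c3
      * qdet Q ^+ n)
    (star (x o3 o3) ^+ e1 * (- Q *: star (x o3 o2)) ^+ e2
      * (Q ^+ 2 *: star (x o3 o1)) ^+ e3 * x o1 o2 ^+ f2 * x o1 o3 ^+ f3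
      * qdet Q ^+ n) =
  Uq_pairing haar d1 d2 d3 c2 c3 e1 e2 e3 f2 f3.
Proof.
rewrite /innerL; set u := _ * qdet Q ^+ n; set w := _ * x o1 o3 ^+ f3.
have sD : star (qdet Q) = T by case: star_Uq.
have conjN : (- Q)^* = - Q by rewrite -rmorphN; exact: conjQ.
have conj2 : (Q ^+ 2)^* = Q ^+ 2 by rewrite -rmorphXn; exact: conjQ.
have -> : star u = T ^+ n * lword (Q ^+ 2 *: x o3 o1) (- Q *: x o3 o2) (x o3 o3)
    (- Q *: m o1 o2) (Q ^+ 2 *: m o1 o3) d1 d2 d3 c2 c3.
  rewrite /u.
  rewrite !(starM star_Uq).
  rewrite !starX.
  rewrite !(starZ star_Uq).
  rewrite conjN conj2 sD !starK.
  rewrite !(star_gx1 star_Uq).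
  rewrite expr1 sqrrN /lword.
  by rewrite !mulrA.
have -> : w = rword (m o3 o1) (m o3 o2) (m o3 o3) (x o1 o2) (x o1 o3) e1 e2 e3
  f2 f3.
  rewrite /w /rword (scaled_star3 (_ : - Q = _)) ?expr1 //.
  rewrite (scaled_star3 (_ : Q ^+ 2 = _)) ?sqrrN //.
  by rewrite -[star (x o3 o3)]scale1r (scaled_star3 (_ : 1 = _)) ?subnn ?expr0.
rewrite /Uq_pairing /pairing; congr haar.
set L := lword _ _ _ _ _ _ _ _ _ _; set W := rword _ _ _ _ _ _ _ _ _ _.
(* The powers of [T] and [qdet Q] stand at opposite ends of the product; centrality of [T] brings
   them together, where they cancel. *)
have TX (v : A) : T ^+ n * v = v * T ^+ n.
  by apply/commr_sym/commrX/commr_sym; exact: gdetV_comm.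
rewrite (TX L) -(mulrA L) (TX (W * _)) -(mulrA W) -exprMn_comm; last first.
  exact/commr_sym/gdetV_comm.
by rewrite qdet_gdetV expr1n mulr1.
Qed.
End Bridge.

(** Transports the formula between the real q and its complex image. *)
Lemma pairing_form_morph (K L : fieldType) (f : {rmorphism K -> L}) q
    d1 d2 d3 c2 c3 k :
  f (pairing_form q d1 d2 d3 c2 c3 k) = pairing_form (f q) d1 d2 d3 c2 c3 k.
Proof.
have fF a p n : f (qpoch a p n) = qpoch (f a) (f p) n.
  rewrite /qpoch rmorph_prod; apply: eq_bigr => i _.
  by rewrite rmorphB rmorph1 rmorphM rmorphXn.
have fqb p n j : f (qbinom p n j) = qbinom (f p) n j.
  rewrite /qbinom; case: ifP => _; last exact: rmorph0.
  by rewrite fmorph_div rmorphM !fF.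
rewrite /pairing_form !rmorphM fmorphV rmorph_sum !rmorphM !fF !rmorphXn.
rewrite !rmorphB !rmorph1 !rmorphXn; congr (_ * _); apply: eq_bigr => j _.
rewrite !rmorphM fmorphV !fF !fqb !rmorphXn rmorphN rmorph1 rmorph_sum.
congr (_ * _); apply: eq_bigr => p _.
by rewrite !rmorphM !fF !fqb !rmorphXn.
Qed.

(** By absolute values, a real number other than 1 and -1 is not a root of unity; this keeps all
    denominators nonzero. *)
Lemma one_sub_exp_neq0 (R : realDomainType) (q : R) n : q != 1 -> q != -1 ->
  1 - q ^+ n.+1 ^+ 2 != 0.
Proof.
move=> q1 qN1; rewrite subr_eq0 -exprM; apply/eqP => /(congr1
  Num.norm)/esym/eqP.
rewrite normr1 normrX pexpr_eq1 ?muln_gt0 //.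
by rewrite eqr_norml (negPf q1) (negPf qN1).
Qed.

Theorem theorem5p9 (R : realType) (q : R)
    (q_neq0 : q != 0) (q_neq1 : q != 1) (q_neqN1 : q != -1)
    (Delta : OUq q -> tensor (OUq q) (OUq q))
    (Delta_comult : is_comult Delta)
    (star : OUq q -> OUq q)
    (star_Uq : is_Uq_star star)
    (haar : OUq q -> R[i])
    (haar_Uq : is_haar_state Delta haar)
    (lambda1 lambda2 : nat)
    (lambda2_gt0 : (0 < lambda2)%N) (lambda1_gt : (lambda2 < lambda1)%N)
    (mu : 'I_3 -> nat) (T0 : tableau)
    (T0_top : top_tableau lambda1 lambda2 mu T0)
    (all_type_b : forall T, ssyt lambda1 lambda2 mu T -> type_b T)
    (i k d1 d2 d3 c2 c3 : nat)
    (i_basis : ssyt lambda1 lambda2 mu (iter i O2 T0))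
    (ik_basis : ssyt lambda1 lambda2 mu (iter (i + k) O2 T0))
    (k_le : (k <= minn d2 c2)%N) :
  let Q := real_complex R q in
  let b := gx Q o1 o2 in
  let c := gx Q o1 o3 in
  let g := gx Q o3 o1 in
  let h := gx Q o3 o2 in
  let gk := gx Q o3 o3 in
  let v := fun n : nat => xiT Q (iter n O2 T0) in
  v i = star gk ^+ d1 * (- Q *: star h) ^+ d2 * (Q ^+ 2 *: star g) ^+ d3
        * b ^+ c2 * c ^+ c3 * qdet Q ^+ (d1 + d2 + d3) ->
  v (i + k)%N =
        star gk ^+ (d1 + k) * (- Q *: star h) ^+ (d2 - k)
        * (Q ^+ 2 *: star g) ^+ d3
        * b ^+ (c2 - k) * c ^+ (c3 + k) * qdet Q ^+ (d1 + d2 + d3) ->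
  innerL star haar (v i) (v (i + k)%N) =
  ((q ^+ (2 * d2 * d3 + 2 * d1 * d2 + 2 * d1 * d3 + 4 * d3 + 4 * d1 + 4 * d2
          + 2 * c2 * c3 + 4 * c2 + 4 * c3 + k * (d2 + c2 - k))
    * ((1 - q ^+ 2) ^+ 2 * (1 - q ^+ 4)
       * qpoch (q ^+ 2) (q ^+ 2) d2 * qpoch (q ^+ 2) (q ^+ 2) c2
       / (qpoch (q ^+ 2) (q ^+ 2) (c2 + c3 + 1)
          * qpoch (q ^+ 2) (q ^+ 2) (d1 + d2 + d3 + 1)))
    * \sum_(j < d1.+1)
        ((-1) ^+ j * q ^+ (j ^ 2 - j) * qbinom (q ^+ 2) d1 j
           * qbinom (q ^+ 2) c3 j * qpoch (q ^+ 2) (q ^+ 2) j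
         / qpoch (q ^+ (2 * d3 + 2 * c2 + 2 * c3 + 2 * d1 - 2 * j + 4))
             (q ^+ 2) (d2 + 1)
         * \sum_(p < (d2 - k).+1)
             (q ^+ ((2 * c2 + 2 * c3 + 2 * d1 - 2 * j + 2) * p)
              * qpoch (q ^+ 2) (q ^+ 2) (c3 + d2 + d1 - j - p)
              * qpoch (q ^+ 2) (q ^+ 2) (d3 + p)
              * qbinom (q ^+ 2) (d2 - k) p)))%:C)%C.
Proof.
move=> Q b c g h gk v -> ->.
have Q0 : Q != 0 by rewrite fmorph_eq0.
have Q2n n : 1 - Q ^+ n.+1 ^+ 2 != 0.
  by rewrite -!rmorphXn -(rmorph1 (real_complex R)) -rmorphB fmorph_eq0
    one_sub_exp_neq0.
have Q21 : 1 - Q ^+ 2 != 0 := Q2n 0.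
move: k_le; rewrite leq_min => /andP[kd kc].
rewrite innerL_pairing //.
rewrite (@pairing_formE _ Q Q0 Q2n (Uq_pairing haar)) //; first last.
- exact: Uq_pairing0 haar_Uq.
- exact: Uq_pairing_row1 Q0 Q21 Delta_comult star_Uq haar_Uq Q2n.
- exact: Uq_pairing_row3 Q0 haar_Uq.
- exact: Uq_pairing_lower2 Q0 Q21 Delta_comult star_Uq haar_Uq.
- exact: Uq_pairing_root2 Q0 Q21 Delta_comult star_Uq haar_Uq.
- exact: Uq_pairing_root1 Q0 Q21 Delta_comult star_Uq haar_Uq.
by rewrite -[RHS]/(real_complex R (pairing_form q d1 d2 d3 c2 c3 k))
  pairing_form_morph.
Qed.
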